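(* Let $\Re(\mu)>0$. For the Seeley-de Witt coefficients $\tilde a_0[q_0],\tilde a_2[q_0],\tilde a_4[q_0]$ of the one-parametric family of Bianchi IX gravitational instantons, $$\tilde a_0[q_0](i\mu+1)=\tilde a_0[q_0-i](i\mu),\qquad \tilde a_0[q_0]\left(\tfrac i\mu\right)=-q_0^4\mu^2\,\tilde a_0\left[\tfrac1{q_0}\right](i\mu),$$ $$\tilde a_2[q_0](i\mu+1)=\tilde a_2[q_0-i](i\mu),\qquad \tilde a_2[q_0]\left(\tfrac i\mu\right)=q_0^2\mu^2\,\tilde a_2\left[\tfrac1{q_0}\right](i\mu),$$ $$\tilde a_4[q_0](i\mu+1)=\tilde a_4[q_0-i](i\mu),\qquad \tilde a_4[q_0]\left(\tfrac i\mu\right)=-\mu^2\,\tilde a_4\left[\tfrac1{q_0}\right](i\mu).$$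
   Context: General coefficients. Let $\sigma_1,\sigma_2,\sigma_3$ be the left-invariant 1-forms on $SU(2)\cong\mathbb S^3$ with $d\sigma_1=\sigma_2\wedge\sigma_3$ and cyclic permutations ($\int_{\mathbb S^3}|\sigma_1\wedge\sigma_2\wedge\sigma_3|=16\pi^2$). For functions $w_1,w_2,w_3,F$ of $\mu$ let $\tilde D$ be the Dirac operator (rank 4 spinors) of $d\tilde s^2 = F\left(w_1w_2w_3\,d\mu^2+\frac{w_2w_3}{w_1}\sigma_1^2+\frac{w_3w_1}{w_2}\sigma_2^2+\frac{w_1w_2}{w_3}\sigma_3^2\right)$, and consider $\mathrm{Trace}(\exp(-t\tilde D^2))\sim t^{-2}\sum_{n\ge0}\tilde a_{2n}t^n$, $t\to0^+$. Each coefficient is $\int(\cdot)\,d\mu$ of a function of $\mu$, obtained by integrating the local heat kernel coefficient of $\tilde D^2$ (times the volume density) over $\mathbb S^3$; this function of $\mu$ is again denoted $\tilde a_{2n}$, and it is a rational expression with rational coefficients in $w_1,w_2,w_3,F$ and their $\mu$-derivatives. Explicitly $\tilde a_0=4F^2w_1w_2w_3$ and $$\tilde a_2=-\tfrac F3(w_1^2+w_2^2+w_3^2)+\tfrac F6\Big(\tfrac{w_1^2w_2^2-w_3'^2}{w_3^2}+\tfrac{w_1^2w_3^2-w_2'^2}{w_2^2}+\tfrac{w_2^2w_3^2-w_1'^2}{w_1^2}\Big)-\tfrac F3\Big(\tfrac{w_1'w_2'}{w_1w_2}+\tfrac{w_1'w_3'}{w_1w_3}+\tfrac{w_2'w_3'}{w_2w_3}\Big)+\tfrac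 F3\Big(\tfrac{w_1''}{w_1}+\tfrac{w_2''}{w_2}+\tfrac{w_3''}{w_3}\Big)-\tfrac{F'^2}{2F}+F''.$$ One-parametric family. For $\Re(\mu)>0$ put $\vartheta_2(i\mu)=\sum_{m\in\mathbb Z}e^{-\pi(m+\frac12)^2\mu}$, $\vartheta_3(i\mu)=\sum_{m\in\mathbb Z}e^{-\pi m^2\mu}$, $\vartheta_4(i\mu)=\sum_{m\in\mathbb Z}(-1)^me^{-\pi m^2\mu}$, and for a parameter $q_0$ (allowed to be complex) $$w_j[q_0](i\mu)=\frac1{\mu+q_0}+2\frac{d}{d\mu}\log\vartheta_{j+1}(i\mu)\ (j=1,2,3),\qquad F[q_0](i\mu)=C(\mu+q_0)^2,$$ where $C>0$ is a fixed constant. $\tilde a_{2n}[q_0](i\mu)$ is the function obtained by substituting $w_j=w_j[q_0]$, $F=F[q_0]$ in the expression for $\tilde a_{2n}$, continued to complex $\mu$ with $\Re(\mu)>0$; parameters and points where a denominator vanishes (including $q_0=0$ where $1/q_0$ appears) are excluded. All these are functions of the variable $i\mu$; the value at $i\mu+1$ is the value at time $\mu-i$ and the value at $i/\mu$ is the value at time $1/\mu$ (derivatives being taken with respect to the time variable before evaluating). *)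

(* Defs.v *)
From HB Require Import structures.
From mathcomp Require Import all_boot all_order all_algebra.
From mathcomp Require Import all_classical all_reals all_analysis.
From mathcomp Require Import complex.
(* The notations of mpoly clash with those of mathcomp-analysis. *)
From mathcomp Require Import -(notations) mpoly.

Set Implicit Arguments.
Unset Strict Implicit.
Unset Printing Implicit Defensive.

Import Order.TTheory GRing.Theory Num.Theory.
Import numFieldNormedType.Exports.

Local Open Scope ring_scope.

(* Local heat kernel coefficients of the squared Dirac operator of the Bianchi
   IX metric, as functions of the jets (w k is the k-th derivative) of w1, w2,
   w3 and F at one time mu.

   Formal calculus at the point (mu, identity) of time x SU(2).  A unit
   quaternion q near 1 has coordinates y = Im q / Re q in K^3; 'X_0 is the time
   elapsed since mu and 'X_a (a = 1, 2, 3) is y_a.  Formal power series are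
   represented by polynomials, compared modulo terms of total degree > N. *)
Section HeatCoefficients.

Variable K : numClosedFieldType.

Local Notation P := (mpoly 4 K).
Local Notation M := 'M[P]_4.

Definition eq_upto (N : nat) (p q : P) : Prop :=
  forall m : multinom 4, (mdeg m <= N)%N -> mcoeff m p = mcoeff m q.

Definition eq_uptom (N : nat) (A B : M) : Prop :=
  forall i j, eq_upto N (A i j) (B i j).

Definition at0 (p : P) : K := mcoeff mnm0 p.

Definition var (i : 'I_4) : P := mpolyX K (mnm1 i).

Definition taylor (N : nat) (f : nat -> K) : P :=
  \sum_(k < N.+1) (f k / (k`!)%:R) *: var ord0 ^+ k.

Definition eps (a b c : nat) : K :=
  if (a, b, c) \in [:: (1, 2, 3); (2, 3, 1); (3, 1, 2)]%N then 1
  else if (a, b, c) \in [:: (2, 1, 3); (1, 3, 2); (3, 2, 1)]%N then -1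
  else 0.

(* vf 0 = d/dmu.  For a = 1, 2, 3, the field vf a is the left-invariant field
   q |-> - q e_a / 2, where e_1, e_2, e_3 are the quaternions i, j, k, that is,
   - (e_a + y x e_a + y_a y) / 2 in the coordinates y.
   Then [vf 1, vf 2] = - vf 3 and cyclically, so that the dual 1-forms satisfy
   d sigma_1 = sigma_2 /\ sigma_3 and cyclically. *)
Definition vf (a : 'I_4) (f : P) : P :=
  if a == ord0 then mderiv ord0 f
  else - (2^-1 : K) *: \sum_(b < 4 | b != ord0)
         ((a == b)%:R + var a * var b
          + \sum_(d < 4 | d != ord0) eps a b d *: var d) * mderiv b f.

(* Lengths of the fields vf 0, ..., vf 3 and their inverses, as series. *)
Record lengths := Lengths { len : 'I_4 -> P; ilen : 'I_4 -> P }.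

(* With h ^ 2 = F w1 w2 w3, the metric is
   h ^ 2 (dmu ^ 2 + \sum_a sigma_a ^ 2 / w_a ^ 2).
   The sign of h does not matter: it changes the Dirac operator into its
   opposite. *)
Definition metric_lengths (N : nat) (w1 w2 w3 F : nat -> K) (l : lengths) :
    Prop :=
  [/\ eq_upto N (len l ord0 ^+ 2)
        (taylor N F * taylor N w1 * taylor N w2 * taylor N w3),
      eq_upto N (len l (inord 1) * taylor N w1) (len l ord0),
      eq_upto N (len l (inord 2) * taylor N w2) (len l ord0),
      eq_upto N (len l (inord 3) * taylor N w3) (len l ord0)
    & forall a, eq_upto N (len l a * ilen l a) 1].

Definition fr (l : lengths) (a : 'I_4) (f : P) : P := ilen l a * vf a f.

(* <[fr a, fr b], fr d>, with [vf a, vf b] = - \sum_d eps a b d vf d. *)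
Definition struct_coef (l : lengths) (a b d : 'I_4) : P :=
  ((b == d)%:R * (ilen l a * vf a (ilen l b))
   - (a == d)%:R * (ilen l b * vf b (ilen l a))
   - eps a b d *: (ilen l a * ilen l b)) * len l d.

(* <nabla_(fr a) (fr b), fr d>, by the Koszul formula. *)
Definition levi_civita (l : lengths) (a b d : 'I_4) : P :=
  (2^-1 : K) *: (struct_coef l a b d - struct_coef l b d a + struct_coef l d a b).

Definition pauli (a : nat) : 'M[K]_2 :=
  \matrix_(i, j) match a with
  | 1%N => (i != j)%:R
  | 2%N => if i == j then 0 else if i == ord0 then - 'i else 'i
  | _ => if i != j then 0 else if i == ord0 then 1 else -1
  end.

(* gamma_a gamma_b + gamma_b gamma_a = - 2 delta_ab. *)
Definition gamma (a : 'I_4) : 'M[K]_4 :=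
  if a == ord0 then block_mx 0 (- 1%:M) 1%:M 0 :> 'M[K]_(2 + 2)
  else 'i *: (block_mx 0 (pauli a) (pauli a) 0 : 'M[K]_(2 + 2)).

Definition gammaP (a : 'I_4) : M := map_mx (@mpolyC 4 K) (gamma a).

Definition spin_nabla (l : lengths) (a : 'I_4) (u : M) : M :=
  map_mx (fr l a) u
  + (4^-1 : K)%:A *:
      \sum_(b < 4) \sum_(d < 4) levi_civita l a b d *: (gammaP b *m gammaP d *m u).

(* The Dirac operator, on endomorphisms of the spinor bundle acting on a fixed
   fibre, i.e., column by column. *)
Definition dirac (l : lengths) (u : M) : M :=
  \sum_(a < 4) gammaP a *m spin_nabla l a u.

(* Clifford multiplication by the gradient of s. *)
Definition cliff_grad (l : lengths) (s : P) : M :=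
  \sum_(a < 4) fr l a s *: gammaP a.

(* s is the squared geodesic distance to the base point. *)
Definition sq_distance (N : nat) (l : lengths) (s : P) : Prop :=
  [/\ eq_upto N (\sum_(a < 4) fr l a s ^+ 2) (4 *: s),
      at0 s = 0,
      forall a, at0 (fr l a s) = 0
    & forall a b, at0 (fr l a (fr l b s)) = 2 * (a == b)%:R].

(* The formal heat kernel
     k_t = (4 pi t)^-2 exp (- s / 4t) (u 0 + t u 1 + t ^ 2 u 2 + ...)
   satisfies (d/dt + D ^ 2) k_t = 0 and u 0 = 1 at the base point.
   Since D o exp (- s / 4t) = exp (- s / 4t) o (D - c / 4t), with
   c = cliff_grad s and c ^ 2 = - 4 s, the coefficient of
   (4 pi)^-2 t ^ (k - 3) exp (- s / 4t) in the heat equation is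
     (k - 2) u_k - (D (c u_k) + c (D u_k)) / 4 + D ^ 2 u_(k-1). *)
Definition heat_series (N : nat) (l : lengths) (s : P) (u : nat -> M) : Prop :=
  [/\ sq_distance N l s,
      map_mx at0 (u 0%N) = 1%:M
    & forall k : nat,
        eq_uptom N
          ((k%:R - 2) *: u k
           - (4^-1 : K)%:A *: (dirac l (cliff_grad l s *m u k)
                               + cliff_grad l s *m dirac l (u k))
           + (if k is k'.+1 then dirac l (dirac l (u k')) else 0))
          0].

(* a is the trace of the n-th local heat kernel coefficient at the identity of
   SU(2) times the density of the volume form F ^ 2 w1 w2 w3 dmu /\ sigma_1 /\
   sigma_2 /\ sigma_3, integrated over SU(2).  By left invariance the integral
   is the value at the identity times 16 pi ^ 2, which cancels (4 pi)^-2. *)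
Definition is_heat_coef (n : nat) (w1 w2 w3 F : nat -> K) (a : K) : Prop :=
  forall N : nat, exists (l : lengths) (s : P) (u : nat -> M),
    [/\ metric_lengths N w1 w2 w3 F l,
        heat_series N l s u
      & a = F 0%N ^+ 2 * w1 0%N * w2 0%N * w3 0%N * \tr (map_mx at0 (u n))].

Definition a0 (w1 w2 w3 F : nat -> K) : K :=
  4 * F 0%N ^+ 2 * w1 0%N * w2 0%N * w3 0%N.

Definition a2 (w1 w2 w3 F : nat -> K) : K :=
  let: (x1, x2, x3, f) := (w1 0, w2 0, w3 0, F 0)%N in
  let: (x1', x2', x3', f') := (w1 1, w2 1, w3 1, F 1)%N in
  let: (x1'', x2'', x3'', f'') := (w1 2, w2 2, w3 2, F 2)%N in
  - (f / 3) * (x1 ^+ 2 + x2 ^+ 2 + x3 ^+ 2)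
  + f / 6 * ((x1 ^+ 2 * x2 ^+ 2 - x3' ^+ 2) / x3 ^+ 2
             + (x1 ^+ 2 * x3 ^+ 2 - x2' ^+ 2) / x2 ^+ 2
             + (x2 ^+ 2 * x3 ^+ 2 - x1' ^+ 2) / x1 ^+ 2)
  - f / 3 * (x1' * x2' / (x1 * x2) + x1' * x3' / (x1 * x3)
             + x2' * x3' / (x2 * x3))
  + f / 3 * (x1'' / x1 + x2'' / x2 + x3'' / x3)
  - f' ^+ 2 / (2 * f) + f''.

(* There is exactly one heat coefficient when w1, w2, w3, F do not vanish at the
   base point: s and u are determined degree by degree, since the gradient of s
   is twice the Euler field up to terms of higher order. *)
Definition a4 (w1 w2 w3 F : nat -> K) : K :=
  xget 0 [set a | is_heat_coef 2 w1 w2 w3 F a]%classic.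

End HeatCoefficients.

(* Complex numbers, with the topology and the complex derivatives that
   mathcomp-analysis puts on every numFieldType. *)
Definition CC (R : realType) : numClosedFieldType := R[i].

Section Family.

Variable R : realType.

Local Notation C := (CC R).

Definition cexp (z : C) : C :=
  (expR (complex.Re z))%:C%C
  * ((cos (complex.Im z))%:C%C + 'i * (sin (complex.Im z))%:C%C).

Definition bisum (f : int -> C) : C :=
  limn (series (fun n : nat => f (Posz n)))
  + limn (series (fun n : nat => f (Negz n))).

(* theta k mu is the value of the theta function of index k = 2, 3, 4 at the
   modular variable i mu. *)
Definition theta (k : nat) (mu : C) : C :=
  let piC : C := (pi : R)%:C%C in
  match k with
  | 2%N => bisum (fun m => cexp (- piC * (m%:~R + 2^-1) ^+ 2 * mu))
  | 3%N => bisum (fun m => cexp (- piC * m%:~R ^+ 2 * mu))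
  | _ => bisum (fun m => (-1) ^ m * cexp (- piC * m%:~R ^+ 2 * mu))
  end.

Definition w (j : nat) (q0 mu : C) : C :=
  (mu + q0)^-1 + 2 * (derive1 (theta j.+1) mu / theta j.+1 mu).

Definition F (c : R) (q0 mu : C) : C := c%:C%C * (mu + q0) ^+ 2.

Definition jet (f : C -> C) (mu : C) (k : nat) : C := derive1n k f mu.

(* Substitution of the family in an expression in the jets of w1, w2, w3, F;
   the last argument is the time mu (modular variable i mu). *)
Definition on_family
    (A : (nat -> C) -> (nat -> C) -> (nat -> C) -> (nat -> C) -> C)
    (c : R) (q0 mu : C) : C :=
  A (jet (w 1 q0) mu) (jet (w 2 q0) mu) (jet (w 3 q0) mu) (jet (F c q0) mu).

Definition atilde0 := on_family (@a0 C).
Definition atilde2 := on_family (@a2 C).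
Definition atilde4 := on_family (@a4 C).

(* The denominators of w1, w2, w3 do not vanish at time mu. *)
Definition w_defined (q0 mu : C) : Prop :=
  mu + q0 != 0 /\ forall k : nat, (2 <= k <= 4)%N -> theta k mu != 0.

(* Moreover the denominators w1, w2, w3, F of a2 and a4 do not vanish. *)
Definition regular (q0 mu : C) : Prop :=
  w_defined q0 mu /\ forall j : nat, (1 <= j <= 3)%N -> w j q0 mu != 0.

End Family.

(* Main.v *)
Require Import Defs.
From mathcomp Require Import all_boot all_order all_algebra.
From mathcomp Require Import all_classical all_reals all_analysis.
From mathcomp Require Import complex.
From mathcomp Require Import ring lra zify.
From mathcomp Require Import -(notations) mpoly.

(* Translation by - i and inversion both act on the family through a change of
   the time variable r: w_j[q](r(mu)) r'(mu) = w_j'[q'](mu), where j -> j'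
   exchanges 2 and 3 for r(mu) = mu - i and 1 and 3 for r(mu) = 1 / mu, and
   F[q](r(mu)) = d r'(mu) F[q'](mu) with d = 1, resp. d = - q ^ 2.  Hence the
   two metrics are homothetic, by a map that exchanges two of the invariant
   fields of SU(2) up to sign.  It acts on formal heat kernels by substitution
   in the coordinates and conjugation by sigma_i - sigma_j on spinors; as the
   formal heat kernel is unique, this gives the rules for a4.  Those for a0 and
   a2 are computations with jets.

   The rules for w_j under inversion are the logarithmic derivatives of the
   theta inversion formulas.  Up to a factor independent of z,
     sum_m exp (- pi mu (z + m) ^ 2)  and
     sum_k exp (- pi k ^ 2 / mu + 2 pi i k z)
   are equal: the discrete Fourier coefficients of z -> exp (- pi mu z ^ 2),
   sampled with step 1 / N, tend to multiples of the Gaussians in k.  The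
   logarithmic derivatives do not see the factor, and the second derivatives in
   z at z = 0 and z = 1 / 2 are derivatives in mu by the heat equation. *)

Set Implicit Arguments.
Unset Strict Implicit.
Unset Printing Implicit Defensive.

Import Order.TTheory GRing.Theory Num.Theory.
Import numFieldNormedType.Exports.

Local Open Scope ring_scope.

(** * Filtration of formal series by the order at the origin *)

Section Filtration.

Variable K : numClosedFieldType.

Local Notation P := (mpoly 4 K).

(** [a4] is a choice in the set of heat coefficients, so no heat kernel is constructed: a homothety
    carries the coefficients of one metric to those of the other, and the choices then correspond.
    Each derivative lowers the order to which a truncated series is known; as the definition
    quantifies over all orders, it suffices to start a few orders higher. If the pulled-back metric
    is [d] times the new one, the trace of [u n] is multiplied by [d ^ n], the density
    [F ^ 2 w1 w2 w3] contributes [r'(mu) / d ^ 2], and for [n = 2] only [r'(mu)] survives: this is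
    why no power of [q] occurs in the rules for [a4]. For inversion [d = - q ^ 2] is in general not
    positive; the formal calculus over a closed field allows its square root as a scaling factor. On
    the theta side, proportionality leaves the Gaussian integral uncomputed. The price is that the
    zeros of the two sides must be matched before dividing, hence the nonvanishing statements for
    [gsum] and [hsum]. *)

Definition ordge (n : nat) (p : P) : Prop :=
  forall m : multinom 4, (mdeg m < n)%N -> mcoeff m p = 0.

Lemma ordge0 p : ordge 0 p.
Proof. by []. Qed.

Lemma ordge_0 n : ordge n 0.
Proof. by move=> m _; rewrite mcoeff0. Qed.

Lemma ordgeW n k p : (k <= n)%N -> ordge n p -> ordge k p.
Proof. by move=> kn H m mk; apply: H; apply: leq_trans kn. Qed.

Lemma ordgeD n p q : ordge n p -> ordge n q -> ordge n (p + q).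
Proof. by move=> Hp Hq m mn; rewrite mcoeffD Hp ?Hq ?addr0. Qed.

Lemma ordgeN n p : ordge n p -> ordge n (- p).
Proof. by move=> Hp m mn; rewrite mcoeffN Hp ?oppr0. Qed.

Lemma ordgeB n p q : ordge n p -> ordge n q -> ordge n (p - q).
Proof. by move=> Hp Hq; apply: ordgeD => //; apply: ordgeN. Qed.

Lemma ordgeZ n c p : ordge n p -> ordge n (c *: p).
Proof. by move=> Hp m mn; rewrite mcoeffZ Hp ?mulr0. Qed.

Lemma ordgeZ_inv n c p : c != 0 -> ordge n (c *: p) -> ordge n p.
Proof.
move=> c0 H; have := ordgeZ c^-1 H.
by rewrite scalerA mulVf // scale1r.
Qed.

Lemma ordge_sum n (I : Type) (r : seq I) (Q : pred I) (f : I -> P) :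
  (forall i, Q i -> ordge n (f i)) -> ordge n (\sum_(i <- r | Q i) f i).
Proof.
move=> H; elim/big_ind: _ => //; first exact: ordge_0.
exact: ordgeD.
Qed.

Lemma ordgeM a b p q : ordge a p -> ordge b q -> ordge (a + b) (p * q).
Proof.
move=> Hp Hq m mab.
have [mx|] := boolP (m \in msupp (p * q)); last first.
  by rewrite -mcoeff_eq0 => /eqP.
have /allpairsP [[m1 m2] /= [m1p m2q Em]] := msuppM_le mx.
move: m1p m2q; rewrite !mcoeff_msupp => m1p m2q.
have [m1a|m1a] := ltnP (mdeg m1) a; first by rewrite Hp ?eqxx in m1p.
have [m2b|m2b] := ltnP (mdeg m2) b; first by rewrite Hq ?eqxx in m2q.
move: mab; rewrite Em mdegD => mab.
by have := leq_add m1a m2b; rewrite leqNgt mab.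
Qed.

Lemma ordgeMl n p q : ordge n q -> ordge n (p * q).
Proof. by move=> H; have := ordgeM (ordge0 p) H. Qed.

Lemma ordgeMr n p q : ordge n p -> ordge n (p * q).
Proof. by rewrite mulrC; exact: ordgeMl. Qed.

Lemma ordgeX p i : ordge 1 p -> ordge i (p ^+ i).
Proof.
move=> Hp; elim: i => [|i IH]; first exact: ordge0.
by rewrite exprS -add1n; apply: ordgeM.
Qed.

Lemma ordge_var i : ordge 1 (@var K i).
Proof.
move=> m; rewrite ltnS leqn0 mdeg_eq0 => /eqP ->.
rewrite /var mcoeffX; case: eqP => // /(congr1 (@mdeg 4)).
by rewrite mdeg1 mdeg0.
Qed.

Lemma ordge_mderiv n i p : ordge n.+1 p -> ordge n (mderiv i p).
Proof.
move=> H m mn; rewrite mcoeff_mderiv H ?mul0rn //.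
by rewrite mdegD mdeg1 addn1.
Qed.

Lemma ordge1E p : ordge 1 p <-> at0 p = 0.
Proof.
split; first by move=> H; apply: H; rewrite mdeg0.
by move=> H m; rewrite ltnS leqn0 mdeg_eq0 => /eqP ->.
Qed.

Lemma at0D (p q : P) : at0 (p + q) = at0 p + at0 q.
Proof. exact: mcoeffD. Qed.

Lemma at0B (p q : P) : at0 (p - q) = at0 p - at0 q.
Proof. exact: mcoeffB. Qed.

Lemma at0Z c (p : P) : at0 (c *: p) = c * at0 p.
Proof. exact: mcoeffZ. Qed.

Lemma at0C (c : K) : at0 (mpolyC 4 c) = c.
Proof. by rewrite /at0 mcoeffC eqxx mulr1. Qed.

Lemma at0_1 : at0 (1 : P) = 1.
Proof. exact: at0C. Qed.

Lemma at0M (p q : P) : at0 (p * q) = at0 p * at0 q.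
Proof. exact: (rmorphM (mcoeff (mnm0 : multinom 4))). Qed.

Lemma at0_sum (I : Type) (r : seq I) (Q : pred I) (f : I -> P) :
  at0 (\sum_(i <- r | Q i) f i) = \sum_(i <- r | Q i) at0 (f i).
Proof. exact: (raddf_sum (mcoeff (mnm0 : multinom 4))). Qed.

Lemma at0X (p : P) n : at0 (p ^+ n) = at0 p ^+ n.
Proof. by elim: n => [|n IH]; rewrite ?expr0 ?at0_1 // !exprS at0M IH. Qed.

(** A coefficient whose exponent of ['X_i] is positive is, up to that exponent, a coefficient of the
    i-th partial derivative; characteristic 0 allows the division. *)
Lemma ordge_Sn n p :
  at0 p = 0 -> (forall i, ordge n (mderiv i p)) -> ordge n.+1 p.
Proof.
move=> p0 H m mn; have [->//|m0] := eqVneq m mnm0.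
have /existsP [i mi] : [exists i : 'I_4, (0 < m i)%N].
  apply: contraR m0 => /existsPn h; apply/eqP/mnmP => i.
  by rewrite mnm0E; apply/eqP; rewrite -leqn0 leqNgt h.
have Hle := lep1mP i m; rewrite -lt0n mi in Hle.
have := H i (mnm_sub m (mnm1 i)); rewrite mcoeff_mderiv submK // => h.
have /eqP : mcoeff m p *+ ((mnm_sub m (mnm1 i)) i).+1 = 0.
  apply: h; rewrite -(submK Hle) mdegD mdeg1 addn1 ltnS in mn.
  by [].
by rewrite mulrn_eq0 /= => /eqP.
Qed.

(** Here [n] bounds the order of the difference, whereas [eq_upto] bounds the degrees compared;
    hence the shift by one in [eq_uptoE]. A derivation lowers the index by one. *)
Definition eqo (n : nat) (p q : P) : Prop := ordge n (p - q).

Lemma eq_uptoE n p q : eq_upto n p q <-> eqo n.+1 p q.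
Proof.
split=> H m mn; first by rewrite mcoeffB H ?subrr.
by apply/eqP; rewrite -subr_eq0 -mcoeffB H.
Qed.

Lemma eqo_refl n p : eqo n p p.
Proof. by rewrite /eqo subrr; exact: ordge_0. Qed.

Lemma eqo_eq n p q : p = q -> eqo n p q.
Proof. by move=> ->; exact: eqo_refl. Qed.

Lemma eqo_sym n p q : eqo n p q -> eqo n q p.
Proof. by rewrite /eqo => /ordgeN; rewrite opprB. Qed.

Lemma eqo_trans n q p r : eqo n p q -> eqo n q r -> eqo n p r.
Proof. by move=> h1 h2; have := ordgeD h1 h2; rewrite addrA subrK. Qed.

Lemma eqoW n k p q : (k <= n)%N -> eqo n p q -> eqo k p q.
Proof. exact: ordgeW. Qed.

Lemma eqo0 n p : eqo n p 0 <-> ordge n p.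
Proof. by rewrite /eqo subr0. Qed.

Lemma eqoD n p q p' q' : eqo n p p' -> eqo n q q' -> eqo n (p + q) (p' + q').
Proof. by move=> h1 h2; have := ordgeD h1 h2; rewrite addrACA -opprD. Qed.

Lemma eqoN n p p' : eqo n p p' -> eqo n (- p) (- p').
Proof. by move=> /ordgeN; rewrite opprD. Qed.

Lemma eqoB n p q p' q' : eqo n p p' -> eqo n q q' -> eqo n (p - q) (p' - q').
Proof. by move=> h1 h2; apply: eqoD => //; apply: eqoN. Qed.

Lemma eqoZ n c p p' : eqo n p p' -> eqo n (c *: p) (c *: p').
Proof. by move=> h; have := ordgeZ c h; rewrite scalerBr. Qed.

Lemma eqoM n p q p' q' : eqo n p p' -> eqo n q q' -> eqo n (p * q) (p' * q').
Proof.
move=> h1 h2; rewrite /eqo.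
have -> : p * q - p' * q' = p * (q - q') + (p - p') * q' by ring.
by apply: ordgeD; [apply: ordgeMl | apply: ordgeMr].
Qed.

Lemma eqoX n p p' k : eqo n p p' -> eqo n (p ^+ k) (p' ^+ k).
Proof.
move=> h; elim: k => [|k IH]; rewrite ?expr0 ?exprS; first exact: eqo_refl.
exact: eqoM.
Qed.

Lemma eqo_sum n (I : Type) (r : seq I) (Q : pred I) (f g : I -> P) :
  (forall i, Q i -> eqo n (f i) (g i)) ->
  eqo n (\sum_(i <- r | Q i) f i) (\sum_(i <- r | Q i) g i).
Proof. by move=> H; rewrite /eqo -sumrB; apply: ordge_sum. Qed.

Lemma eqo_at0 n p q : (0 < n)%N -> eqo n p q -> at0 p = at0 q.
Proof.
move=> n0 /(ordgeW n0) /ordge1E /eqP.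
by rewrite at0B subr_eq0 => /eqP.
Qed.

(** The order of [p] is raised one step at a time: up to [p * q], the multiple [at0 q *: p] equals
    [p] times a series without constant term. *)
Lemma ordge_unit n p q : at0 q != 0 -> ordge n (p * q) -> ordge n p.
Proof.
move=> q0 H; suff : forall k, (k <= n)%N -> ordge k p by apply.
elim=> [|k IH] kn; first exact: ordge0.
apply: (ordgeZ_inv q0); rewrite -addn1.
have -> : at0 q *: p = p * q - p * (q - mpolyC 4 (at0 q)).
  rewrite -mul_mpolyC; ring.
apply: ordgeB; first by apply: (ordgeW _ H); rewrite addn1.
apply: ordgeM; first by apply: IH; apply: ltnW.
by apply/ordge1E; rewrite at0B at0C subrr.
Qed.

Lemma eqo_mulIr n p p' q : at0 q != 0 -> eqo n (p * q) (p' * q) -> eqo n p p'.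
Proof. by move=> q0; rewrite /eqo -mulrBl; exact: ordge_unit. Qed.

(** Newton's iteration, which squares the error [p * q - 1]. The first inverse, a constant, is
    separate because squaring does not improve an error of order 0. *)
Lemma eqo_inv_ex n p : at0 p != 0 -> exists q, eqo n (p * q) 1.
Proof.
move=> p0; elim: n => [|n [q Hq]]; first by exists 0; apply: ordge0.
case: n Hq => [_|n Hq].
  exists (mpolyC 4 (at0 p)^-1); apply/ordge1E.
  by rewrite at0B at0M at0C at0_1 mulfV ?subrr.
exists (q + q * (1 - p * q)); rewrite /eqo.
have -> : p * (q + q * (1 - p * q)) - 1 = - ((p * q - 1) * (p * q - 1)).
  ring.
apply: ordgeN; apply: (@ordgeW (n.+1 + n.+1)); last exact: ordgeM.
by rewrite addnS ltnS leq_addr.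
Qed.

Lemma eqo_inv_uniq n p p' q q' :
  eqo n p p' -> eqo n (p * q) 1 -> eqo n (p' * q') 1 -> eqo n q q'.
Proof.
move=> pp h h'.
apply: (@eqo_trans _ (q * (p' * q'))).
  apply: eqo_sym; rewrite -[X in eqo _ _ X]mulr1.
  by apply: eqoM => //; exact: eqo_refl.
rewrite mulrA -[X in eqo _ _ X]mul1r.
apply: eqoM; last exact: eqo_refl.
apply: eqo_trans h; rewrite mulrC; apply: eqoM; last exact: eqo_refl.
exact: eqo_sym.
Qed.

(** Euler's identity on the part of degree [n]; replacing [v i] by its linear part makes an error of
    order [2 + (n - 1)]. For [n = 0] it is enough that [v i] vanishes at the origin. *)
Lemma euler_field n c (v : 'I_4 -> P) p :
  (forall i, eqo 2 (v i) (c *: var K i)) -> ordge n p ->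
  eqo n.+1 (\sum_(i < 4) v i * mderiv i p) ((c * n%:R) *: p).
Proof.
move=> Hv Hp.
case: n Hp => [|n] Hp.
  rewrite mulr0 scale0r; apply/eqo0; apply: ordge_sum => i _.
  apply: ordgeMr; rewrite -[v i](subrK (c *: var K i)).
  apply: ordgeD; first exact: ordgeW (Hv i).
  by apply: ordgeZ; exact: ordge_var.
apply: (@eqo_trans _ (\sum_(i < 4) (c *: var K i) * mderiv i p)).
  apply: eqo_sum => i _; rewrite /eqo -mulrBl.
  by rewrite -[n.+2]/(2 + n)%N; apply: ordgeM (Hv i) _; exact: ordge_mderiv.
move=> m; rewrite ltnS => mn.
under eq_bigr do rewrite -scalerAl.
rewrite -scaler_sumr -scalerA -scalerBr mcoeffZ mcoeffB mcoeffZ.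
(* The Euler field multiplies the coefficient of [m] by its degree; below degree [n] the coefficient
   is 0, and in degree [n] the factor is [n]. *)
rewrite [X in _ * (X - _)](_ : _ = (mdeg m)%:R * mcoeff m p).
  move: mn; rewrite leq_eqVlt => /orP [/eqP ->|mn].
    by rewrite subrr mulr0.
  by rewrite Hp // !mulr0 subrr mulr0.
rewrite raddf_sum mdegE natr_sum mulr_suml; apply: eq_bigr => i _.
rewrite /var mulrC.
have [mi|mi] := eqVneq (m i) 0%N.
  rewrite mi mul0r /=.
  have [mx|] := boolP (m \in msupp (mderiv i p * mpolyX K (mnm1 i))); last first.
    by rewrite -mcoeff_eq0 => /eqP.
  have /allpairsP [[m1 m2] /= [_]] := msuppM_le mx.
  rewrite msuppX inE => /eqP -> Em.
  by move: mi; rewrite Em mnmDE mnm1E eqxx addn1.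
have Hle := lep1mP i m; rewrite mi in Hle.
have E q : mcoeff m (q * mpolyX K (mnm1 i)) = mcoeff (mnm_sub m (mnm1 i)) q.
  by rewrite -[in LHS](submK Hle) addmC mcoeffMX.
rewrite [LHS]E mcoeff_mderiv submK // mulr_natl.
by rewrite mnmBE mnm1E eqxx subn1 prednK ?lt0n.
Qed.

End Filtration.

(** * Derivations along the frame and uniqueness of the squared distance *)

Section Dirac.

Variable K : numClosedFieldType.
Implicit Types (p q s : mpoly 4 K) (l : lengths K) (t : K).

Local Notation P := (mpoly 4 K).
Local Notation M := 'M[P]_4.

Definition vfield (v : 'I_4 -> P) (p : P) : P := \sum_(i < 4) v i * mderiv i p.

Lemma vfield_var v i : vfield v (var K i) = v i.
Proof.
rewrite /vfield (bigD1 i) //= big1 => [|j ji].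
  have -> : mderiv i (var K i) = 1.
    rewrite /var mderivX mnm1E eqxx scale1r -mpolyX0; congr mpolyX.
    by apply/mnmP => j; rewrite mnmBE subnn mnm0E.
  by rewrite mulr1 addr0.
by rewrite /var mderivX mnm1E eq_sym (negbTE ji) scale0r mulr0.
Qed.

Lemma vfieldM v p q : vfield v (p * q) = vfield v p * q + p * vfield v q.
Proof.
rewrite /vfield mulr_suml mulr_sumr -big_split; apply: eq_bigr => i _ /=.
by rewrite mderivM; ring.
Qed.

Lemma vfieldD v p q : vfield v (p + q) = vfield v p + vfield v q.
Proof.
by rewrite /vfield -big_split; apply: eq_bigr => i _ /=; rewrite mderivD mulrDr.
Qed.

Lemma vfieldZ v c p : vfield v (c *: p) = c *: vfield v p.
Proof.
by rewrite /vfield scaler_sumr; apply: eq_bigr => i _; rewrite mderivZ scalerAr.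
Qed.

(** Components of [vf a] in the coordinates, so that the Leibniz rule and the order estimates are
    proved once, for [vfield]. *)
Definition vfc (a i : 'I_4) : P :=
  if a == ord0 then (i == ord0)%:R
  else if i == ord0 then 0
  else - (2^-1 : K) *: ((a == i)%:R + var K a * var K i
       + \sum_(d < 4 | d != ord0) eps K a i d *: var K d).

Lemma vf_vfield a p : vf a p = vfield (vfc a) p.
Proof.
rewrite /vf /vfield /vfc; case: eqP => [_|_].
  rewrite (bigD1 ord0) //= mul1r big1 ?addr0 // => i /negbTE ->.
  by rewrite mul0r.
rewrite [RHS](bigD1 ord0) //= mul0r add0r scaler_sumr.
by apply: eq_bigr => i /negbTE ->; rewrite scalerAl.
Qed.

Definition frc (l : lengths K) (a i : 'I_4) : P := ilen l a * vfc a i.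

Lemma fr_vfield l a p : fr l a p = vfield (frc l a) p.
Proof.
by rewrite /fr vf_vfield /vfield mulr_sumr; apply: eq_bigr => i _; rewrite mulrA.
Qed.

Lemma vfM a (p q : P) : vf a (p * q) = vf a p * q + p * vf a q.
Proof. by rewrite !vf_vfield vfieldM. Qed.

Lemma vfD a (p q : P) : vf a (p + q) = vf a p + vf a q.
Proof. by rewrite !vf_vfield vfieldD. Qed.

Lemma vfZ a c (p : P) : vf a (c *: p) = c *: vf a p.
Proof. by rewrite !vf_vfield vfieldZ. Qed.

Lemma frM l a p q : fr l a (p * q) = fr l a p * q + p * fr l a q.
Proof. by rewrite !fr_vfield vfieldM. Qed.

Lemma frD l a p q : fr l a (p + q) = fr l a p + fr l a q.
Proof. by rewrite !fr_vfield vfieldD. Qed.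

Lemma frZ l a c p : fr l a (c *: p) = c *: fr l a p.
Proof. by rewrite !fr_vfield vfieldZ. Qed.

Lemma frN l a p : fr l a (- p) = - fr l a p.
Proof. by rewrite -scaleN1r frZ scaleN1r. Qed.

Lemma frB l a p q : fr l a (p - q) = fr l a p - fr l a q.
Proof. by rewrite frD frN. Qed.

Lemma fr0 l a : fr l a 0 = 0.
Proof. by rewrite -(scale0r 0) frZ !scale0r. Qed.

Lemma frC l a c : fr l a (mpolyC 4 c) = 0.
Proof.
rewrite fr_vfield /vfield big1 // => i _; by rewrite mderivC mulr0.
Qed.

Lemma fr_sum l a (I : Type) (r : seq I) (Q : pred I) (f : I -> P) :
  fr l a (\sum_(i <- r | Q i) f i) = \sum_(i <- r | Q i) fr l a (f i).
Proof. by apply: (big_morph (fr l a)) => [p q|]; rewrite ?frD ?fr0. Qed.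

Lemma vf_ordge n a (p : P) : ordge n.+1 p -> ordge n (vf a p).
Proof.
move=> h; rewrite vf_vfield; apply: ordge_sum => i _; apply: ordgeMl.
exact: ordge_mderiv.
Qed.

Lemma vf_eqo n a (p q : P) : eqo n.+1 p q -> eqo n (vf a p) (vf a q).
Proof.
rewrite /eqo => /(@vf_ordge _ a _).
by rewrite vfD -[- q]scaleN1r vfZ scaleN1r.
Qed.

Lemma fr_ordge n l a p : ordge n.+1 p -> ordge n (fr l a p).
Proof. by move=> h; apply: ordgeMl; apply: vf_ordge. Qed.

Lemma fr_eqo n l a p q : eqo n.+1 p q -> eqo n (fr l a p) (fr l a q).
Proof. by rewrite /eqo => /(fr_ordge l a); rewrite frB. Qed.

Definition vf_scale (a : 'I_4) : K := if a == ord0 then 1 else - 2^-1.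

Lemma vf_scale_neq0 a : vf_scale a != 0.
Proof.
rewrite /vf_scale; case: (a == ord0); first exact: oner_neq0.
by rewrite oppr_eq0 invr_eq0 pnatr_eq0.
Qed.

Lemma at0_var i : at0 (var K i) = 0.
Proof. by apply/ordge1E; exact: ordge_var. Qed.

Lemma at0_vfc a i : at0 (vfc a i) = vf_scale a * (a == i)%:R.
Proof.
rewrite /vfc /vf_scale.
have E (b : bool) : at0 (b%:R : P) = b%:R.
  by case: b; rewrite ?at0_1 // /at0 mcoeff0.
case: (eqVneq a ord0) => [->|a0].
  by rewrite mul1r E eq_sym.
have E0 : at0 (0 : P) = 0 by rewrite /at0 mcoeff0.
case: (eqVneq i ord0) => [->|i0]; first by rewrite (negbTE a0) mulr0 E0.
rewrite at0Z !at0D at0M !at0_var mul0r addr0 E at0_sum big1 ?addr0 // => d _.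
by rewrite at0Z at0_var mulr0.
Qed.

Lemma at0_vf a p : at0 (vf a p) = vf_scale a * at0 (mderiv a p).
Proof.
rewrite vf_vfield /vfield at0_sum (bigD1 a) //= big1 => [|i ia].
  by rewrite at0M at0_vfc eqxx mulr1 addr0.
by rewrite at0M at0_vfc eq_sym (negbTE ia) mulr0 mul0r.
Qed.

Lemma at0_fr l a p :
  at0 (fr l a p) = at0 (ilen l a) * vf_scale a * at0 (mderiv a p).
Proof. by rewrite /fr at0M at0_vf mulrA. Qed.

Lemma at0_frM l a p q :
  at0 (fr l a (p * q)) = at0 (fr l a p) * at0 q + at0 p * at0 (fr l a q).
Proof. by rewrite frM at0D (at0M (fr l a p)) (at0M p). Qed.

Lemma at0_fr_sumM l a (f g : 'I_4 -> P) : (forall b, at0 (f b) = 0) ->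
  at0 (fr l a (\sum_(b < 4) f b * g b)) =
  \sum_(b < 4) at0 (fr l a (f b)) * at0 (g b).
Proof.
move=> f0; rewrite fr_sum at0_sum; apply: eq_bigr => b _.
by rewrite at0_frM f0 mul0r addr0.
Qed.

Definition nondeg (l : lengths K) : Prop := forall a, at0 (ilen l a) != 0.

Lemma fr_ordge2 l p : nondeg l ->
  at0 p = 0 -> (forall a, at0 (fr l a p) = 0) -> ordge 2 p.
Proof.
move=> nd p0 h; apply: ordge_Sn => // i; apply/ordge1E.
have /eqP := h i; rewrite at0_fr !mulf_eq0 (negbTE (nd i)).
by rewrite (negbTE (vf_scale_neq0 i)) => /eqP.
Qed.

(** Critical base point with Hessian [t] times the metric: [t] is 2 for a squared distance and 4 for
    the sum of two of them. *)
Definition has_hessian (l : lengths K) (t : K) (s : P) : Prop :=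
  (forall a, at0 (fr l a s) = 0) /\
  (forall a b, at0 (fr l a (fr l b s)) = t * (a == b)%:R).

(** To first order the gradient is [t] times the Euler field: both sides vanish at the origin, and
    the Hessian gives them the same frame derivatives there. *)
Lemma grad_linear l t s i : nondeg l -> has_hessian l t s ->
  eqo 2 (\sum_(a < 4) fr l a s * fr l a (var K i)) (t *: var K i).
Proof.
move=> nd [h1 h2]; apply: (fr_ordge2 nd).
  rewrite at0B at0Z at0_var mulr0 subr0 at0_sum big1 // => a _.
  by rewrite (at0M (fr l a s)) h1 mul0r.
move=> a; rewrite frB frZ at0B at0Z.
apply/eqP; rewrite subr_eq0; apply/eqP.
rewrite (at0_fr_sumM l a (fun b => fr l b (var K i)) h1); transitivity (\sum_(b < 4)
    (t * (a == b)%:R) * at0 (fr l b (var K i))).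
  by apply: eq_bigr => b _; congr (_ * _); exact: h2.
rewrite (bigD1 a) //= big1 => [|b ba].
  by rewrite eqxx mulr1 addr0.
by rewrite eq_sym (negbTE ba) mulr0 mul0r.
Qed.

Lemma grad_euler l t s n p : nondeg l -> has_hessian l t s -> ordge n p ->
  eqo n.+1 (\sum_(a < 4) fr l a s * fr l a p) ((t * n%:R) *: p).
Proof.
move=> nd hs hp.
have -> : \sum_(a < 4) fr l a s * fr l a p =
    vfield (fun i => \sum_(a < 4) fr l a s * fr l a (var K i)) p.
  under eq_bigr do rewrite [fr l _ p]fr_vfield /vfield mulr_sumr.
  rewrite exchange_big; apply: eq_bigr => i _; rewrite /= mulr_suml.
  by apply: eq_bigr => a _; rewrite [fr l a (var K i)]fr_vfield vfield_var mulrA.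
by apply: euler_field => // i; exact: grad_linear.
Qed.

(** Subtracting the two eikonal equations gives [<grad (s + s'), grad (s - s')> = 4 (s - s')]. On
    the part of degree [k] of [s - s'] the left side is multiplication by [4 k], so this part
    vanishes for [k > 1]; the normalization at the base point deals with degrees 0 and 1. *)
Lemma sq_distance_unique N l s s' : nondeg l ->
  sq_distance N l s -> sq_distance N l s' -> eqo N.+1 s s'.
Proof.
move=> nd [h1 h2 h3 h4] [h1' h2' h3' h4'].
have hess : has_hessian l 4 (s + s').
  split=> [a|a b]; first by rewrite frD at0D h3 h3' addr0.
  rewrite !frD at0D.
  transitivity (2 * (a == b)%:R + 2 * (a == b)%:R : K); last by ring.
  by congr (_ + _).
have base : ordge 2 (s - s').
  apply: (fr_ordge2 nd) => [|a]; first by rewrite at0B h2 h2' subrr.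
  by rewrite frB at0B h3 h3' subrr.
have eq1 : eqo N.+1 (\sum_(a < 4) fr l a (s + s') * fr l a (s - s'))
    (4 *: (s - s')).
  move/eq_uptoE : h1 => h1; move/eq_uptoE : h1' => h1'.
  rewrite scalerBr.
  apply: eqo_trans (eqoB h1 h1'); apply: eqo_eq.
  rewrite -sumrB; apply: eq_bigr => a _; rewrite frD frB; ring.
(* The maximum keeps the starting point 2 in range when [N = 0]. *)
suff : forall k, (2 <= k <= maxn 2 N.+1)%N -> ordge k (s - s').
  move=> /(_ (maxn 2 N.+1)); rewrite leqnn leq_maxl => /(_ isT).
  by apply: ordgeW; rewrite leq_maxr.
elim=> // k IH /andP [k2 kN].
have [k1|k1] := leqP k 1.
  have -> : k = 1%N by apply/eqP; rewrite eqn_leq k1.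
  exact: base.
have hk : ordge k (s - s') by apply: IH; rewrite k1 ltnW.
have kN' : (k < N.+1)%N.
  by move: kN; rewrite leq_max => /orP [] //; rewrite ltnS leqNgt k1.
have eq2 := grad_euler nd hess hk.
have := eqo_trans (eqo_sym eq2) (eqoW kN' eq1).
rewrite /eqo -scalerBl; apply: ordgeZ_inv.
rewrite -{2}[4]mulr1 -mulrBr mulf_eq0 pnatr_eq0 /= subr_eq0.
by rewrite (eqr_nat K k 1) gtn_eqF.
Qed.

End Dirac.

(** * Clifford algebra and the Dirac operator *)

Section Clifford.

Variable K : numClosedFieldType.

Lemma pauli_anticomm (a b : nat) : (1 <= a <= 3)%N -> (1 <= b <= 3)%N ->
  pauli K a *m pauli K b + pauli K b *m pauli K a = (2 * (a == b)%:R)%:M.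
Proof.
have iN : 'i * 'i = -1 :> K by rewrite -expr2 sqrCi.
have two (i : 'I_2) : (i == 0) || (i == 1) by case: i => [[|[|]]].
move=> /andP [a1 a3] /andP [b1 b3]; apply/matrixP => i j.
rewrite !mxE !big_ord_recl !big_ord0 !mxE /=.
move: a b a1 a3 b1 b3 => [|[|[|[|a]]]] [|[|[|[|b]]]] // _ _ _ _;
  case/orP: (two i) => /eqP ->; case/orP: (two j) => /eqP -> /=;
  rewrite ?mul0r ?mulr0 ?mulr1 ?mul1r ?addr0 ?add0r ?mulrNN ?mulNr ?mulrN ?iN
    ?opprK ?subrr ?mulr0n ?mulr1n ?mul1r ?addNr //; try by ring.
Qed.

Lemma gamma_anticomm (a b : 'I_4) :
  gamma K a *m gamma K b + gamma K b *m gamma K a = (- 2 * (a == b)%:R)%:M.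
Proof.
have iN : 'i * 'i = -1 :> K by rewrite -expr2 sqrCi.
have bnd (c : 'I_4) : c != ord0 -> (1 <= c <= 3)%N.
  by case: c => [[|[|[|[|]]]]].
(* The block identities are restated at type ['M_4], which is convertible with ['M_(2 + 2)] but not
   syntactically equal to it. *)
have mulB (X Y X' Y' : 'M[K]_2) :
    (block_mx 0 X Y 0 : 'M[K]_4) *m (block_mx 0 X' Y' 0 : 'M[K]_4)
    = block_mx (X *m Y') 0 0 (Y *m X').
  have := mulmx_block 0 X Y 0 0 X' Y' 0.
  by rewrite !mul0mx !mulmx0 !addr0 !add0r.
have addB (X Y X' Y' : 'M[K]_2) :
    (block_mx X 0 0 Y : 'M[K]_4) + (block_mx X' 0 0 Y' : 'M[K]_4)
    = block_mx (X + X') 0 0 (Y + Y').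
  by have := add_block_mx X 0 0 Y X' 0 0 Y'; rewrite !addr0.
have scaleB (c : K) (X Y : 'M[K]_2) :
    c *: (block_mx X 0 0 Y : 'M[K]_4) = block_mx (c *: X) 0 0 (c *: Y).
  by have := scale_block_mx c X 0 0 Y; rewrite !scaler0.
have E (c : K) : c%:M = (block_mx (c%:M : 'M[K]_2) 0 0 (c%:M : 'M[K]_2) : 'M[K]_4).
  exact: (@scalar_mx_block _ 2 2).
rewrite /gamma.
case: (boolP (a == ord0)) => [/eqP ->|a0];
  case: (boolP (b == ord0)) => [/eqP ->|b0].
- rewrite eqxx mulr1 E mulB addB mulNmx mulmxN !mul1mx -opprD -raddfD -raddfN.
  by [].
- rewrite eq_sym (negbTE b0) mulr0 -scalemxAl -scalemxAr -scalerDr !mulB addB.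
  by rewrite !mulNmx !mulmxN !mul1mx ?mulmx1 addNr subrr E scaleB !scaler0 raddf0.
- rewrite (negbTE a0) mulr0 -scalemxAl -scalemxAr -scalerDr !mulB addB.
  by rewrite !mulNmx !mulmxN !mul1mx ?mulmx1 addNr subrr E scaleB !scaler0 raddf0.
rewrite -!scalemxAl -!scalemxAr -!scalerDr !mulB addB.
rewrite pauli_anticomm ?bnd // scalerA iN scaleB !scaleN1r E.
by rewrite -raddfN /= mulNr.
Qed.

Local Notation P := (mpoly 4 K).
Local Notation M := 'M[P]_4.

Lemma gammaP_anticomm (a b : 'I_4) :
  gammaP K a *m gammaP K b + gammaP K b *m gammaP K a
  = (mpolyC 4 (- 2 * (a == b)%:R))%:M.
Proof.
by rewrite -!map_mxM -map_mxD gamma_anticomm map_scalar_mx.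
Qed.

End Clifford.

(** * Congruences of matrices and loss of order under the Dirac operator *)

Section MatrixCongruence.

Variable K : numClosedFieldType.

Local Notation P := (mpoly 4 K).
Local Notation M := 'M[P]_4.
Local Notation dirac := Defs.dirac.
Implicit Types (A B U : M) (l : lengths K).

Definition mordge (n : nat) (A : M) : Prop := forall i j, ordge n (A i j).

Definition meqo (n : nat) (A B : M) : Prop := forall i j, eqo n (A i j) (B i j).

Lemma eq_uptomE n A B : eq_uptom n A B <-> meqo n.+1 A B.
Proof. by split=> H i j; apply/eq_uptoE. Qed.

Lemma meqoE n A B : meqo n A B <-> mordge n (A - B).
Proof. by split=> H i j; have := H i j; rewrite /eqo !mxE. Qed.

Lemma meqo_refl n A : meqo n A A.
Proof. by move=> i j; exact: eqo_refl. Qed.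

Lemma meqo_eq n A B : A = B -> meqo n A B.
Proof. by move=> ->; exact: meqo_refl. Qed.

Lemma meqo_sym n A B : meqo n A B -> meqo n B A.
Proof. by move=> h i j; exact: eqo_sym. Qed.

Lemma meqo_trans n B A C : meqo n A B -> meqo n B C -> meqo n A C.
Proof. by move=> h1 h2 i j; apply: eqo_trans (h1 i j) (h2 i j). Qed.

Lemma meqoW n k A B : (k <= n)%N -> meqo n A B -> meqo k A B.
Proof. by move=> kn h i j; apply: eqoW (h i j). Qed.

Lemma meqo0 n A : meqo n A 0 <-> mordge n A.
Proof. by rewrite meqoE subr0. Qed.

Lemma meqoD n A B A' B' :
  meqo n A A' -> meqo n B B' -> meqo n (A + B) (A' + B').
Proof. by move=> h1 h2 i j; rewrite !mxE; apply: eqoD. Qed.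

Lemma meqoN n A A' : meqo n A A' -> meqo n (- A) (- A').
Proof. by move=> h i j; rewrite !mxE; apply: eqoN. Qed.

Lemma meqoB n A B A' B' :
  meqo n A A' -> meqo n B B' -> meqo n (A - B) (A' - B').
Proof. by move=> h1 h2; apply: meqoD => //; apply: meqoN. Qed.

Lemma meqoZ n p p' A A' : eqo n p p' -> meqo n A A' -> meqo n (p *: A) (p' *: A').
Proof. by move=> h1 h2 i j; rewrite !mxE; apply: eqoM. Qed.

Lemma meqo_sum n (I : Type) (r : seq I) (Q : pred I) (f g : I -> M) :
  (forall i, Q i -> meqo n (f i) (g i)) ->
  meqo n (\sum_(i <- r | Q i) f i) (\sum_(i <- r | Q i) g i).
Proof.
by move=> H i j; rewrite !summxE; apply: eqo_sum => k Qk; exact: H.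
Qed.

Lemma meqoM n A B A' B' :
  meqo n A A' -> meqo n B B' -> meqo n (A *m B) (A' *m B').
Proof. by move=> h1 h2 i j; rewrite !mxE; apply: eqo_sum => k _; apply: eqoM. Qed.

Lemma mordgeM a b A B : mordge a A -> mordge b B -> mordge (a + b) (A *m B).
Proof.
by move=> h1 h2 i j; rewrite !mxE; apply: ordge_sum => k _; apply: ordgeM.
Qed.

Lemma mordgeMl n A B : mordge n B -> mordge n (A *m B).
Proof. by rewrite -{2}[n]add0n; apply: mordgeM => i j; exact: ordge0. Qed.

Lemma mordgeW n k A : (k <= n)%N -> mordge n A -> mordge k A.
Proof. by move=> kn h i j; apply: ordgeW (h i j). Qed.

Lemma mordgeD n A B : mordge n A -> mordge n B -> mordge n (A + B).
Proof. by move=> h1 h2 i j; rewrite !mxE; apply: ordgeD. Qed.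

Lemma mordge_sum n (I : Type) (r : seq I) (Q : pred I) (f : I -> M) :
  (forall i, Q i -> mordge n (f i)) -> mordge n (\sum_(i <- r | Q i) f i).
Proof.
by move=> H i j; rewrite !summxE; apply: ordge_sum => k Qk; exact: H.
Qed.

Lemma map_fr_mul l a A B :
  map_mx (fr l a) (A *m B) = map_mx (fr l a) A *m B + A *m map_mx (fr l a) B.
Proof.
apply/matrixP => i j; rewrite !mxE fr_sum -big_split; apply: eq_bigr => k _ /=.
by rewrite !mxE frM.
Qed.

Lemma map_frD l a A B :
  map_mx (fr l a) (A + B) = map_mx (fr l a) A + map_mx (fr l a) B.
Proof. by apply/matrixP => i j; rewrite !mxE frD. Qed.

Lemma map_fr_sum l a (I : Type) (r : seq I) (Q : pred I) (f : I -> M) :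
  map_mx (fr l a) (\sum_(i <- r | Q i) f i)
  = \sum_(i <- r | Q i) map_mx (fr l a) (f i).
Proof.
apply: (big_morph (map_mx (fr l a))); first exact: map_frD.
by apply/matrixP => i j; rewrite !mxE fr0.
Qed.

Lemma map_fr_const l a (G : 'M[K]_4) :
  map_mx (fr l a) (map_mx (@mpolyC 4 K) G) = 0.
Proof. by apply/matrixP => i j; rewrite !mxE frC. Qed.

Lemma map_frZ_const l a p (G : 'M[K]_4) :
  map_mx (fr l a) (p *: map_mx (@mpolyC 4 K) G)
  = fr l a p *: map_mx (@mpolyC 4 K) G.
Proof. by apply/matrixP => i j; rewrite !mxE frM frC mulr0 addr0. Qed.

Lemma map_fr_mordge n l a A : mordge n.+1 A -> mordge n (map_mx (fr l a) A).
Proof. by move=> h i j; rewrite !mxE; apply: fr_ordge. Qed.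

(** The zeroth-order part of the Dirac operator. For uniqueness it only matters that it acts by
    matrix multiplication and so does not lower the order. *)
Definition conn l : M :=
  \sum_(a < 4) gammaP K a *m ((4^-1 : K)%:A *: \sum_(b < 4) \sum_(d < 4)
     levi_civita l a b d *: (gammaP K b *m gammaP K d)).

Lemma diracE l U :
  dirac l U = \sum_(a < 4) gammaP K a *m map_mx (fr l a) U + conn l *m U.
Proof.
rewrite /dirac /conn mulmx_suml -big_split; apply: eq_bigr => a _ /=.
rewrite /spin_nabla mulmxDr; congr (_ + _).
rewrite -mulmxA; congr (_ *m _); rewrite -scalemxAl; congr (_ *: _).
rewrite mulmx_suml; apply: eq_bigr => b _.
by rewrite mulmx_suml; apply: eq_bigr => d _; rewrite -scalemxAl.
Qed.

Lemma diracD l A B : dirac l (A + B) = dirac l A + dirac l B.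
Proof.
rewrite !diracE mulmxDr addrACA; congr (_ + _).
by rewrite -big_split; apply: eq_bigr => a _ /=; rewrite map_frD mulmxDr.
Qed.

Lemma diracN l A : dirac l (- A) = - dirac l A.
Proof.
rewrite !diracE mulmxN opprD; congr (_ + _).
rewrite -sumrN; apply: eq_bigr => a _; rewrite -mulmxN; congr (_ *m _).
by apply/matrixP => i j; rewrite !mxE frN.
Qed.

Lemma diracB l A B : dirac l (A - B) = dirac l A - dirac l B.
Proof. by rewrite diracD diracN. Qed.

Lemma dirac_mordge n l U : mordge n.+1 U -> mordge n (dirac l U).
Proof.
move=> h; rewrite diracE; apply: mordgeD.
  by apply: mordge_sum => a _; apply: mordgeMl; exact: map_fr_mordge.
by apply: mordgeMl; apply: mordgeW h.
Qed.

Lemma dirac_meqo n l A B : meqo n.+1 A B -> meqo n (dirac l A) (dirac l B).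
Proof. by rewrite !meqoE -diracB; exact: dirac_mordge. Qed.

End MatrixCongruence.

(** * Uniqueness of the formal heat kernel *)

Section HeatUnique.

Variable K : numClosedFieldType.

Local Notation P := (mpoly 4 K).
Local Notation M := 'M[P]_4.
Local Notation dirac := Defs.dirac.
Implicit Types (A B U : M) (l : lengths K) (s : P).

(** This removes the gamma matrices from the first-order part of [D c + c D], leaving [- 2] times
    differentiation along the gradient of [s]. *)
Lemma cliff_anticomm l s a :
  gammaP K a *m cliff_grad l s + cliff_grad l s *m gammaP K a
  = (-2 * fr l a s)%:M.
Proof.
rewrite /cliff_grad mulmx_sumr mulmx_suml -big_split /= (bigD1 a) //= big1.
  rewrite addr0 -scalemxAl -scalemxAr -scalerDr gammaP_anticomm eqxx mulr1.
  by rewrite scale_scalar_mx mulrC rmorphN rmorph_nat.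
move=> b ba; rewrite -scalemxAl -scalemxAr -scalerDr gammaP_anticomm.
by rewrite eq_sym (negbTE ba) mulr0 mpolyC0 scale_scalar_mx mulr0 raddf0.
Qed.

Lemma gammaP_sq a : gammaP K a *m gammaP K a = (-1)%:M.
Proof.
rewrite -map_mxM (_ : (-1)%:M = map_mx (@mpolyC 4 K) (-1)%:M); last first.
  by rewrite map_scalar_mx; congr (_%:M); rewrite [RHS]rmorphN1.
congr (map_mx _ _).
have two : (2 : K) != 0 by rewrite pnatr_eq0.
apply: (scalerI two); rewrite scaler_nat mulr2n gamma_anticomm eqxx mulr1.
by rewrite scale_scalar_mx mulrN1.
Qed.

Lemma cliff_grad_ordge l t s : has_hessian l t s -> mordge 1 (cliff_grad l s).
Proof.
move=> [h _]; apply: mordge_sum => a _ i j; rewrite mxE; apply: ordgeMr.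
by apply/ordge1E; exact: h.
Qed.

(** Three contributions on order [n]: [- 2] times the gradient field gives [- 4 n] by Euler's
    identity with Hessian 2; the derivative of [c] gives [2 gamma_a ^ 2 = - 2] for each of four
    directions, hence [- 8]; the connection terms contain [c], of order 1, and fall into order
    [n + 1]. *)
Lemma dirac_symbol l s n U : nondeg l -> has_hessian l 2 s -> mordge n U ->
  meqo n.+1 (dirac l (cliff_grad l s *m U) + cliff_grad l s *m dirac l U)
    ((- (4 * n%:R + 8) : K)%:A *: U).
Proof.
move=> nd hs hU.
have [c [Ec hc hanti]] : exists c, [/\ c = cliff_grad l s, mordge 1 c & forall a,
    gammaP K a *m c + c *m gammaP K a = (-2 * fr l a s)%:M].
  exists (cliff_grad l s); split=> //; first exact: cliff_grad_ordge hs.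
  exact: cliff_anticomm.
rewrite -Ec.
have -> : dirac l (c *m U) + c *m dirac l U =
    (\sum_(a < 4) (-2 * fr l a s) *: map_mx (fr l a) U
     + (\sum_(a < 4) gammaP K a *m map_mx (fr l a) c) *m U)
    + (conn l *m (c *m U) + c *m (conn l *m U)).
  rewrite !diracE mulmxDr addrACA; congr (_ + _).
  rewrite mulmx_suml mulmx_sumr -!big_split; apply: eq_bigr => a _ /=.
  rewrite map_fr_mul mulmxDr -addrA addrC !mulmxA; congr (_ + _).
  by rewrite -mulmxDl hanti mul_scalar_mx.
have h3 : meqo n.+1 (conn l *m (c *m U) + c *m (conn l *m U)) 0.
  apply/meqo0; apply: mordgeD.
    by apply: mordgeMl; rewrite -add1n; exact: mordgeM.
  by rewrite -add1n; apply: mordgeM => //; exact: mordgeMl.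
have h1 : meqo n.+1 (\sum_(a < 4) (-2 * fr l a s) *: map_mx (fr l a) U)
    ((- (4 * n%:R) : K)%:A *: U).
  move=> i j; rewrite summxE mxE.
  apply: (@eqo_trans _ _ ((-2 : K) *: \sum_(a < 4) fr l a s * fr l a (U i j))).
    apply: eqo_eq; rewrite scaler_sumr; apply: eq_bigr => a _.
    by rewrite !mxE -mul_mpolyC rmorphN rmorph_nat mulrA.
  have -> : (- (4 * n%:R) : K)%:A * U i j = (-2 : K) *: ((2 * n%:R : K) *: U i j).
    rewrite scalerA mulr_algl; congr (_ *: _); ring.
  by apply: eqoZ; apply: grad_euler.
have h2 : meqo n.+1 ((\sum_(a < 4) gammaP K a *m map_mx (fr l a) c) *m U)
    ((- 8 : K)%:A *: U).
  apply/meqoE; rewrite -mul_scalar_mx -mulmxBl -add1n; apply: mordgeM => //.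
  apply/meqoE.
  apply: (@meqo_trans _ _ (\sum_(a < 4) (2 : P) *: (gammaP K a *m gammaP K a))).
    apply: meqo_sum => a _.
    rewrite Ec /cliff_grad map_fr_sum mulmx_sumr.
    rewrite (_ : 2 *: _ = \sum_(b < 4) (2 * (a == b)%:R : P) *:
       (gammaP K a *m gammaP K b)); last first.
      rewrite (bigD1 a) //= big1 ?addr0 ?eqxx ?mulr1 // => b /negbTE ba.
      by rewrite eq_sym ba mulr0 scale0r.
    apply: meqo_sum => b _; rewrite /gammaP map_frZ_const -scalemxAr.
    apply: meqoZ; last exact: meqo_refl.
    apply/ordge1E; rewrite at0B; have [_ ->] := hs.
    case: (a == b); rewrite ?mulr1 ?mulr0.
      by rewrite -[2 : P](rmorph_nat (@mpolyC 4 K)) at0C subrr.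
    by rewrite -[0 : P](rmorph0 (@mpolyC 4 K)) at0C subrr.
  apply: meqo_eq.
  under eq_bigr do rewrite gammaP_sq.
  rewrite sumr_const card_ord scale_scalar_mx -raddfMn; congr (_%:M).
  rewrite -mul_mpolyC mulr1 rmorphN rmorph_nat; ring.
rewrite [X in meqo _ _ X](_ : _ =
    (- (4 * n%:R) : K)%:A *: U + (- 8 : K)%:A *: U + 0); last first.
  by rewrite addr0 -scalerDl -scalerDl opprD.
by apply: meqoD => //; apply: meqoD.
Qed.

Lemma at0_mxE A B : map_mx (@at0 K) A = map_mx (@at0 K) B -> meqo 1 A B.
Proof.
move=> h i j; apply/ordge1E.
by have /matrixP /(_ i j) := h; rewrite !mxE at0B => ->; rewrite subrr.
Qed.

Lemma meqo_at0 n A B : (0 < n)%N -> meqo n A B ->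
  map_mx (@at0 K) A = map_mx (@at0 K) B.
Proof. by move=> n0 h; apply/matrixP => i j; rewrite !mxE (eqo_at0 n0 (h i j)). Qed.

Definition heat_op l (c : M) (k : nat) U : M :=
  (k%:R - 2) *: U - (4^-1 : K)%:A *: (dirac l (c *m U) + c *m dirac l U).

Definition heat_prev l (u : nat -> M) (k : nat) : M :=
  if k is k'.+1 then dirac l (dirac l (u k')) else 0.

Lemma heat_seriesE N l s u k : heat_series N l s u ->
  meqo N.+1 (heat_op l (cliff_grad l s) k (u k) + heat_prev l u k) 0.
Proof. by case=> _ _ /(_ k) /eq_uptomE. Qed.

Lemma heat_opB l c k U U' : heat_op l c k (U - U') = heat_op l c k U - heat_op l c k U'.
Proof.
have E : dirac l (c *m (U - U')) + c *m dirac l (U - U') =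
    dirac l (c *m U) + c *m dirac l U - (dirac l (c *m U') + c *m dirac l U').
  by rewrite mulmxBr !diracB mulmxBr addrACA -opprD.
have gen (p q : P) (A A' B B' : M) : p *: (A - A') - q *: (B - B') =
    p *: A - q *: B - (p *: A' - q *: B').
  by rewrite !scalerBr opprB [in RHS]opprB addrACA [RHS]addrACA [- (p *: A') + _]addrC.
apply: etrans (gen _ _ _ _ _ _).
by rewrite /heat_op; congr (_ - _ *: _).
Qed.

Lemma meqo_cancel n A B C D : meqo n (A + C) 0 -> meqo n (B + D) 0 ->
  meqo n C D -> meqo n (A - B) 0.
Proof.
move=> h1 h2 h3 i j; have := ordgeB (ordgeB (h1 i j) (h2 i j)) (h3 i j).
rewrite /eqo !mxE !subr0; congr (ordge _ _).
by move: (A i j) (B i j) (C i j) (D i j) => a b c d; ring.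
Qed.

Lemma heat_op_cliff n l c c' k U : meqo n.+1 c c' ->
  meqo n (heat_op l c k U) (heat_op l c' k U).
Proof.
move=> ec; apply: meqoB; first exact: meqo_refl.
apply: meqoZ; first exact: eqo_refl.
apply: meqoD; first by apply: dirac_meqo; apply: meqoM => //; exact: meqo_refl.
apply: meqoM; last exact: meqo_refl.
exact: meqoW ec.
Qed.

(** The [- 2] coming from [t ^ -2] in dimension four cancels [8 / 4], and [4 n / 4] remains: the
    transport equation is invertible on every order except [n = 0] for [k = 0]. *)
Lemma heat_op_symbol l s n k U : nondeg l -> has_hessian l 2 s -> mordge n U ->
  meqo n.+1 (heat_op l (cliff_grad l s) k U) (((k + n)%:R : K)%:A *: U).
Proof.
move=> nd hs hU.
have h := meqoZ (@eqo_refl _ _ (4^-1 : K)%:A) (dirac_symbol nd hs hU).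
apply: meqo_trans (meqoB (@meqo_refl _ _ ((k%:R - 2 : P) *: U)) h) _.
apply: meqo_eq; rewrite scalerA -scalerBl; congr (_ *: _).
have -> : (k%:R - 2 : P) = (k%:R - 2 : K)%:A.
  by rewrite scalerBl !scaler_nat.
rewrite mulr_algl scalerA -scalerBl; congr (_ *: _).
have four : (4 : K) != 0 by rewrite pnatr_eq0.
by rewrite natrD; field.
Qed.

(** The squared distance is known modulo order [N + 1]; its gradient loses one order and the Dirac
    operator in the transport equation another, hence [N.-1]. Each further coefficient loses two
    orders through [D ^ 2]. *)
Lemma heat_series_unique N l s s' u u' : nondeg l ->
  heat_series N l s u -> heat_series N l s' u' ->
  forall j, meqo (N.-1 - 2 * j) (u j) (u' j).
Proof.
move=> nd H H'.
have [ds u0 _] := H; have [ds' u0' _] := H'.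
have es := sq_distance_unique nd ds ds'.
have hs : has_hessian l 2 s by case: ds.
have ec : meqo N (cliff_grad l s) (cliff_grad l s').
  apply: meqo_sum => a _; apply: meqoZ; last exact: meqo_refl.
  exact: fr_eqo.
have he j := heat_seriesE j H; have he' j := heat_seriesE j H'.
have diff j n : (n <= N.-1)%N ->
    meqo n (heat_prev l u j) (heat_prev l u' j) ->
    meqo n (heat_op l (cliff_grad l s) j (u j - u' j)) 0.
  move=> nN hprev; have nN1 : (n <= N)%N by apply: leq_trans nN (leq_pred N).
  have h2 := meqo_cancel (meqoW (leqW nN1) (he j)) (meqoW (leqW nN1) (he' j)) hprev.
  rewrite heat_opB; apply: meqo_trans h2; apply: meqoB; first exact: meqo_refl.
  case: N nN ec {es ds ds' he he' H H' nN1} => [|N' nN ec].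
    by rewrite leqn0 => /eqP -> _ ? ?; exact: ordge0.
  by apply: meqoW (nN) _; exact: heat_op_cliff.
have ind j n : (n <= N.-1)%N ->
    meqo n (heat_prev l u j) (heat_prev l u' j) -> meqo n (u j) (u' j).
  move=> nN hprev; have main := diff j n nN hprev.
  apply/meqoE; suff : forall k, (k <= n)%N -> mordge k (u j - u' j) by apply.
  elim=> [|k IHk] kN; first by move=> ? ?; exact: ordge0.
  have hk := IHk (ltnW kN).
  (* The factor [j + k] vanishes only for the value of [u 0] at the base point, which the initial
     condition fixes. *)
  have [jk|jk] := posnP (j + k).
    move/eqP: jk; rewrite addn_eq0 => /andP [/eqP -> /eqP ->].
    by apply/meqoE; apply: at0_mxE; rewrite u0 u0'.
  have h4 := meqo_trans (meqo_sym (heat_op_symbol j nd hs hk)) (meqoW kN main).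
  move=> i i'; have /meqo0 /(_ i i') := h4; rewrite mxE mulr_algl.
  by apply: ordgeZ_inv; rewrite pnatr_eq0 -lt0n.
elim=> [|j IH]; apply: ind.
- exact: leq_subr.
- exact: meqo_refl.
- exact: leq_subr.
(* When fewer than two orders are left, truncated subtraction makes the claim one modulo order 0,
   which is empty. *)
have [h2|h2] := ltnP (N.-1 - 2 * j) 2.
  have -> : (N.-1 - 2 * j.+1 = 0)%N.
    by apply/eqP; rewrite mulnSr subnDA subn_eq0 ltnW.
  by move=> ? ?; exact: ordge0.
apply: dirac_meqo; apply: dirac_meqo.
by apply: meqoW IH; rewrite mulnSr subnDA -addn2 subnK.
Qed.

End HeatUnique.

(** * Naturality of the heat kernel *)

Section Transport.

Variable K : numClosedFieldType.

Local Notation P := (mpoly 4 K).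
Local Notation M := 'M[P]_4.
Local Notation dirac := Defs.dirac.
Implicit Types (A B U : M) (l : lengths K) (s p q : P).

Lemma eps_aab (a d : 'I_4) : eps K a a d = 0.
Proof. by move: a d => [[|[|[|[|a]]]] ha] [[|[|[|[|d]]]] hd]. Qed.

Lemma eps_nz (a b d : 'I_4) : eps K a b d != 0 ->
  [/\ a != ord0, b != ord0 & d != ord0].
Proof.
move: a b d => [[|[|[|[|a]]]] ha] [[|[|[|[|b]]]] hb] [[|[|[|[|d]]]] hd] //=;
  by rewrite /eps /= ?eqxx.
Qed.

Lemma struct_coef_aa l a d : struct_coef l a a d = 0.
Proof. by rewrite /struct_coef subrr eps_aab scale0r subrr mul0r. Qed.

Variables (n : nat) (l1 l2 : lengths K).
Variables (Phi : {rmorphism P -> P}) (pi : 'I_4 -> 'I_4) (e : 'I_4 -> K).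
Variables (chi chii : P) (c : K) (T : 'M[K]_4).

(** Only the time direction is stretched; [chii] plays the inverse of [chi] modulo the
    truncation. *)
Definition psi (a : 'I_4) : P := if a == ord0 then chii else 1.
Definition psi' (a : 'I_4) : P := if a == ord0 then chi else 1.

(* Phi is the substitution associated with a map of time x SU(2) that
   reparametrizes time, with derivative chi, and permutes the invariant fields
   up to the signs e; it rescales the metric by the factor c ^ -2. *)
Record transports : Prop := Transports {
  tr_PhiC : forall x, Phi (mpolyC 4 x) = mpolyC 4 x;
  tr_ordge : forall k p, ordge k p -> ordge k (Phi p);
  tr_pi : involutive pi;
  tr_pi0 : pi ord0 = ord0;
  tr_e : forall a, e a * e a = 1;
  tr_eps : forall a b d,
    eps K (pi a) (pi b) (pi d) = e a * e b * e d * eps K a b d;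
  tr_chi : eqo n.+1 (chi * chii) 1;
  tr_vf_chi : forall a, a != ord0 -> vf a chi = 0;
  tr_vf : forall a p, vf (pi a) (Phi p) = e a *: (psi' a * Phi (vf a p));
  tr_c : c != 0;
  tr_ilen : forall a,
    eqo n.+1 (ilen l2 (pi a)) (c *: (psi a * Phi (ilen l1 a)));
  tr_len : forall a,
    eqo n.+1 (len l2 (pi a)) (c^-1 *: (psi' a * Phi (len l1 a)));
  tr_T : T \in unitmx;
  tr_gamma : forall a, gamma K (pi a) *m T = e a *: (T *m gamma K a) }.

Hypothesis tr : transports.

Lemma PhiZ x p : Phi (x *: p) = x *: Phi p.
Proof. by rewrite -mul_mpolyC rmorphM (tr_PhiC tr) mul_mpolyC. Qed.

Lemma Phi_eqo k p q : eqo k p q -> eqo k (Phi p) (Phi q).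
Proof. by move/(tr_ordge tr); rewrite rmorphB. Qed.

Lemma at0_Phi p : at0 (Phi p) = at0 p.
Proof.
have : ordge 1 (p - mpolyC 4 (at0 p)) by apply/ordge1E; rewrite at0B at0C subrr.
move/(tr_ordge tr)/ordge1E; rewrite rmorphB (tr_PhiC tr) at0B at0C.
by move/eqP; rewrite subr_eq0 => /eqP.
Qed.

Lemma psiK a : eqo n.+1 (psi a * psi' a) 1.
Proof.
rewrite /psi /psi'; case: eqP => _; last by apply: eqo_eq; rewrite mulr1.
by rewrite mulrC; exact: tr_chi tr.
Qed.

Lemma fr_transport a p :
  eqo n.+1 (fr l2 (pi a) (Phi p)) ((c * e a) *: Phi (fr l1 a p)).
Proof.
rewrite /fr (tr_vf tr).
apply: eqo_trans (eqoM (tr_ilen tr a) (@eqo_refl _ _ _)) _.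
apply: (@eqo_trans _ _ ((c * e a) *: (psi a * psi' a * Phi (ilen l1 a * vf a p)))).
  apply: eqo_eq; rewrite rmorphM -!mul_mpolyC rmorphM.
  by move: (Phi _) (Phi (vf a p)) => x y; ring.
rewrite -[X in eqo _ _ (_ *: X)]mul1r; apply: eqoZ.
by apply: eqoM; [exact: psiK | exact: eqo_refl].
Qed.

Lemma pi_eq a b : (pi a == pi b) = (a == b).
Proof. exact: (inj_eq (can_inj (tr_pi tr))). Qed.

(** Differentiate [chi * chii = 1], where [chi] depends on time alone, and cancel [chi]. *)
Lemma vf_chii a : a != ord0 -> eqo n (vf a chii) 0.
Proof.
move=> a0; have h := vf_eqo a (tr_chi tr).
rewrite vfM (tr_vf_chi tr a0) mul0r add0r in h.
have e1 : vf a (1 : P) = 0 by rewrite vf_vfield /vfield big1 // => i _;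
  rewrite -[1]mpolyC1 mderivC mulr0.
rewrite e1 in h.
have h2 := eqoM (@eqo_refl _ n chii) h; rewrite mulr0 mulrA in h2.
apply: eqo_trans h2; apply: eqo_sym; rewrite -[X in eqo _ _ X]mul1r.
apply: eqoM; last exact: eqo_refl.
by rewrite mulrC; apply: eqoW (tr_chi tr).
Qed.

Lemma vf_psi a b : a != b -> eqo n (vf (pi a) (psi b)) 0.
Proof.
rewrite /psi; case: (eqVneq b ord0) => [->|b0] a0.
  by apply: vf_chii; rewrite -(tr_pi0 tr) pi_eq.
apply: eqo_eq; rewrite vf_vfield /vfield big1 // => i _.
by rewrite -[1]mpolyC1 mderivC mulr0.
Qed.

(** With [a] and [b] distinct no time derivative of [chii] can appear; on the diagonal the bracket
    vanishes anyway, by [struct_coef_aa]. *)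
Lemma vf_ilen_transport a b : a != b ->
  eqo n (vf (pi a) (ilen l2 (pi b)))
    ((c * e a) *: (psi b * psi' a * Phi (vf a (ilen l1 b)))).
Proof.
move=> ab; apply: eqo_trans (vf_eqo _ (tr_ilen tr b)) _.
rewrite vfZ vfM (tr_vf tr).
apply: (@eqo_trans _ _ (c *: (0 * Phi (ilen l1 b)
   + psi b * (e a *: (psi' a * Phi (vf a (ilen l1 b))))))).
  apply: eqoZ; apply: eqoD; last exact: eqo_refl.
  by apply: eqoM; [exact: vf_psi | exact: eqo_refl].
by apply: eqo_eq; rewrite mul0r add0r -scalerAr scalerA mulrA.
Qed.

Lemma struct_term_transport a b : a != b ->
  eqo n (ilen l2 (pi a) * vf (pi a) (ilen l2 (pi b)) * len l2 (pi b))
   ((c * e a) *: Phi (ilen l1 a * vf a (ilen l1 b) * len l1 b)).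
Proof.
move=> ab.
have il := eqoW (leqnSn n) (tr_ilen tr a).
have ll := eqoW (leqnSn n) (tr_len tr b).
apply: eqo_trans (eqoM (eqoM il (vf_ilen_transport ab)) ll) _.
apply: (@eqo_trans _ _ ((c * e a) *: ((psi a * psi' a) * (psi b * psi' b) *
   Phi (ilen l1 a * vf a (ilen l1 b) * len l1 b)))).
  apply: eqo_eq; rewrite !rmorphM -!mul_mpolyC !rmorphM /=.
  have cc : mpolyC 4 c * mpolyC 4 c^-1 = 1 by rewrite -mpolyCM mulfV ?(tr_c tr).
  move: (Phi (ilen l1 a)) (Phi (vf a _)) (Phi (len l1 b)) (psi a) (psi b).
  move: (psi' a) (psi' b) (mpolyC 4 (e a)) cc => x y z.
  move: (mpolyC 4 c) (mpolyC 4 c^-1) => u v uv p1 p2 p3 p4 p5.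
  transitivity ((u * v) * (u * z * (p4 * x * (p5 * y) * (p1 * p2 * p3)))); first by ring.
  by rewrite uv mul1r.
rewrite -[X in eqo _ _ (_ *: X)]mul1r -[X in eqo _ _ (_ *: (X * _))]mulr1.
apply: eqoZ; apply: eqoM; last exact: eqo_refl.
by apply: eqoM; apply: eqoW (psiK _).
Qed.

(** Two inverse lengths and one length leave the weight [c]. In the two terms with a Kronecker delta
    a sign occurs twice and disappears; the last term takes its signs from [tr_eps]. *)
Lemma struct_transport a b d :
  eqo n (struct_coef l2 (pi a) (pi b) (pi d))
    ((c * e a * e b * e d) *: Phi (struct_coef l1 a b d)).
Proof.
have [<-|ab] := eqVneq a b.
  by rewrite !struct_coef_aa rmorph0 scaler0; exact: eqo_refl.
rewrite /struct_coef !pi_eq (tr_eps tr) !mulrBl !rmorphB !scalerBr.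
apply: eqoB; first apply: eqoB.
- have [<-|bd] := eqVneq b d.
    rewrite -[c * e a * e b * e b]mulrA (tr_e tr) mulr1 !mul1r.
    exact: struct_term_transport.
  by rewrite !mul0r rmorph0 scaler0; exact: eqo_refl.
- have [<-|bd] := eqVneq a d.
    have -> : c * e a * e b * e a = c * e b by rewrite -[RHS]mulr1 -(tr_e tr a); ring.
    rewrite !mul1r.
    by apply: struct_term_transport; rewrite eq_sym.
  by rewrite !mul0r rmorph0 scaler0; exact: eqo_refl.
(* A nonzero [eps] forces three spatial indices, where [psi] and [psi'] are 1. *)
have [->|nz] := eqVneq (eps K a b d) 0.
  by rewrite mulr0 !scale0r !mul0r rmorph0 scaler0; exact: eqo_refl.
have [a0 b0 d0] := eps_nz nz.
have il x : x != ord0 -> eqo n (ilen l2 (pi x)) (c *: Phi (ilen l1 x)).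
  move=> /negbTE x0; apply: eqoW (leqnSn n) _.
  by have := tr_ilen tr x; rewrite /psi x0 mul1r.
have ll : eqo n (len l2 (pi d)) (c^-1 *: Phi (len l1 d)).
  apply: eqoW (leqnSn n) _.
  by have := tr_len tr d; rewrite /psi' (negbTE d0) mul1r.
apply: eqo_trans (eqoM (eqoZ _ (eqoM (il a a0) (il b b0))) ll) _.
apply: eqo_eq; rewrite !rmorphM PhiZ !rmorphM /= -!mul_mpolyC !rmorphM /=.
have cc : mpolyC 4 c * mpolyC 4 c^-1 = 1 by rewrite -mpolyCM mulfV ?(tr_c tr).
move: (Phi (ilen l1 a)) (Phi (ilen l1 b)) (Phi (len l1 d)) (mpolyC 4 (eps K a b d)).
move: (mpolyC 4 (e a)) (mpolyC 4 (e b)) (mpolyC 4 (e d)) cc.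
move: (mpolyC 4 c) (mpolyC 4 c^-1) => u v ea eb ed uv p1 p2 p3 ep.
transitivity ((u * v) * (u * ea * eb * ed * (ep * (p1 * p2) * p3))); first by ring.
by rewrite uv mul1r.
Qed.

Lemma levi_civita_transport a b d :
  eqo n (levi_civita l2 (pi a) (pi b) (pi d))
    ((c * e a * e b * e d) *: Phi (levi_civita l1 a b d)).
Proof.
rewrite /levi_civita PhiZ scalerA mulrC -scalerA; apply: eqoZ.
rewrite rmorphD rmorphB scalerDr scalerBr.
have h1 := struct_transport a b d; have h2 := struct_transport b d a.
have h3 := struct_transport d a b.
have e2 : c * e b * e d * e a = c * e a * e b * e d by ring.
have e3 : c * e d * e a * e b = c * e a * e b * e d by ring.
rewrite e2 in h2; rewrite e3 in h3.
by apply: eqoD => //; apply: eqoB.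
Qed.

(** Action of the homothety on endomorphisms of the spinor fibre. Conjugation, rather than left
    multiplication by [T], preserves the normalization [u 0 = 1]. *)
Definition spin_conj U : M :=
  map_mx (@mpolyC 4 K) T *m map_mx Phi U *m map_mx (@mpolyC 4 K) (invmx T).

Lemma spin_conjD A B : spin_conj (A + B) = spin_conj A + spin_conj B.
Proof. by rewrite /spin_conj map_mxD mulmxDr mulmxDl. Qed.

Lemma spin_conj0 : spin_conj 0 = 0.
Proof. by rewrite /spin_conj map_mx0 mulmx0 mul0mx. Qed.

Lemma spin_conjB A B : spin_conj (A - B) = spin_conj A - spin_conj B.
Proof. by rewrite /spin_conj map_mxB mulmxBr mulmxBl. Qed.

Lemma spin_conjZ p A : spin_conj (p *: A) = Phi p *: spin_conj A.
Proof. by rewrite /spin_conj map_mxZ -scalemxAr -scalemxAl. Qed.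

Lemma spin_conj_sum (I : Type) (r : seq I) (Q : pred I) (f : I -> M) :
  spin_conj (\sum_(i <- r | Q i) f i) = \sum_(i <- r | Q i) spin_conj (f i).
Proof. by apply: (big_morph spin_conj spin_conjD); exact: spin_conj0. Qed.

Lemma spin_conj_meqo k A B : meqo k A B -> meqo k (spin_conj A) (spin_conj B).
Proof.
move=> h; apply: meqoM; last exact: meqo_refl.
apply: meqoM; first exact: meqo_refl.
by move=> i j; rewrite !mxE; apply: Phi_eqo.
Qed.

Lemma gammaP_spin_conj a U :
  gammaP K (pi a) *m spin_conj U = mpolyC 4 (e a) *: spin_conj (gammaP K a *m U).
Proof.
have h1 : gammaP K (pi a) *m map_mx (@mpolyC 4 K) T =
    mpolyC 4 (e a) *: (map_mx (@mpolyC 4 K) T *m gammaP K a).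
  by rewrite -!map_mxM (tr_gamma tr) map_mxZ.
have h2 : map_mx Phi (gammaP K a *m U) = gammaP K a *m map_mx Phi U.
  rewrite map_mxM; congr (_ *m _).
  by apply/matrixP => i j; rewrite !mxE (tr_PhiC tr).
have gen (G G' A B D : M) x : G *m A = x *: (A *m G') ->
    G *m (A *m B *m D) = x *: (A *m (G' *m B) *m D).
  by move=> h; rewrite !mulmxA h -!scalemxAl.
by rewrite /spin_conj h2; exact: gen.
Qed.

Lemma map_fr_spin_conj a U :
  meqo n.+1 (map_mx (fr l2 (pi a)) (spin_conj U))
    (mpolyC 4 (c * e a) *: spin_conj (map_mx (fr l1 a) U)).
Proof.
rewrite /spin_conj !map_fr_mul !map_fr_const mul0mx mulmx0 add0r addr0.
rewrite scalemxAl scalemxAr; apply: meqoM; last exact: meqo_refl.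
apply: meqoM; first exact: meqo_refl.
by move=> i j; rewrite !mxE mul_mpolyC; exact: fr_transport.
Qed.

(** After reindexing by [pi], the signs [e b] and [e d] occur once in the connection coefficient and
    once in the gamma matrices, so that only [e a] is left. *)
Lemma spin_nabla_transport a U :
  meqo n (spin_nabla l2 (pi a) (spin_conj U))
    (mpolyC 4 (c * e a) *: spin_conj (spin_nabla l1 a U)).
Proof.
rewrite /spin_nabla spin_conjD scalerDr; apply: meqoD.
  by apply: meqoW (leqnSn n) _; exact: map_fr_spin_conj.
rewrite spin_conjZ PhiZ rmorph1 scalerA mulrC -scalerA.
apply: meqoZ; first exact: eqo_refl.
have pi_inj := can_inj (tr_pi tr).
rewrite (reindex_inj pi_inj) spin_conj_sum scaler_sumr; apply: meqo_sum => b _.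
rewrite (reindex_inj pi_inj) spin_conj_sum scaler_sumr; apply: meqo_sum => d _.
rewrite spin_conjZ -mulmxA gammaP_spin_conj -scalemxAr gammaP_spin_conj.
rewrite !scalerA mulmxA; apply: meqoZ; last exact: meqo_refl.
apply: eqo_trans (eqoM (eqoM (levi_civita_transport a b d) (@eqo_refl _ _ _))
  (@eqo_refl _ _ _)) _.
apply: eqo_eq; rewrite -mul_mpolyC !mpolyCM.
have eb : mpolyC 4 (e b) * mpolyC 4 (e b) = 1 by rewrite -mpolyCM (tr_e tr).
have ed : mpolyC 4 (e d) * mpolyC 4 (e d) = 1 by rewrite -mpolyCM (tr_e tr).
move: (mpolyC 4 (e b)) (mpolyC 4 (e d)) eb ed (mpolyC 4 c) (mpolyC 4 (e a)) (Phi _).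
move=> x y xx yy u v p.
transitivity ((x * x) * (y * y) * (u * v * p)); first by ring.
by rewrite xx yy !mul1r.
Qed.

Lemma dirac_transport U :
  meqo n (dirac l2 (spin_conj U)) (mpolyC 4 c *: spin_conj (dirac l1 U)).
Proof.
have E1 : dirac l2 (spin_conj U) =
    \sum_(a < 4) gammaP K (pi a) *m spin_nabla l2 (pi a) (spin_conj U).
  exact: (reindex_inj (can_inj (tr_pi tr))).
have E2 : mpolyC 4 c *: spin_conj (dirac l1 U) =
    \sum_(a < 4) mpolyC 4 c *: spin_conj (gammaP K a *m spin_nabla l1 a U).
  by rewrite -scaler_sumr -spin_conj_sum.
rewrite E1 E2; apply: meqo_sum => a _.
apply: meqo_trans (meqoM (@meqo_refl _ _ _) (spin_nabla_transport a U)) _.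
apply: meqo_eq; rewrite -scalemxAr gammaP_spin_conj scalerA -mpolyCM -mulrA.
by rewrite (tr_e tr) mulr1.
Qed.

Lemma cliff_grad_transport s U :
  meqo n.+1 (cliff_grad l2 (c^-2 *: Phi s) *m spin_conj U)
    (mpolyC 4 c^-1 *: spin_conj (cliff_grad l1 s *m U)).
Proof.
have E1 : cliff_grad l2 (c^-2 *: Phi s) *m spin_conj U =
    \sum_(a < 4) fr l2 (pi a) (c^-2 *: Phi s) *: gammaP K (pi a) *m spin_conj U.
  have E0 : cliff_grad l2 (c^-2 *: Phi s) =
      \sum_(a < 4) fr l2 (pi a) (c^-2 *: Phi s) *: gammaP K (pi a).
    exact: (reindex_inj (can_inj (tr_pi tr))).
  by rewrite E0 mulmx_suml.
have E2 : mpolyC 4 c^-1 *: spin_conj (cliff_grad l1 s *m U) =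
    \sum_(a < 4) mpolyC 4 c^-1 *: spin_conj (fr l1 a s *: gammaP K a *m U).
  by rewrite /cliff_grad mulmx_suml spin_conj_sum scaler_sumr.
rewrite E1 E2; apply: meqo_sum => a _.
rewrite -!scalemxAl spin_conjZ gammaP_spin_conj !scalerA.
apply: meqoZ; last exact: meqo_refl.
rewrite frZ; apply: eqo_trans (eqoM (eqoZ _ (fr_transport a s)) (@eqo_refl _ _ _)) _.
apply: eqo_eq; rewrite scalerA -mul_mpolyC mulrAC -mpolyCM; congr (mpolyC _ _ * _).
have -> : c ^- 2 * (c * e a) * e a = c ^- 2 * c * (e a * e a) by ring.
by rewrite (tr_e tr); have c0 := tr_c tr; field.
Qed.


Lemma diracZ l x U : dirac l (mpolyC 4 x *: U) = mpolyC 4 x *: dirac l U.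
Proof.
rewrite !diracE scalerDr -scalemxAr; congr (_ + _).
rewrite scaler_sumr; apply: eq_bigr => a _; rewrite scalemxAr; congr (_ *m _).
by apply/matrixP => i j; rewrite !mxE !mul_mpolyC frZ.
Qed.

Lemma meqoZC k x A B : meqo k A B -> meqo k (mpolyC 4 x *: A) (mpolyC 4 x *: B).
Proof. by apply: meqoZ; exact: eqo_refl. Qed.

Lemma scalerCV A : mpolyC 4 c^-1 *: (mpolyC 4 c *: A) = A.
Proof. by rewrite scalerA -mpolyCM mulVf ?(tr_c tr) // mpolyC1 scale1r. Qed.

Lemma heat_opZ l A k x U :
  heat_op l A k (mpolyC 4 x *: U) = mpolyC 4 x *: heat_op l A k U.
Proof.
have gen (p q r : P) (B D : M) :
    p *: (r *: B) - q *: (r *: D) = r *: (p *: B - q *: D).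
  by rewrite scalerBr !scalerA mulrC [q * r]mulrC.
apply: etrans _ (gen _ _ _ _ _); rewrite /heat_op; congr (_ - _ *: _).
by rewrite scalerDr -scalemxAr !diracZ -scalemxAr.
Qed.

(** The Dirac operator has weight [c] and the Clifford gradient of the rescaled distance weight
    [c^-1], so their products are invariant. *)
Lemma heat_op_transport s k U :
  meqo n (heat_op l2 (cliff_grad l2 (c^-2 *: Phi s)) k (spin_conj U))
    (spin_conj (heat_op l1 (cliff_grad l1 s) k U)).
Proof.
set c2 := cliff_grad l2 _; set c1 := cliff_grad l1 s.
have h1 : meqo n (dirac l2 (c2 *m spin_conj U)) (spin_conj (dirac l1 (c1 *m U))).
  apply: meqo_trans (dirac_meqo _ (cliff_grad_transport s U)) _.
  rewrite diracZ -[X in meqo _ _ X]scalerCV; apply: meqoZC.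
  exact: dirac_transport.
have h2 : meqo n (c2 *m dirac l2 (spin_conj U)) (spin_conj (c1 *m dirac l1 U)).
  apply: meqo_trans (meqoM (@meqo_refl _ _ _) (dirac_transport U)) _.
  rewrite -scalemxAr -[X in meqo _ _ X]scalerCV scalerA mulrC -scalerA.
  by apply: meqoZC; apply: meqoW (leqnSn n) _; exact: cliff_grad_transport.
rewrite /heat_op spin_conjB !spin_conjZ spin_conjD.
have -> : Phi (4^-1 : K)%:A = (4^-1 : K)%:A by rewrite PhiZ rmorph1.
have -> : Phi (k%:R - 2) = k%:R - 2 by rewrite rmorphB !rmorph_nat.
apply: meqoB; first exact: meqo_refl.
by apply: meqoZ; [exact: eqo_refl | apply: meqoD].
Qed.

(** [D ^ 2] has weight [c ^ 2], which forces the weight [c ^ (2 k)] on [u k]. The second application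
    of [D] costs one more order. *)
Lemma heat_prev_transport u k : (0 < n)%N ->
  meqo n.-1 (heat_prev l2 (fun k => mpolyC 4 (c ^+ (2 * k)) *: spin_conj (u k)) k)
    (mpolyC 4 (c ^+ (2 * k)) *: spin_conj (heat_prev l1 u k)).
Proof.
case: k => [|k] n0 /=; first by rewrite spin_conj0 scaler0; exact: meqo_refl.
rewrite !diracZ mulnSr exprD mpolyCM -scalerA; apply: meqoZC.
have h := dirac_transport (u k); rewrite -(prednK n0) in h.
apply: meqo_trans (dirac_meqo _ h) _.
rewrite diracZ expr2 mpolyCM -scalerA; apply: meqoZC.
by apply: meqoW (leq_pred n) _; exact: dirac_transport.
Qed.

(** Of the two orders lost, one goes to the connection, which contains derivatives of the lengths,
    and one to applying [D] twice. *)
Lemma heat_series_transport N s u : n = N.+2 -> heat_series n l1 s u ->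
  heat_series N l2 (c^-2 *: Phi s)
    (fun k => mpolyC 4 (c ^+ (2 * k)) *: spin_conj (u k)).
Proof.
move=> nN H; have [[hs1 hs2 hs3 hs4] u0 _] := H.
have c0 := tr_c tr.
have n0 : (0 < n)%N by rewrite nN.
have pi_inj := can_inj (tr_pi tr).
have pis a : exists b, a = pi b by exists (pi a); rewrite (tr_pi tr).
have fr2 a : eqo n.+1 (fr l2 (pi a) (c^-2 *: Phi s)) ((c^-1 * e a) *: Phi (fr l1 a s)).
  rewrite frZ; have -> : c^-1 * e a = c^-2 * (c * e a) by field.
  by rewrite -scalerA; apply: eqoZ; exact: fr_transport.
split; first split.
- have nN' : (N.+1 <= n.+1)%N by rewrite nN ltnW.
  apply/eq_uptoE; apply: eqoW nN' _; move/eq_uptoE : hs1 => hs1.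
  apply: (@eqo_trans _ _ (\sum_(a < 4) c^-2 *: Phi (fr l1 a s) ^+ 2)).
    rewrite (reindex_inj pi_inj); apply: eqo_sum => a _.
    apply: eqo_trans (eqoX 2 (fr2 a)) _; apply: eqo_eq.
    rewrite exprZn exprMn [e a ^+ 2](tr_e tr) mulr1; congr (_ *: _).
    by rewrite -exprVn.
  rewrite -scaler_sumr scalerA mulrC -scalerA; apply: eqoZ.
  have -> : \sum_(a < 4) Phi (fr l1 a s) ^+ 2 = Phi (\sum_(a < 4) fr l1 a s ^+ 2).
    by rewrite rmorph_sum; apply: eq_bigr => a _; rewrite rmorphXn.
  by rewrite -PhiZ; exact: Phi_eqo.
- by rewrite at0Z at0_Phi hs2 mulr0.
- move=> a; have [b ->] := pis a.
  by rewrite (eqo_at0 _ (fr2 b)) // at0Z at0_Phi hs3 mulr0.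
- move=> a b; have [a' ->] := pis a; have [b' ->] := pis b.
  rewrite pi_eq; have h := fr_eqo l2 (pi a') (fr2 b').
  rewrite (eqo_at0 n0 h) frZ at0Z.
  rewrite (eqo_at0 _ (fr_transport a' (fr l1 b' s))) // at0Z at0_Phi hs4.
  have [->|_] := eqVneq a' b'; last by rewrite !mulr0.
  rewrite !mulr1 mulrA (_ : c^-1 * e b' * (c * e b') = 1) ?mul1r //.
  transitivity (c^-1 * c * (e b' * e b')); first by ring.
  by rewrite (tr_e tr) mulVf ?mul1r.
- rewrite muln0 expr0 mpolyC1 scale1r.
  rewrite (@meqo_at0 _ 1 _ (map_mx (@mpolyC 4 K) 1%:M)) //.
    by apply/matrixP => i j; rewrite !mxE at0C.
  have h : meqo 1 (u 0%N) 1%:M.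
    by apply: at0_mxE; rewrite u0; apply/matrixP => i j; rewrite !mxE; case: (i == j);
      rewrite ?at0_1 // /at0 mcoeff0.
  apply: meqo_trans (spin_conj_meqo h) _; apply: meqo_eq.
  rewrite /spin_conj map_mx1 mulmx1 -map_mxM mulmxV ?(tr_T tr) //.
move=> k; apply/eq_uptomE.
have hN1 : (N.+1 <= n)%N by rewrite nN.
have hN2 : (N.+1 <= n.-1)%N by rewrite nN.
have h1 := meqoW hN1 (meqoZC (c ^+ (2 * k)) (heat_op_transport s k (u k))).
have h2 := meqoW hN2 (heat_prev_transport u k n0).
have h3 := meqoD h1 h2.
have h4 := meqoZC (c ^+ (2 * k)) (spin_conj_meqo (heat_seriesE k H)).
rewrite spin_conj0 scaler0 spin_conjD scalerDr in h4.
have h5 := meqo_trans h3 (meqoW (leqW hN1) h4).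
by apply: meqo_trans h5; apply: meqoD; [apply: meqo_eq; exact: heat_opZ | exact: meqo_refl].
Qed.

End Transport.

(** * Independence of the heat coefficient from all choices *)

Section HeatCoefUnique.

Variable K : numClosedFieldType.

Local Notation P := (mpoly 4 K).
Local Notation M := 'M[P]_4.
Implicit Types (l : lengths K) (s : P) (W : 'I_4 -> nat -> K).

Lemma at0_taylor N (f : nat -> K) : at0 (taylor N f) = f 0%N.
Proof.
rewrite /taylor big_ord_recl at0D at0_sum big1 => [|i _].
  by rewrite expr0 at0Z at0_1 fact0 divr1 mulr1 addr0.
by rewrite at0Z at0X at0_var expr0n mulr0.
Qed.

Lemma ord4P (a : 'I_4) :
  [\/ a = ord0, a = inord 1, a = inord 2 | a = inord 3].
Proof.
case: a => [[|[|[|[|a]]]] ha] //; [constructor 1|constructor 2|constructor 3|constructor 4];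
  by apply/val_inj; rewrite /= ?inordK.
Qed.

Lemma prod_ord4 (R : comPzRingType) (f : 'I_4 -> R) :
  \prod_(a < 4 | a != ord0) f a = f (inord 1) * f (inord 2) * f (inord 3).
Proof.
rewrite big_mkcond !big_ord_recl big_ord0 /= mul1r mulr1 mulrA.
by congr (f _ * f _ * f _); apply/val_inj; rewrite /= inordK.
Qed.

(** Indexing the three functions by ['I_4] lets permutations of the invariant fields act on them. *)
Lemma metric_lengthsE N W (F : nat -> K) l :
  metric_lengths N (W (inord 1)) (W (inord 2)) (W (inord 3)) F l <->
  [/\ eqo N.+1 (len l ord0 ^+ 2)
        (taylor N F * \prod_(a < 4 | a != ord0) taylor N (W a)),
      forall a, a != ord0 -> eqo N.+1 (len l a * taylor N (W a)) (len l ord0)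
    & forall a, eqo N.+1 (len l a * ilen l a) 1].
Proof.
rewrite prod_ord4 !mulrA.
split=> [[h0 h1 h2 h3 hi]|[h0 hw hi]].
  split=> [|a a0|a]; [exact/eq_uptoE | | by apply/eq_uptoE; exact: hi].
  have [a00|->|->|->] := ord4P a; try exact/eq_uptoE.
  by rewrite a00 in a0.
have nz k : (0 < k < 4)%N -> inord k != ord0 :> 'I_4.
  by case/andP=> k0 k4; rewrite -val_eqE /= inordK // -lt0n.
split; last by move=> a; apply/eq_uptoE; exact: hi.
all: apply/eq_uptoE => //; apply: hw; exact: nz.
Qed.

Lemma metric_nz N W (F : nat -> K) l :
  metric_lengths N (W (inord 1)) (W (inord 2)) (W (inord 3)) F l ->
  [/\ forall a, at0 (len l a) != 0, nondeg l
    & forall a, a != ord0 -> W a 0%N != 0].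
Proof.
move=> /metric_lengthsE [_ hw hi].
have h a : at0 (len l a) * at0 (ilen l a) = 1.
  by rewrite -at0M (eqo_at0 _ (hi a)) // at0_1.
have hl a : at0 (len l a) != 0.
  by apply: contra_eq_neq (h a) => ->; rewrite mul0r eq_sym oner_neq0.
split=> // a.
  by apply: contra_eq_neq (h a) => ->; rewrite mulr0 eq_sym oner_neq0.
move=> /hw /(eqo_at0 (isT : (0 < N.+1)%N)); rewrite at0M at0_taylor => h1.
by apply: contra_eq_neq h1 => ->; rewrite mulr0 eq_sym.
Qed.

(** In [(p - q) (p + q)] at least one factor is a unit, since their values at the origin differ by
    [2 at0 q]; the other factor is then small. *)
Lemma eqo_sqr n p q : at0 q != 0 -> eqo n (p ^+ 2) (q ^+ 2) ->
  exists2 x : K, x * x = 1 & eqo n p (x *: q).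
Proof.
move=> q0; rewrite /eqo subr_sqr => h.
have [pq|pq] := eqVneq (at0 (p + q)) 0.
  exists (-1); first by rewrite mulrNN mulr1.
  rewrite scaleN1r opprK; rewrite mulrC in h.
  apply: ordge_unit h; rewrite at0B.
  move/eqP: pq; rewrite at0D addr_eq0 => /eqP ->.
  by rewrite -opprD oppr_eq0 -mulr2n mulrn_eq0 negb_or.
by exists 1; rewrite ?mulr1 // scale1r; exact: ordge_unit h.
Qed.

(** The ambiguity in the sign of [h] is treated as a homothety with trivial substitution and factor
    [c = x], whose weight [x ^ (2 k)] is 1. *)
Lemma transports_sign n l l' x : x * x = 1 ->
  (forall a, eqo n.+1 (len l' a) (x *: len l a)) ->
  (forall a, eqo n.+1 (ilen l' a) (x *: ilen l a)) ->
  transports n l l' idfun id (fun=> 1) 1 1 x 1%:M.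
Proof.
move=> xx hl hi.
have x0 : x != 0 by apply: contra_eq_neq xx => ->; rewrite mul0r eq_sym oner_neq0.
split=> //=.
- by move=> a; rewrite mulr1.
- by move=> a b d; rewrite !mul1r.
- by rewrite mulr1; exact: eqo_refl.
- move=> a _; rewrite vf_vfield /vfield big1 // => i _.
  by rewrite -[1]mpolyC1 mderivC mulr0.
- by move=> a p; rewrite scale1r /psi'; case: eqP; rewrite mul1r.
- by move=> a; rewrite /psi; case: eqP; rewrite mul1r.
- move=> a; have -> : x^-1 = x by rewrite -[LHS]mulr1 -xx mulKf.
  by rewrite /psi'; case: eqP; rewrite mul1r.
- exact: unitmx1.
- by move=> a; rewrite scale1r mulmx1 mul1mx.
Qed.

Lemma metric_lengths_unique N W (F : nat -> K) l l' :
  metric_lengths N (W (inord 1)) (W (inord 2)) (W (inord 3)) F l ->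
  metric_lengths N (W (inord 1)) (W (inord 2)) (W (inord 3)) F l' ->
  exists x, transports N l l' idfun id (fun=> 1) 1 1 x 1%:M /\ x * x = 1.
Proof.
move=> m m'; have [nz _ wnz] := metric_nz m.
move: m m' => /metric_lengthsE [h0 hw hi] /metric_lengthsE [h0' hw' hi'].
have [x xx h] := eqo_sqr (nz ord0) (eqo_trans h0' (eqo_sym h0)).
have hl a : eqo N.+1 (len l' a) (x *: len l a).
  have [->//|a0] := eqVneq a ord0.
  apply: (@eqo_mulIr _ _ _ _ (taylor N (W a))); first by rewrite at0_taylor wnz.
  apply: eqo_trans (hw' a a0) _; apply: eqo_trans h _.
  by rewrite -scalerAl; apply: eqoZ; apply: eqo_sym; exact: hw.
exists x; split=> //; apply: transports_sign => // a.
apply: (eqo_inv_uniq (hl a) (hi' a)).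
by rewrite -scalerAl -scalerAr scalerA xx scale1r.
Qed.

Lemma heat_seriesW n k l s u : (k <= n)%N -> heat_series n l s u -> heat_series k l s u.
Proof.
move=> kn [[h1 h2 h3 h4] h5 h6]; split=> //; first split=> //.
  by move=> m mk; apply: h1; apply: leq_trans kn.
by move=> i a b m mk; apply: h6; apply: leq_trans kn.
Qed.

Lemma at0_Cmul x p : at0 (mpolyC 4 x * p) = x * at0 p :> K.
Proof. by rewrite mul_mpolyC at0Z. Qed.

(** The trace ignores conjugation and [Phi] fixes values at the origin, so only the scalar weight is
    seen. *)
Lemma tr_at0_spin_conj n l1 l2 (Phi : {rmorphism P -> P}) pi e chi chii c T x (U : M) :
  transports n l1 l2 Phi pi e chi chii c T ->
  \tr (map_mx (@at0 K) (mpolyC 4 x *: spin_conj Phi T U)) = x * \tr (map_mx (@at0 K) U).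
Proof.
move=> tr.
have -> : map_mx (@at0 K) (mpolyC 4 x *: spin_conj Phi T U) =
    x *: (T *m map_mx (@at0 K) U *m invmx T).
  apply/matrixP => i j; rewrite !mxE at0_Cmul; congr (_ * _).
  rewrite at0_sum; apply: eq_bigr => k _; rewrite !mxE at0M at0C; congr (_ * _).
  rewrite at0_sum; apply: eq_bigr => k' _; rewrite !mxE at0M at0C; congr (_ * _).
  exact: at0_Phi tr _.
by rewrite linearZ /= mxtrace_mulC mulmxA mulVmx ?(tr_T tr) // mul1mx.
Qed.

Lemma heat_coef_unique n (w1 w2 w3 F : nat -> K) a a' :
  is_heat_coef n w1 w2 w3 F a -> is_heat_coef n w1 w2 w3 F a' -> a = a'.
Proof.
move=> H H'.
(* With this [N] the two kernels agree on [u n] modulo order [N.-1 - 2 * n = 2], enough to compare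
   values; the transport by the sign uses up two more orders, hence [N.+2] below. *)
pose N := (2 * n).+3.
have [l [s [u [m h ->]]]] := H N.+2; have [l' [s' [u' [m' h' ->]]]] := H' N.+2.
pose W (i : 'I_4) := if i == inord 1 then w1 else if i == inord 2 then w2 else w3.
have EW : [/\ W (inord 1) = w1, W (inord 2) = w2 & W (inord 3) = w3].
  by rewrite /W -!val_eqE /= !inordK.
have [E1 E2 E3] := EW; rewrite -E1 -E2 -E3 in m m' *.
have [_ nd _] := metric_nz m.
have [x [tr xx]] := metric_lengths_unique m' m.
have h2 := heat_series_transport tr (erefl _) h'.
have h1 : heat_series N l s u by apply: heat_seriesW h; rewrite -addn2 leq_addr.
have := @heat_series_unique _ _ _ _ _ _ _ nd h1 h2 n.
have -> : (N.-1 - 2 * n = 2)%N by rewrite /N /= -[X in (X - _)%N]addn2 addKn.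
move=> /(meqo_at0 (isT : (0 < 2)%N)) ->.
by rewrite (tr_at0_spin_conj _ _ tr) exprM (_ : x ^+ 2 = 1) // expr1n mul1r.
Qed.

End HeatCoefUnique.

(** * Change of time combined with the exchange of two invariant fields *)

Section Reparametrization.

Variable K : numClosedFieldType.

Local Notation P := (mpoly 4 K).
Implicit Types (p q : P) (l : lengths K).

Lemma mpoly_mul_ind (Q : P -> Prop) :
  (forall c, Q (mpolyC 4 c)) -> (forall i, Q (var K i)) ->
  (forall p q, Q p -> Q q -> Q (p + q)) -> (forall p q, Q p -> Q q -> Q (p * q)) ->
  forall p, Q p.
Proof.
move=> QC QX QD QM.
have Qm (m : multinom 4) : Q (mpolyX K m).
  have [k] := ubnP (mdeg m); elim: k m => // k IH m mk.
  have [->|m0] := eqVneq m mnm0; first by rewrite mpolyX0 -mpolyC1; exact: QC.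
  have /existsP [i mi] : [exists i : 'I_4, (0 < m i)%N].
    apply: contraR m0 => /existsPn h; apply/eqP/mnmP => i.
    by rewrite mnm0E; apply/eqP; rewrite -leqn0 leqNgt h.
  have Hle := lep1mP i m; rewrite -lt0n mi in Hle.
  rewrite -(submK Hle) in mk *; rewrite mpolyXD; apply: QM; last exact: QX.
  by apply: IH; move: mk; rewrite mdegD mdeg1 addn1 ltnS.
elim/mpolyind => [|c m p _ _ Qp]; first by rewrite -mpolyC0; exact: QC.
by apply: QD => //; rewrite -mul_mpolyC; apply: QM.
Qed.

(** Meant for [vf_time_subst], both sides of which are derivations along the substitution and are
    therefore determined by the variables. *)
Lemma derivation_ext (Phi D D' : P -> P) :
  (forall p q, D (p + q) = D p + D q) -> (forall p q, D' (p + q) = D' p + D' q) ->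
  (forall p q, D (p * q) = D p * Phi q + Phi p * D q) ->
  (forall p q, D' (p * q) = D' p * Phi q + Phi p * D' q) ->
  (forall c, D (mpolyC 4 c) = D' (mpolyC 4 c)) ->
  (forall i, D (var K i) = D' (var K i)) -> forall p, D p = D' p.
Proof.
move=> hD hD' hM hM' hC hX; apply: mpoly_mul_ind => // p q hp hq.
  by rewrite hD hD' hp hq.
by rewrite hM hM' hp hq.
Qed.

Variables (i j : 'I_4).
Hypotheses (i0 : i != ord0) (j0 : j != ord0) (ij : i != j).

Definition swap (a : 'I_4) : 'I_4 := if a == i then j else if a == j then i else a.

(** A transposition of the invariant fields reverses their brackets; changing the sign of all three
    restores them. The result is an automorphism of su(2), the rotation by pi about the axis
    [e_i - e_j]. *)
Definition swap_sign (a : 'I_4) : K := if a == ord0 then 1 else -1.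

Lemma swapK : involutive swap.
Proof.
move=> a; rewrite /swap.
have [->|ai] := eqVneq a i; first by rewrite eqxx eq_sym (negbTE ij).
have [->|aj] := eqVneq a j; first by rewrite eqxx.
by rewrite (negbTE ai) (negbTE aj).
Qed.

Lemma swap0 : swap ord0 = ord0.
Proof. by rewrite /swap !(eq_sym ord0) (negbTE i0) (negbTE j0). Qed.

Lemma swap_eq0 a : (swap a == ord0) = (a == ord0).
Proof. by rewrite -{1}swap0 (inj_eq (can_inj swapK)). Qed.

Lemma eps_swap a b d : eps K (swap a) (swap b) (swap d) =
  swap_sign a * swap_sign b * swap_sign d * eps K a b d.
Proof.
rewrite /swap /swap_sign /eps.
move: i j i0 j0 ij => [[|[|[|[|ii]]]] hi] [[|[|[|[|jj]]]] hj] //= _ _ _;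
  move: a b d => [[|[|[|[|a]]]] ha] [[|[|[|[|b]]]] hb] [[|[|[|[|d]]]] hd] //=;
  by rewrite /= ?mulr0 ?mulr1 ?mulrN1 ?opprK.
Qed.

(** Up to a scalar, the spin lift of the rotation by pi about [e_i - e_j], the same on both
    half-spinor spaces. *)
Definition swap_spin : 'M[K]_4 :=
  block_mx (pauli K i - pauli K j) 0 0 (pauli K i - pauli K j) : 'M[K]_(2 + 2).

Lemma ord4_bounds (a : 'I_4) : a != ord0 -> (1 <= a <= 3)%N.
Proof. by case: a => [[|[|[|[|]]]]]. Qed.

Lemma pauli_sq (a : 'I_4) : a != ord0 -> pauli K a *m pauli K a = 1%:M.
Proof.
move=> a0; have two : (2 : K) != 0 by rewrite pnatr_eq0.
apply: (scalerI two); rewrite scaler_nat mulr2n pauli_anticomm ?ord4_bounds //.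
by rewrite eqxx mulr1 scale_scalar_mx mulr1.
Qed.

Lemma pauli_anti (a b : 'I_4) : a != ord0 -> b != ord0 -> a != b ->
  pauli K a *m pauli K b = - (pauli K b *m pauli K a).
Proof.
move=> a0 b0 ab; apply/eqP; rewrite -addr_eq0 pauli_anticomm ?ord4_bounds //.
by rewrite (_ : (a == b :> nat) = false) ?mulr0 ?raddf0 //; apply/negbTE.
Qed.

Lemma swap_pauli (a : 'I_4) : a != ord0 ->
  pauli K (swap a) *m (pauli K i - pauli K j) = - ((pauli K i - pauli K j) *m pauli K a).
Proof.
move=> a0; rewrite mulmxBr mulmxBl opprB /swap.
have [->|ai] := eqVneq a i.
  by rewrite !pauli_sq.
have [->|aj] := eqVneq a j.
  by rewrite !pauli_sq.
by rewrite (pauli_anti a0 i0 ai) (pauli_anti a0 j0 aj) opprK addrC.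
Qed.

Lemma swap_spin_unit : swap_spin \in unitmx.
Proof.
have sq : (pauli K i - pauli K j) *m (pauli K i - pauli K j) = 2%:M.
  rewrite mulmxBr !mulmxBl !pauli_sq // (pauli_anti i0 j0 ij) opprB opprK addrA.
  by rewrite addrAC subrK -raddfD.
have E : swap_spin *m (2^-1 *: swap_spin) = 1%:M.
  rewrite -scalemxAr.
  have -> : swap_spin *m swap_spin = 2%:M.
    set Z := pauli K i - pauli K j in sq *.
    have := mulmx_block Z 0 0 Z Z 0 0 Z.
    rewrite !mulmx0 !mul0mx !addr0 !add0r sq => h.
    by rewrite /swap_spin -/Z; apply: (etrans h); rewrite -scalar_mx_block.
  by rewrite scale_scalar_mx mulVf // pnatr_eq0.
by case: (mulmx1_unit E).
Qed.

Lemma gamma_swap (a : 'I_4) :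
  gamma K (swap a) *m swap_spin = swap_sign a *: (swap_spin *m gamma K a).
Proof.
have mulB (X Y Z : 'M[K]_2) : (block_mx 0 X Y 0 : 'M[K]_(2 + 2)) *m block_mx Z 0 0 Z
    = block_mx 0 (X *m Z) (Y *m Z) 0.
  by rewrite mulmx_block !mul0mx !mulmx0 !addr0 !add0r.
have mulB' (X Y Z : 'M[K]_2) : (block_mx Z 0 0 Z : 'M[K]_(2 + 2)) *m block_mx 0 X Y 0
    = block_mx 0 (Z *m X) (Z *m Y) 0.
  by rewrite mulmx_block !mul0mx !mulmx0 !addr0 !add0r.
rewrite /gamma swap_eq0 /swap_sign.
set Z := pauli K i - pauli K j in mulB mulB' *.
have [a00|a0] := eqVneq a ord0.
  rewrite scale1r; apply: (etrans (mulB (- 1%:M) 1%:M Z)).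
  apply: esym; apply: (etrans (mulB' (- 1%:M) 1%:M Z)).
  by rewrite !mulNmx !mulmxN !mul1mx !mulmx1.
rewrite -scalemxAl -scalemxAr scalerA mulrC -scalerA; congr (_ *: _).
apply: (etrans (mulB _ _ Z)).
have h := swap_pauli a0; rewrite -/Z in h.
rewrite h scaleN1r; apply: esym.
apply: (etrans (congr1 -%R (mulB' (pauli K a) (pauli K a) Z))).
by apply: (etrans (opp_block_mx _ _ _ _)); rewrite !oppr0.
Qed.

Variable phi : P.
Hypotheses (phi0 : at0 phi = 0) (phi_time : forall a, a != ord0 -> mderiv a phi = 0).

(** The rotation fixes [Re q] and acts linearly on [Im q], hence linearly on the coordinates [y];
    time becomes [phi]. *)
Definition subst_tuple : 4.-tuple P :=
  [tuple if b == ord0 then phi else - var K (swap b) | b < 4].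

Definition time_subst : P -> P := comp_mpoly subst_tuple.

Lemma time_subst_var b :
  time_subst (var K b) = if b == ord0 then phi else - var K (swap b).
Proof. by rewrite /time_subst /var comp_mpolyXU -tnth_nth tnth_mktuple. Qed.

Lemma time_subst_C c : time_subst (mpolyC 4 c) = mpolyC 4 c.
Proof. exact: comp_mpolyC. Qed.

Lemma ordge_phi : ordge 1 phi. Proof. exact/ordge1E. Qed.

Lemma time_subst_ordge k p : ordge k p -> ordge k (time_subst p).
Proof.
move=> hp; rewrite /time_subst comp_mpolyEX big_seq; apply: ordge_sum => m.
rewrite mcoeff_msupp => pm; apply: ordgeZ.
have km : (k <= mdeg m)%N by rewrite leqNgt; apply: contra pm => /hp ->.
apply: ordgeW km _; rewrite comp_mpolyX mdegE.
have hX b : ordge 1 (tnth subst_tuple b).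
  rewrite tnth_mktuple; case: eqP => _; first exact: ordge_phi.
  by apply: ordgeN; exact: ordge_var.
elim/big_rec2: _ => [|b x y _ h]; first exact: ordge0.
by apply: ordgeM => //; exact: ordgeX.
Qed.

Lemma vf_var_eq (a b : 'I_4) : a != ord0 -> b != ord0 ->
  vf a (var K b) = - (2^-1 : K) *: ((a == b)%:R + var K a * var K b
     + \sum_(d < 4 | d != ord0) eps K a b d *: var K d).
Proof.
by move=> /negbTE a0 /negbTE b0; rewrite vf_vfield vfield_var /vfc a0 b0.
Qed.

Lemma vf_time_subst a p : vf (swap a) (time_subst p) =
  swap_sign a *: (psi' (mderiv ord0 phi) a * time_subst (vf a p)).
Proof.
have sD : forall p q, time_subst (p + q) = time_subst p + time_subst q := rmorphD _.
have sM : forall p q, time_subst (p * q) = time_subst p * time_subst q := rmorphM _.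
have vC c b : vf b (mpolyC 4 c) = 0 :> P.
  by rewrite vf_vfield /vfield big1 // => d _; rewrite mderivC mulr0.
pose Phi : P -> P := time_subst.
move: p; apply: (@derivation_ext Phi) => [p q|p q|p q|p q|c|b].
- by rewrite sD vfD.
- by rewrite vfD sD mulrDr scalerDr.
- by rewrite sM vfM.
- rewrite vfM sD !sM -!mul_mpolyC /Phi.
  move: (time_subst _) (time_subst _) (time_subst p) (time_subst q) => x y z t; ring.
- rewrite time_subst_C !vC (_ : time_subst 0 = 0) ?mulr0 ?scaler0 //.
  exact: (rmorph0 (comp_mpoly subst_tuple)).
have vphi c : c != ord0 -> vf c phi = 0.
  move=> c0; rewrite vf_vfield /vfield (bigD1 ord0) //= big1 => [|d d0].
    by rewrite /vfc (negbTE c0) eqxx mul0r addr0.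
  by rewrite phi_time // mulr0.
have S0 : time_subst 0 = 0 by exact: (rmorph0 (comp_mpoly subst_tuple)).
have S1 : time_subst 1 = 1 by exact: (rmorph1 (comp_mpoly subst_tuple)).
have vN c q : vf c (- q) = - vf c q by rewrite -scaleN1r vfZ scaleN1r.
have vX c d : vf c (var K d) = vfc K c d by rewrite vf_vfield vfield_var.
rewrite time_subst_var; have [b0|b0] := eqVneq b ord0; have [a0|a0] := eqVneq a ord0.
- rewrite a0 b0 swap0 vX /vfc /psi' /swap_sign !eqxx S1 mulr1 scale1r.
  by rewrite vf_vfield /vfield (bigD1 ord0) //= big1 ?addr0 ?mul1r // => d /negbTE d0;
    rewrite /vfc eqxx d0 mul0r.
- rewrite vphi ?swap_eq0 // vX /vfc (negbTE a0) b0 eqxx.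
  by rewrite [X in _ *: (_ * X)]S0 mulr0 scaler0.
- rewrite a0 swap0 vN !vX /vfc !eqxx swap_eq0 (negbTE b0) oppr0.
  by rewrite [X in _ *: (_ * X)]S0 mulr0 scaler0.
rewrite vN !vf_var_eq ?swap_eq0 // /psi' /swap_sign (negbTE a0) mul1r scaleN1r.
have sZ x q : time_subst (x *: q) = x *: time_subst q.
  by rewrite -!mul_mpolyC sM time_subst_C.
rewrite sZ; congr (- (_ *: _)).
(* The quadratic term is even in [y]. The linear term is odd, and its sign is the one that
   [eps_swap] produces. *)
have -> : time_subst ((a == b)%:R + var K a * var K b
    + \sum_(d < 4 | d != ord0) eps K a b d *: var K d) =
    (a == b)%:R + var K (swap a) * var K (swap b)
    - \sum_(d < 4 | d != ord0) eps K a b d *: var K (swap d).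
  rewrite !sD sM !time_subst_var (negbTE a0) (negbTE b0) mulrNN.
  congr (_ + _ + _); first by case: (a == b).
  rewrite (big_morph time_subst sD S0) -sumrN; apply: eq_bigr => d /negbTE d0.
  by rewrite sZ time_subst_var d0 scalerN.
rewrite (inj_eq (can_inj swapK)); congr (_ + _).
rewrite (reindex_inj (can_inj swapK)) -sumrN; apply: eq_big => d; first by rewrite swap_eq0.
rewrite swap_eq0 => d0; rewrite eps_swap /swap_sign (negbTE a0) (negbTE b0) (negbTE d0).
by rewrite mulrNN mulr1 mul1r mulN1r scaleNr.
Qed.

Lemma mderiv0_time a : a != ord0 -> vf a (mderiv ord0 phi) = 0.
Proof.
move=> a0; rewrite vf_vfield /vfield (bigD1 ord0) //= big1 => [|d d0].
  by rewrite /vfc (negbTE a0) eqxx mul0r addr0.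
by rewrite mderiv_comm phi_time // mderiv0 mulr0.
Qed.

Lemma taylorW k n (f : nat -> K) : (k <= n)%N ->
  eqo k.+1 (taylor k f) (taylor n f).
Proof.
elim: n => [|n IH]; first by rewrite leqn0 => /eqP ->; exact: eqo_refl.
rewrite leq_eqVlt => /orP [/eqP ->|kn]; first exact: eqo_refl.
apply: eqo_trans (IH kn) _; rewrite /eqo /taylor [X in _ - X]big_ord_recr /=.
rewrite opprD addNKr; apply: ordgeN; apply: ordgeZ.
by apply: ordgeW kn _; apply: ordgeX; exact: ordge_var.
Qed.

Lemma metric_lengthsW k n (V : 'I_4 -> nat -> K) G l : (k <= n)%N ->
  metric_lengths n (V (inord 1)) (V (inord 2)) (V (inord 3)) G l ->
  metric_lengths k (V (inord 1)) (V (inord 2)) (V (inord 3)) G l.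
Proof.
move=> kn /metric_lengthsE [h1 h2 h3]; apply/metric_lengthsE.
have kn' : (k.+1 <= n.+1)%N by [].
split=> [|a a0|a]; last exact: eqoW (h3 a).
- apply: eqo_trans (eqoW kn' h1) _; rewrite !prod_ord4.
  by do ?apply: eqoM; apply: eqo_sym; exact: taylorW.
- apply: eqo_trans (eqoW kn' (h2 a a0)); apply: eqoM; first exact: eqo_refl.
  exact: taylorW.
Qed.

Section Transfer.

Variables (n N : nat) (W V : 'I_4 -> nat -> K) (F G : nat -> K) (d chi0 : K).
Hypotheses (d0 : d != 0) (chi_neq0 : chi0 != 0).
Hypothesis at0_chi : at0 (mderiv ord0 phi) = chi0.
Hypothesis subst_W : forall a, a != ord0 ->
  eqo N.+3 (time_subst (taylor N.+2 (W a)) * mderiv ord0 phi)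
    (taylor N.+2 (V (swap a))).
Hypothesis subst_F : eqo N.+3 (time_subst (taylor N.+2 F))
  (d *: (mderiv ord0 phi * taylor N.+2 G)).

(** The metric of [(W, F)], pulled back by the change of time, is [d] times that of [(V, G)]. The
    trace of [u n] gains [d ^ n], and comparing the two densities gives [chi0 / d ^ 2]. *)
Lemma heat_coef_time_subst a :
  is_heat_coef n (W (inord 1)) (W (inord 2)) (W (inord 3)) F a ->
  exists (l : lengths K) (s : P) (u : nat -> 'M[P]_4),
    [/\ metric_lengths N (V (inord 1)) (V (inord 2)) (V (inord 3)) G l,
        heat_series N l s u
      & chi0 * (d ^+ n / d ^+ 2) * a = G 0%N ^+ 2 * V (inord 1) 0%N
          * V (inord 2) 0%N * V (inord 3) 0%N * \tr (map_mx (@at0 K) (u n))].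
Proof.
move=> /(_ N.+2) [l1 [s [u [m h ->]]]].
have [_ _ Wnz] := metric_nz m.
move: m => /metric_lengthsE [m0 mw mi].
pose chi := mderiv ord0 phi.
have chi_nz : at0 chi != 0 by rewrite at0_chi.
have [chii hchi] := eqo_inv_ex N.+3 chi_nz.
pose c := sqrtC d.
have cc : c ^+ 2 = d by rewrite sqrtCK.
have c0 : c != 0 by rewrite sqrtC_eq0.
pose Phi : {rmorphism P -> P} := comp_mpoly subst_tuple.
(* The lengths of the target metric are defined as the transported ones; that they belong to
   [(V, G)] is what the substitution rules have to provide. *)
pose l2 : lengths K := {|
  len := fun a => c^-1 *: (psi' chi (swap a) * Phi (len l1 (swap a)));
  ilen := fun a => c *: (psi chii (swap a) * Phi (ilen l1 (swap a))) |}.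
have tr : transports N.+2 l1 l2 Phi swap swap_sign chi chii c swap_spin.
  split=> //.
  - exact: time_subst_C.
  - exact: time_subst_ordge.
  - exact: swapK.
  - exact: swap0.
  - by move=> b; rewrite /swap_sign; case: (b == ord0); rewrite ?mulrNN mulr1.
  - exact: eps_swap.
  - exact: mderiv0_time.
  - exact: vf_time_subst.
  - by move=> b; rewrite /= swapK; exact: eqo_refl.
  - by move=> b; rewrite /= swapK; exact: eqo_refl.
  - exact: swap_spin_unit.
  - exact: gamma_swap.
have PhiZ' x q : Phi (x *: q) = x *: Phi q by exact: PhiZ tr _ _.
exists l2, (c^-2 *: Phi s), (fun k => mpolyC 4 (c ^+ (2 * k)) *: spin_conj Phi swap_spin (u k)).
have sw_inj := can_inj swapK.
have prodV : \prod_(b < 4 | b != ord0) taylor N.+2 (V b)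
    = \prod_(b < 4 | b != ord0) taylor N.+2 (V (swap b)).
  by rewrite (reindex_inj sw_inj); apply: eq_bigl => b; rewrite swap_eq0.
have ci2 : c^-1 ^+ 2 * d = 1 by rewrite -cc -exprMn mulVf ?expr1n.
split.
- apply: (@metric_lengthsW _ N.+2); first by rewrite ltnW.
  apply/metric_lengthsE; split.
  + rewrite /= swap0 /psi' eqxx exprZn exprMn prodV.
    rewrite -rmorphXn.
    apply: eqo_trans (eqoZ _ (eqoM (@eqo_refl _ _ _) (Phi_eqo tr m0))) _.
    rewrite rmorphM rmorph_prod.
    apply: (@eqo_trans _ _ (c^-1 ^+ 2 *: (chi ^+ 2 * ((d *: (chi * taylor N.+2 G)) *
       \prod_(b < 4 | b != ord0) Phi (taylor N.+2 (W b)))))).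
      apply: eqoZ; apply: eqoM; first exact: eqo_refl.
      by apply: eqoM; last exact: eqo_refl.
    (* Of the three factors [chi], two come from the squared time length and one from [subst_F];
       each [w] takes one, and [c ^ -2] cancels [d]. *)
    apply: (@eqo_trans _ _ (taylor N.+2 G *
       \prod_(b < 4 | b != ord0) (Phi (taylor N.+2 (W b)) * chi))).
      apply: eqo_eq; rewrite -scalerAl -scalerAr scalerA ci2 scale1r !prod_ord4.
      by move: (Phi _) (Phi _) (Phi _) (taylor _ G) => x y z t; ring.
    rewrite !prod_ord4; apply: eqoM; first exact: eqo_refl.
    by do ?apply: eqoM; apply: subst_W; rewrite -val_eqE /= inordK.
  + move=> b b0; rewrite /= swap0 /psi' eqxx swap_eq0 (negbTE b0) mul1r.
    rewrite -scalerAl; apply: eqoZ.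
    have sb0 : swap b != ord0 by rewrite swap_eq0.
    have := subst_W sb0; rewrite swapK => hb.
    apply: eqo_trans (eqoM (@eqo_refl _ _ _) (eqo_sym hb)) _.
    rewrite mulrA mulrC; apply: eqoM; first exact: eqo_refl.
    rewrite -[time_subst _]/(Phi _) -rmorphM; exact: Phi_eqo tr _ _ _ (mw _ sb0).
  move=> b /=.
  have hb := Phi_eqo tr (mi (swap b)).
  rewrite rmorphM rmorph1 in hb.
  have hp := psiK tr (swap b).
  have := eqoM hp hb; rewrite mulr1; apply: eqo_trans.
  apply: eqo_eq; rewrite -scalerAl -scalerAr scalerA mulVf // scale1r.
  by rewrite mulrACA [psi' _ _ * _]mulrC.
- have hh := heat_series_transport tr (erefl N.+2) h; exact: hh.
rewrite (tr_at0_spin_conj _ _ tr).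
have at0_subst p : at0 (time_subst p) = at0 p by exact: at0_Phi tr p.
have hF : F 0%N = d * (chi0 * G 0%N).
  have := eqo_at0 (isT : (0 < N.+3)%N) subst_F.
  by rewrite at0_subst at0_taylor at0Z (at0M chi) at0_chi at0_taylor.
have hW b : b != ord0 -> V (swap b) 0%N = chi0 * W b 0%N.
  move=> b0; have := eqo_at0 (isT : (0 < N.+3)%N) (subst_W b0).
  by rewrite (at0M _ chi) at0_subst !at0_taylor at0_chi mulrC => ->.
have pW : V (inord 1) 0%N * V (inord 2) 0%N * V (inord 3) 0%N =
    chi0 ^+ 3 * (W (inord 1) 0%N * W (inord 2) 0%N * W (inord 3) 0%N).
  rewrite -(prod_ord4 (fun b => V b 0%N)) -(prod_ord4 (fun b => W b 0%N)).
  rewrite (reindex_inj sw_inj).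
  under eq_bigl do rewrite swap_eq0.
  under eq_bigr => b b0 do rewrite hW //.
  by rewrite !prod_ord4; ring.
rewrite exprM cc -!mulrA [V _ 0%N * (V _ 0%N * _)]mulrA [V _ 0%N * V _ 0%N * _]mulrA pW hF.
have dn : d ^+ n != 0 by rewrite expf_neq0.
move: (W _ 0%N) (W _ 0%N) (W _ 0%N) (\tr _) (d ^+ n) (G 0%N) => x y z t u' g.
by field; rewrite d0.
Qed.

End Transfer.

End Reparametrization.

(** * Smooth functions and their jets *)

Section SmoothFunctions.

Local Open Scope classical_set_scope.

Variable K : numClosedFieldType.
Implicit Types (f g r : K -> K) (A B : set K) (x d e c : K).

Definition smooth_on A f : Prop :=
  forall n x, A x -> derivable (derive1n n f) x 1.

Lemma is_derive_derive1 f x d : is_derive x (1 : K) f d -> derive1 f x = d.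
Proof. by move=> h; rewrite derive1E derive_val. Qed.

Lemma is_derive_comp f r x d e : is_derive x (1 : K) r e -> is_derive (r x) (1 : K) f d ->
  is_derive x (1 : K) (fun t => f (r t)) (d * e).
Proof.
move=> [hr <-] [hf <-].
have dr : differentiable r x by exact/derivable1_diffP.
have df : differentiable f (r x) by exact/derivable1_diffP.
have dfr : differentiable (f \o r) x by exact/differentiable_comp.
apply: DeriveDef; first exact/derivable1_diffP.
rewrite -!derive1E (@derive1E' _ _ (fun t => f (r t))) // diff_comp //.
rewrite !derive1E' //= -[X in 'd  _ _ X = _]mulr1.
by rewrite [LHS]linearZ mulrC.
Qed.

Lemma is_derive_mul f g x d e : is_derive x (1 : K) f d -> is_derive x (1 : K) g e ->
  is_derive x (1 : K) (fun t => f t * g t) (d * g x + f x * e).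
Proof.
move=> hf hg; have h := is_deriveM hf hg.
by apply: (is_derive_eq h); rewrite addrC [d * _]mulrC.
Qed.

Lemma is_derive_inv f x d : f x != 0 -> is_derive x (1 : K) f d ->
  is_derive x (1 : K) (fun t => (f t)^-1) (- d * ((f x)^-1 * (f x)^-1)).
Proof.
move=> f0 [hf <-]; apply: DeriveDef; first exact: derivableV.
by rewrite deriveV // -[_ *: _]/(_ * _) mulNr mulNr mulrC -invfM.
Qed.

(** Closure of the smooth functions under the operations that occur in the family. It is stable
    under differentiation, which yields smoothness of composites without formulas for higher
    derivatives. *)
Inductive smooth_gen A : (K -> K) -> Prop :=
| SmoothBase f : smooth_on A f -> smooth_gen A f
| SmoothAdd f g : smooth_gen A f -> smooth_gen A g -> smooth_gen A (fun x => f x + g x)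
| SmoothMul f g : smooth_gen A f -> smooth_gen A g -> smooth_gen A (fun x => f x * g x)
| SmoothInv f : (forall x, A x -> f x != 0) -> smooth_gen A f ->
    smooth_gen A (fun x => (f x)^-1)
| SmoothComp B f r : smooth_on B f -> smooth_gen A r -> (forall x, A x -> B (r x)) ->
    smooth_gen A (fun x => f (r x)).

Lemma smooth_on_derive1 A f : smooth_on A f -> smooth_on A (derive1 f).
Proof. by move=> h n x Ax; rewrite -derive1Sn; exact: h. Qed.

Lemma smooth_is_derive A f x : smooth_on A f -> A x -> is_derive x (1 : K) f (derive1 f x).
Proof. by move=> h Ax; rewrite derive1E; apply: derivableP; exact: (h 0%N). Qed.

Lemma smooth_on_cst A c : smooth_on A (fun=> c).
Proof.
move=> n x _; suff [d ->] : exists d : K, derive1n n (fun=> c) = (fun=> d).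
  exact: derivable_cst.
elim: n => [|n [d IH]]; first by exists c.
by exists 0; rewrite derive1nS IH; apply/funext => t; rewrite derive1_cst.
Qed.

Lemma smooth_on_id A : smooth_on A (fun x => x).
Proof.
have h : derive1 (fun x : K => x) = (fun=> 1).
  by apply/funext => t; rewrite derive1E derive_id.
case=> [|n] x Ax; first exact: derivable_id.
by rewrite derive1Sn h; exact: smooth_on_cst Ax.
Qed.

Lemma smooth_gen_derive A f : smooth_gen A f -> exists2 g, smooth_gen A g &
  forall x, A x -> is_derive x (1 : K) f (g x).
Proof.
elim=> {f}.
- move=> f hf; exists (derive1 f); first by apply: SmoothBase; exact: smooth_on_derive1.
  by move=> x; exact: smooth_is_derive.
- move=> f g hf [f' sf' df] hg [g' sg' dg].
  exists (fun x => f' x + g' x); first exact: SmoothAdd.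
  by move=> x Ax; exact: is_deriveD (df x Ax) (dg x Ax).
- move=> f g hf [f' sf' df] hg [g' sg' dg].
  exists (fun x => f' x * g x + f x * g' x).
    by apply: SmoothAdd; apply: SmoothMul.
  by move=> x Ax; exact: is_derive_mul (df x Ax) (dg x Ax).
- move=> f f0 hf [f' sf' df].
  exists (fun x => (-1 * f' x) * ((f x)^-1 * (f x)^-1)).
    apply: SmoothMul; last by apply: SmoothMul; exact: SmoothInv.
    by apply: SmoothMul => //; apply: SmoothBase; exact: smooth_on_cst.
  by move=> x Ax; rewrite mulN1r; exact: is_derive_inv (f0 x Ax) (df x Ax).
- move=> B f r hf hr [r' sr' dr] AB.
  exists (fun x => derive1 f (r x) * r' x).
    apply: SmoothMul => //; apply: SmoothComp hr AB.
    exact: smooth_on_derive1.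
  move=> x Ax; apply: is_derive_comp; first exact: dr.
  exact: smooth_is_derive (AB x Ax).
Qed.

Lemma near_derive1 f g A x : open A -> A x -> (forall y, A y -> f y = g y) ->
  derive1 f x = derive1 g x.
Proof.
move=> oA Ax fg; rewrite !derive1E; apply: near_eq_derive.
by apply: filterS (open_nbhs_nbhs (conj oA Ax)).
Qed.

Lemma near_derive1n n f g A x : open A -> A x -> (forall y, A y -> f y = g y) ->
  derive1n n f x = derive1n n g x.
Proof.
move=> oA; elim: n x f g => [|n IH] x f g Ax fg; first exact: fg.
by rewrite !derive1Sn; apply: IH => // y Ay; exact: near_derive1 fg.
Qed.

(** By induction each iterated derivative agrees on [A] with a generated function; openness of [A]
    allows differentiating this agreement. *)
Lemma smooth_genP A f : open A -> smooth_gen A f -> smooth_on A f.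
Proof.
move=> oA sf n x Ax.
suff [g sg fg] : exists2 g, smooth_gen A g & forall y, A y -> derive1n n f y = g y.
  have [g' _ dg] := smooth_gen_derive sg.
  have [+ _] := dg x Ax; apply: near_eq_derivable.
  by apply: filterS (open_nbhs_nbhs (conj oA Ax)) => y /fg.
elim: n => [|n [g sg IH]]; first by exists f.
have [g' sg' dg] := smooth_gen_derive sg; exists g' => // y Ay.
by rewrite derive1nS (near_derive1 oA Ay IH); exact: is_derive_derive1 (dg y Ay).
Qed.

Lemma smooth_onM A f g : open A -> smooth_on A f -> smooth_on A g ->
  smooth_on A (fun x => f x * g x).
Proof. by move=> oA hf hg; apply: smooth_genP => //; apply: SmoothMul; apply: SmoothBase. Qed.

Lemma smooth_on_comp A B f r : open A -> smooth_on B f -> smooth_on A r ->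
  (forall x, A x -> B (r x)) -> smooth_on A (fun x => f (r x)).
Proof.
move=> oA hf hr AB; apply: smooth_genP => //; apply: SmoothComp hf _ AB.
exact: SmoothBase.
Qed.

Lemma derive1nD A f g n x : open A -> A x -> smooth_on A f -> smooth_on A g ->
  derive1n n (fun x => f x + g x) x = derive1n n f x + derive1n n g x.
Proof.
move=> oA; elim: n x f g => [//|n IH] x f g Ax hf hg; rewrite !derive1Sn.
rewrite -(IH _ _ _ Ax (smooth_on_derive1 hf) (smooth_on_derive1 hg)).
apply: near_derive1n oA Ax _ => y Ay; apply: is_derive_derive1.
exact: is_deriveD (smooth_is_derive hf Ay) (smooth_is_derive hg Ay).
Qed.

End SmoothFunctions.

(** * Taylor polynomials of products and composites *)

Section TaylorJets.

Local Open Scope classical_set_scope.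

Variable K : numClosedFieldType.
Local Notation P := (mpoly 4 K).
Implicit Types (f g r : K -> K) (A B : set K) (x d : K).

Definition tjet N f x : P := taylor N (fun k => derive1n k f x).

Lemma mderiv_taylor N (f : nat -> K) :
  mderiv ord0 (taylor N.+1 f) = taylor N (fun k => f k.+1).
Proof.
rewrite /taylor big_ord_recl mderivD raddf_sum /=.
rewrite expr0 mderivZ -mpolyC1 mderivC scaler0 add0r; apply: eq_bigr => k _.
rewrite mderivZ /= /bump leq0n add1n.
have -> : mderiv ord0 (var K ord0 ^+ k.+1) = (k.+1)%:R *: var K ord0 ^+ k.
  elim: (nat_of_ord k) => [|m IH].
    rewrite expr1 expr0 scale1r -[mderiv _ _]/(vf ord0 _) vf_vfield vfield_var.
    by rewrite /vfc !eqxx.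
  rewrite exprS mderivM IH.
  have -> : mderiv ord0 (var K ord0) = 1.
    rewrite -[mderiv _ _]/(vf ord0 _) vf_vfield vfield_var.
    by rewrite /vfc !eqxx.
  by rewrite mul1r -scalerAr -exprS -(@natr1 _ m.+1) scalerDl scale1r addrC.
rewrite scalerA; congr (_ *: _).
rewrite factS natrM.
have h1 : (k.+1)%:R != 0 :> K by rewrite pnatr_eq0.
have h2 : (k`!)%:R != 0 :> K by rewrite pnatr_eq0 -lt0n fact_gt0.
by rewrite -addn1 natrD; rewrite -addn1 natrD in h1; field; rewrite h2.
Qed.

Lemma mderiv_taylor_space N (f : nat -> K) (a : 'I_4) : a != ord0 ->
  mderiv a (taylor N f) = 0.
Proof.
move=> a0; rewrite /taylor raddf_sum big1 // => k _ /=; rewrite mderivZ.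
have v0 : mderiv a (var K ord0) = 0.
  by rewrite /var mderivX mnm1E eq_sym (negbTE a0) scale0r.
suff -> : mderiv a (var K ord0 ^+ k) = 0 by rewrite scaler0.
elim: (nat_of_ord k) => [|m IH]; first by rewrite expr0 -mpolyC1 mderivC.
by rewrite exprS mderivM v0 mul0r add0r IH mulr0.
Qed.

Lemma mderiv_tjet N f x : mderiv ord0 (tjet N.+1 f x) = tjet N (derive1 f) x.
Proof.
rewrite /tjet mderiv_taylor; congr (taylor _ _).
by apply/funext => k; rewrite derive1Sn.
Qed.

Lemma eqo_tjet_ind n (p q : P) : at0 p = at0 q ->
  (forall a : 'I_4, a != ord0 -> mderiv a p = 0) ->
  (forall a : 'I_4, a != ord0 -> mderiv a q = 0) ->
  eqo n (mderiv ord0 p) (mderiv ord0 q) -> eqo n.+1 p q.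
Proof.
move=> h0 hp hq h; apply: ordge_Sn => [|a]; first by rewrite at0B h0 subrr.
rewrite mderivB; have [->|a0] := eqVneq a ord0; first exact: h.
by rewrite hp // hq // subrr; exact: ordge_0.
Qed.

Lemma tjet_near N f g A x : open A -> A x -> (forall y, A y -> f y = g y) ->
  tjet N f x = tjet N g x.
Proof.
move=> oA Ax fg; rewrite /tjet; congr (taylor _ _); apply/funext => k.
exact: near_derive1n oA Ax fg.
Qed.

Lemma tjetD N f g A x : open A -> A x -> smooth_on A f -> smooth_on A g ->
  tjet N (fun t => f t + g t) x = tjet N f x + tjet N g x.
Proof.
move=> oA Ax hf hg; rewrite /tjet /taylor -big_split; apply: eq_bigr => k _ /=.
by rewrite (derive1nD _ oA Ax hf hg) mulrDl scalerDl.
Qed.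

(** Induction on [N] through the time derivative: the product rule for functions matches that of
    polynomials, and no binomial coefficients appear. *)
Lemma tjetM N f g A x : open A -> A x -> smooth_on A f -> smooth_on A g ->
  eqo N.+1 (tjet N (fun t => f t * g t) x) (tjet N f x * tjet N g x).
Proof.
move=> oA Ax; elim: N f g => [|N IH] f g hf hg.
  by apply/ordge1E; rewrite at0B at0M !at0_taylor subrr.
have sp (a : 'I_4) h y : a != ord0 -> mderiv a (tjet N.+1 h y) = 0.
  exact: mderiv_taylor_space.
apply: eqo_tjet_ind => [|a a0|a a0|].
- by rewrite at0M !at0_taylor.
- exact: sp.
- by rewrite mderivM !sp // mul0r mulr0 addr0.
rewrite mderivM !mderiv_tjet.
have -> : tjet N (derive1 (fun t => f t * g t)) x =
    tjet N (fun t => derive1 f t * g t + f t * derive1 g t) x.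
  apply: tjet_near oA Ax _ => y Ay; apply: is_derive_derive1.
  exact: is_derive_mul (smooth_is_derive hf Ay) (smooth_is_derive hg Ay).
have hf' := smooth_on_derive1 hf; have hg' := smooth_on_derive1 hg.
rewrite (tjetD _ oA Ax); try exact: smooth_onM.
have tw h : eqo N.+1 (tjet N h x) (tjet N.+1 h x) by exact: taylorW.
apply: eqoD.
  apply: eqo_trans (IH _ _ hf' hg) _.
  by apply: eqoM; [exact: eqo_refl | exact: tw].
apply: eqo_trans (IH _ _ hf hg') _.
by apply: eqoM; [exact: tw | exact: eqo_refl].
Qed.

Section Composition.

Variables (i j : 'I_4).
Hypotheses (i0 : i != ord0) (j0 : j != ord0) (ij : i != j).

(** The time elapsed since [r x], as a series in the time elapsed since [x]; it has no constant
    term, as a substitution requires. *)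
Definition time_shift N r x : P := tjet N r x - mpolyC 4 (r x).

Lemma at0_time_shift N r x : at0 (time_shift N r x) = 0.
Proof. by rewrite /time_shift at0B at0C at0_taylor subrr. Qed.

Lemma mderiv_time_shift N r x (a : 'I_4) : a != ord0 ->
  mderiv a (time_shift N r x) = 0.
Proof. by move=> a0; rewrite /time_shift mderivB mderivC mderiv_taylor_space // subrr. Qed.

Lemma mderiv0_time_shift N r x :
  mderiv ord0 (time_shift N.+1 r x) = tjet N (derive1 r) x.
Proof. by rewrite /time_shift mderivB mderivC subr0 mderiv_tjet. Qed.

Lemma mderiv_time_subst_taylor N (phi : P) (h : nat -> K) (a : 'I_4) :
  a != ord0 -> mderiv a phi = 0 -> mderiv a (time_subst i j phi (taylor N h)) = 0.
Proof.
move=> a0 hphi.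
have -> : time_subst i j phi (taylor N h) = \sum_(k < N.+1) (h k / (k`!)%:R) *: phi ^+ k.
  rewrite /time_subst /taylor raddf_sum; apply: eq_bigr => k _ /=.
  rewrite comp_mpolyZ; congr (_ *: _); rewrite rmorphXn /=; congr (_ ^+ _).
  by rewrite -[LHS]/(time_subst i j phi (var K ord0)) time_subst_var.
rewrite raddf_sum big1 // => k _ /=; rewrite mderivZ.
suff -> : mderiv a (phi ^+ k) = 0 by rewrite scaler0.
elim: (nat_of_ord k) => [|m IH]; first by rewrite expr0 -mpolyC1 mderivC.
by rewrite exprS mderivM IH hphi mul0r mulr0 addr0.
Qed.

(** Induction on [N] by the chain rule on both sides. The order [M] of the substituted series is
    kept apart from [N] because it must stay fixed while [N] decreases. *)
Lemma time_subst_tjet M N f r A B x : open A -> A x -> smooth_on B f ->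
  smooth_on A r -> (forall y, A y -> B (r y)) -> (N <= M)%N ->
  eqo N.+1 (time_subst i j (time_shift M.+1 r x) (tjet N f (r x)))
    (tjet N (fun t => f (r t)) x).
Proof.
move=> oA Ax + hr AB; set phi := time_shift _ _ _.
have phi0 : at0 phi = 0 by exact: at0_time_shift.
have at0_subst p : at0 (time_subst i j phi p) = at0 p.
  have h : ordge 1 (p - mpolyC 4 (at0 p)) by apply/ordge1E; rewrite at0B at0C subrr.
  have := time_subst_ordge i j phi0 h.
  rewrite /time_subst comp_mpolyB comp_mpolyC => /ordge1E.
  by rewrite at0B at0C => /eqP; rewrite subr_eq0 => /eqP.
elim: N f => [|N IH] f hf NM.
  by apply/ordge1E; rewrite at0B at0_subst !at0_taylor subrr.
apply: eqo_tjet_ind => [|a a0|a a0|].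
- by rewrite at0_subst !at0_taylor.
- by apply: mderiv_time_subst_taylor => //; exact: mderiv_time_shift.
- exact: mderiv_taylor_space.
(* The formal chain rule is [vf_time_subst] in the time direction, where the spatial exchange is not
   seen. *)
have -> : mderiv ord0 (time_subst i j phi (tjet N.+1 f (r x))) =
    tjet M (derive1 r) x * time_subst i j phi (tjet N (derive1 f) (r x)).
  have sp a : a != ord0 -> mderiv a phi = 0 by exact: mderiv_time_shift.
  have := vf_time_subst i0 j0 ij sp ord0 (tjet N.+1 f (r x)).
  rewrite /swap_sign eqxx scale1r swap0 // /psi' eqxx => h.
  have e1 : mderiv ord0 phi = tjet M (derive1 r) x by exact: mderiv0_time_shift.
  have e2 : vf ord0 (tjet N.+1 f (r x)) = tjet N (derive1 f) (r x) by exact: mderiv_tjet.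
  by rewrite e1 e2 in h; exact: h.
rewrite mderiv_tjet.
have hf' := smooth_on_derive1 hf; have hr' := smooth_on_derive1 hr.
have -> : tjet N (derive1 (fun t => f (r t))) x =
    tjet N (fun t => derive1 r t * derive1 f (r t)) x.
  apply: tjet_near oA Ax _ => y Ay; apply: is_derive_derive1; rewrite mulrC.
  exact: is_derive_comp (smooth_is_derive hr Ay) (smooth_is_derive hf (AB _ Ay)).
have hc : smooth_on A (fun t => derive1 f (r t)) by exact: smooth_on_comp hr AB.
have h := eqo_sym (@tjetM N _ _ _ _ oA Ax hr' hc).
refine (eqo_trans _ h).
apply: eqoM; first by apply: eqo_sym; apply: taylorW; apply: ltnW.
by apply: IH => //; exact: ltnW.
Qed.

End Composition.

End TaylorJets.

(** * Heat coefficients under a change of the time variable *)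

Section HeatCoefFunctions.

Local Open Scope classical_set_scope.

Variable K : numClosedFieldType.
Implicit Types (f g r : K -> K) (A B : set K) (x d : K).

Lemma tjet_cst N d x : tjet N (fun=> d) x = mpolyC 4 d.
Proof.
rewrite /tjet /taylor big_ord_recl big1 => [|k _].
  by rewrite addr0 fact0 divr1 expr0 -mul_mpolyC mulr1.
suff -> : derive1n (lift ord0 k) (fun=> d) x = 0 by rewrite mul0r scale0r.
have h0 c : derive1 (fun=> c) = (fun=> 0) :> (K -> K).
  by apply/funext => t; rewrite derive1_cst.
rewrite (_ : lift ord0 k = k.+1 :> nat) // derive1Sn h0; elim: (nat_of_ord k) => [//|m IH].
by rewrite derive1Sn h0.
Qed.

Lemma heat_coef_reparam (i j : 'I_4) n (w v : 'I_4 -> K -> K) f g r A B x d a :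
  i != ord0 -> j != ord0 -> i != j -> d != 0 -> derive1 r x != 0 ->
  open A -> A x -> (forall t, A t -> B (r t)) -> smooth_on A r ->
  (forall b, b != ord0 -> smooth_on B (w b)) -> smooth_on B f -> smooth_on A g ->
  (forall b t, b != ord0 -> A t -> w b (r t) * derive1 r t = v (swap i j b) t) ->
  (forall t, A t -> f (r t) = d * (derive1 r t * g t)) ->
  let jets h y := fun k => derive1n k h y in
  is_heat_coef n (jets (w (inord 1)) (r x)) (jets (w (inord 2)) (r x))
    (jets (w (inord 3)) (r x)) (jets f (r x)) a ->
  is_heat_coef n (jets (v (inord 1)) x) (jets (v (inord 2)) x) (jets (v (inord 3)) x)
    (jets g x) (derive1 r x * (d ^+ n / d ^+ 2) * a).
Proof.
move=> i0 j0 ij d0 rx oA Ax AB hr hw hf hg wv fg jets H N.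
(* One order above the [N.+2] in use, because [chi] is the derivative of [phi]. *)
pose phi := time_shift N.+3 r x.
have phi0 : at0 phi = 0 by exact: at0_time_shift.
have sp (b : 'I_4) : b != ord0 -> mderiv b phi = 0 by exact: mderiv_time_shift.
have chiE : mderiv ord0 phi = tjet N.+2 (derive1 r) x by exact: mderiv0_time_shift.
have hr' := smooth_on_derive1 hr.
have main h : smooth_on B h -> eqo N.+3 (time_subst i j phi (tjet N.+2 h (r x)))
    (tjet N.+2 (fun t => h (r t)) x).
  by move=> hh; apply: time_subst_tjet hh hr AB _.
pose W b := jets (w b) (r x); pose V b := jets (v b) x.
apply: (@heat_coef_time_subst _ i j i0 j0 ij phi phi0 sp n N W V (jets f (r x))
  (jets g x) d _ d0 rx _ _ _ a H).
- by rewrite chiE at0_taylor.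
- move=> b b0; rewrite chiE.
  apply: eqo_trans (eqoM (main _ (hw b b0)) (@eqo_refl _ _ _)) _.
  have hc : smooth_on A (fun t => w b (r t)) by exact: smooth_on_comp (hw b b0) hr AB.
  apply: eqo_trans (eqo_sym (@tjetM _ N.+2 _ _ _ _ oA Ax hc hr')) _.
  apply: eqo_eq; apply: tjet_near oA Ax _ => t At; exact: wv.
rewrite chiE; apply: eqo_trans (main _ hf) _.
have hrg : smooth_on A (fun t => derive1 r t * g t) by exact: smooth_onM.
have -> : tjet N.+2 (fun t => f (r t)) x =
    tjet N.+2 (fun t => d * (derive1 r t * g t)) x.
  by apply: tjet_near oA Ax _ => t At; exact: fg.
have hd : smooth_on A (fun=> d) by exact: smooth_on_cst.
apply: eqo_trans (@tjetM _ N.+2 _ _ _ _ oA Ax hd hrg) _.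
rewrite tjet_cst mul_mpolyC; apply: eqoZ.
exact: (@tjetM _ N.+2 _ _ _ _ oA Ax hr' hg).
Qed.

End HeatCoefFunctions.

(** * Two-sided series with geometric decay *)

Section ComplexNorm.

Local Open Scope classical_set_scope.

Variable R : realType.
Local Notation C := (CC R).
Implicit Types (z w : C) (u v : nat -> C).

(** The norm with values in [R]: the generic norm of [C] lies in [C], where the order is only
    partial and real estimates do not apply. *)
Definition nrm (z : C) : R := Normc.normc z.

Lemma nrmE z : `|z| = (nrm z)%:C%C.
Proof. by []. Qed.

Lemma nrm0 : nrm 0 = 0.
Proof. exact: Normc.normc0. Qed.

Lemma nrm1 : nrm 1 = 1.
Proof. exact: Normc.normc1. Qed.

Lemma nrmM z w : nrm (z * w) = nrm z * nrm w.
Proof. exact: Normc.normcM. Qed.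

Lemma nrmV z : nrm z^-1 = (nrm z)^-1.
Proof. exact: Normc.normcV. Qed.

Lemma nrmN z : nrm (- z) = nrm z.
Proof. exact: normcN. Qed.

Lemma nrmD z w : nrm (z + w) <= nrm z + nrm w.
Proof. exact: le_normcD. Qed.

Lemma nrmB z w : nrm (z - w) <= nrm z + nrm w.
Proof. by rewrite -(nrmN w); exact: nrmD. Qed.

Lemma nrm_distC z w : nrm (z - w) = nrm (w - z).
Proof. by rewrite -nrmN opprB. Qed.

Lemma nrm_ge0 z : 0 <= nrm z.
Proof. by rewrite /nrm; case: z => a b; rewrite /Normc.normc sqrtr_ge0. Qed.

Lemma nrm_eq0 z : nrm z = 0 -> z = 0.
Proof. exact: Normc.eq0_normc. Qed.

Lemma nrm_real (x : R) : nrm x%:C%C = `|x|.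
Proof. by rewrite /nrm /= expr0n addr0 sqrtr_sqr. Qed.

Lemma nrm_i : nrm 'i = 1.
Proof. by rewrite /nrm /= expr0n expr1n add0r sqrtr1. Qed.

Lemma nrm_nat n : nrm n%:R = n%:R.
Proof.
by rewrite -(rmorph_nat (real_complex R)) nrm_real ger0_norm.
Qed.

Lemma nrmX z n : nrm (z ^+ n) = nrm z ^+ n.
Proof. by elim: n => [|n IH]; rewrite ?expr0 ?nrm1 // !exprS nrmM IH. Qed.

Lemma nrm_sum (I : Type) (r : seq I) (P : pred I) (f : I -> C) :
  nrm (\sum_(i <- r | P i) f i) <= \sum_(i <- r | P i) nrm (f i).
Proof.
elim/big_ind2: _ => [|x y a b h1 h2|//]; first by rewrite nrm0.
by apply: le_trans (nrmD _ _) _; exact: lerD.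
Qed.

Lemma nrm_Re z : `|complex.Re z| <= nrm z.
Proof.
case: z => a b; rewrite /nrm /= -sqrtr_sqr ler_wsqrtr //.
by rewrite lerDl sqr_ge0.
Qed.

Lemma nrm_Im z : `|complex.Im z| <= nrm z.
Proof.
case: z => a b; rewrite /nrm /= -sqrtr_sqr ler_wsqrtr //.
by rewrite lerDr sqr_ge0.
Qed.

Lemma complexRI z : z = (complex.Re z)%:C%C + 'i * (complex.Im z)%:C%C.
Proof. exact: complexE. Qed.

Lemma nrm_le_ReIm z : nrm z <= `|complex.Re z| + `|complex.Im z|.
Proof.
by rewrite {1}[z]complexRI; apply: le_trans (nrmD _ _) _; rewrite nrmM nrm_i mul1r !nrm_real.
Qed.

Lemma cvg_nrm u z : (fun n => nrm (u n - z)) @ \oo --> (0 : R) -> u @ \oo --> z.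
Proof.
move=> h; apply/cvgrPdist_lt => e e0.
have [e' [e'0 ->]] : exists e' : R, 0 < e' /\ e = e'%:C%C.
  case: e e0 => a b; rewrite ltcE /= => /andP [/eqP -> a0].
  by exists a.
have /cvgrPdist_lt /(_ e' e'0) := h.
apply: filterS => n; rewrite sub0r normrN ger0_norm ?nrm_ge0 // => hn.
by rewrite nrmE nrm_distC ltcR.
Qed.

Lemma limn_nrm u z : (fun n => nrm (u n - z)) @ \oo --> (0 : R) -> limn u = z.
Proof. by move=> /cvg_nrm; exact: cvg_lim. Qed.

End ComplexNorm.

(** * Two-sided sums with explicit rates of convergence *)

Section GeometricSeries.

Local Open Scope classical_set_scope.

Variable R : realType.
Local Notation C := (CC R).
Implicit Types (z w : C) (u v : nat -> C) (f g : int -> C) (q B : R).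

Lemma geom_sum_le q n : 0 <= q < 1 -> \sum_(k < n) q ^+ k <= (1 - q)^-1.
Proof.
move=> /andP [q0 q1]; have q1' : 0 < 1 - q by rewrite subr_gt0.
have E : (1 - q) * \sum_(k < n) q ^+ k = 1 - q ^+ n.
  by rewrite -[1 - q]opprB mulNr -subrX1 opprB.
rewrite -[leRHS]mul1r ler_pdivlMr // mulrC E lerBlDr lerDl.
exact: exprn_ge0.
Qed.

Definition geod q B u : Prop := forall n, nrm (u n) <= B * q ^+ n.

Lemma geod_tail q B u m n : 0 <= q < 1 -> 0 <= B -> geod q B u -> (m <= n)%N ->
  nrm (series u n - series u m) <= B / (1 - q) * q ^+ m.
Proof.
move=> qq B0 hu mn; have /andP [q0 q1] := qq.
rewrite sub_series mn; apply: le_trans (nrm_sum _ _ _) _.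
apply: (@le_trans _ _ (\sum_(m <= k < n) B * q ^+ k)).
  by apply: ler_sum => k _; exact: hu.
rewrite -{1}(add0n m) big_addn big_mkord.
under eq_bigr do rewrite addnC exprD mulrA.
rewrite -mulr_sumr mulrAC ler_wpM2r ?exprn_ge0 //.
by rewrite ler_wpM2l //; exact: geom_sum_le.
Qed.

Lemma cvg_real_geod q B (v : nat -> R) : 0 <= q < 1 -> (forall n, `|v n| <= B * q ^+ n) ->
  cvgn (series v).
Proof.
move=> /andP [q0 q1] hv; apply: normed_cvg; apply: (@series_le_cvg _ _ (geometric B q)).
- by move=> n; exact: normr_ge0.
- by move=> n; exact: le_trans (normr_ge0 _) (hv n).
- exact: hv.
by apply: is_cvg_geometric_series; rewrite ger0_norm.
Qed.

Definition csum u : C := limn (series u).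

Lemma Re_series u n : complex.Re (series u n) = series (fun k => complex.Re (u k)) n.
Proof.
rewrite /series /=; apply: (big_morph (@complex.Re R)) => //.
by case=> ? ? [].
Qed.

Lemma Im_series u n : complex.Im (series u n) = series (fun k => complex.Im (u k)) n.
Proof.
rewrite /series /=; apply: (big_morph (@complex.Im R)) => //.
by case=> ? ? [].
Qed.

(** Convergence is reduced to the real series of real and imaginary parts, where comparison with a
    geometric series is available. *)
Lemma csum_cvg q B u : 0 <= q < 1 -> geod q B u ->
  (fun n => nrm (series u n - csum u)) @ \oo --> (0 : R).
Proof.
move=> qq hu.
have hRe : cvgn (series (fun k => complex.Re (u k))).
  by apply: (cvg_real_geod qq) => n; exact: le_trans (nrm_Re _) (hu n).
have hIm : cvgn (series (fun k => complex.Im (u k))).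
  by apply: (cvg_real_geod qq) => n; exact: le_trans (nrm_Im _) (hu n).
have dist0 (v : nat -> R) : cvgn v -> (fun n => `|v n - limn v|) @ \oo --> (0 : R).
  move=> h; rewrite -(@normr0 R R); apply: cvg_norm; rewrite -(subrr (limn v)).
  by apply: cvgB h _; exact: cvg_cst.
pose s : C := Complex (limn (series (fun k => complex.Re (u k))))
  (limn (series (fun k => complex.Im (u k)))).
suff h : (fun n => nrm (series u n - s)) @ \oo --> (0 : R).
  by rewrite /csum (limn_nrm h).
apply: (@squeeze_cvgr _ _ _ _ (fun=> 0) (fun n =>
   `|series (fun k => complex.Re (u k)) n - complex.Re s|
   + `|series (fun k => complex.Im (u k)) n - complex.Im s|)).
- near=> n; rewrite nrm_ge0 /=; apply: le_trans (nrm_le_ReIm _) _.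
  by rewrite -Re_series -Im_series; case: (series u n).
- exact: cvg_cst.
rewrite -[0 : R]addr0; apply: cvgD.
  exact: dist0.
exact: dist0.
Unshelve. all: by end_near. Qed.

Lemma csum_approx q B u m : 0 <= q < 1 -> 0 <= B -> geod q B u ->
  nrm (series u m - csum u) <= B / (1 - q) * q ^+ m.
Proof.
move=> qq B0 hu; apply/ler_addgt0Pr => e e0.
have /cvgrPdist_lt /(_ e e0) := csum_cvg qq hu.
case=> n0 _ hn; have := hn (maxn m n0) (leq_maxr _ _).
rewrite /= sub0r normrN ger0_norm ?nrm_ge0 // => /ltW h.
have h2 := geod_tail qq B0 hu (leq_maxl m n0).
set X := series u (maxn m n0) in h h2.
have -> : series u m - csum u = - (X - series u m) + (X - csum u) by ring.
by apply: le_trans (nrmD _ _) _; rewrite nrmN; exact: lerD.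
Qed.

Definition zgeo q B f : Prop := forall m : int, nrm (f m) <= B * q ^+ `|m|%N.

(** The window is [- n <= m < n], as [Negz k] is [- (k + 1)]. It has [2 n] points, a full period of
    the discrete Fourier transform with [2 n] samples. *)
Definition psum f (n : nat) : C :=
  \sum_(k < n) f (Posz k) + \sum_(k < n) f (Negz k).

Lemma bisum_approx q B f n : 0 <= q < 1 -> 0 <= B -> zgeo q B f ->
  nrm (psum f n - bisum f) <= 2 * (B / (1 - q)) * q ^+ n.
Proof.
move=> qq B0 hf; have /andP [q0 q1] := qq.
have h1 : geod q B (fun k => f (Posz k)) by move=> k; exact: hf.
have h2 : geod q B (fun k => f (Negz k)).
  move=> k; apply: le_trans (hf _) _; rewrite ler_wpM2l //.
  by rewrite /= exprS ler_piMl ?exprn_ge0 // ltW.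
have e1 := csum_approx n qq B0 h1; have e2 := csum_approx n qq B0 h2.
rewrite /series /= !big_mkord in e1 e2.
rewrite /psum /bisum opprD addrACA; apply: le_trans (nrmD _ _) _.
by rewrite -mulrA mulr2n mulrDl mul1r; apply: lerD.
Qed.

Lemma geom_le0 q (B x : R) : 0 <= q < 1 -> (forall n, x <= B * q ^+ n) -> x <= 0.
Proof.
move=> /andP [q0 q1] h; have qn : `|q| < 1 by rewrite ger0_norm.
have hc : (fun n => B * q ^+ n) @ \oo --> (0 : R).
  rewrite -(mulr0 B); apply: cvgM; first exact: cvg_cst.
  exact: cvg_expr.
have <- : limn (fun n => B * q ^+ n) = 0 by exact: cvg_lim hc.
by apply: limr_ge; [apply: cvgP hc | exact: nearW].
Qed.

(** The rules for sums, shifts and multiples all pass through this criterion, which replaces limits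
    by estimates of partial sums. *)
Lemma bisum_unique q B1 B f s : 0 <= q < 1 -> 0 <= B -> zgeo q B f ->
  (forall n, nrm (psum f n - s) <= B1 * q ^+ n) -> bisum f = s.
Proof.
move=> qq B0 hf hs; apply/eqP; rewrite -subr_eq0; apply/eqP/nrm_eq0/le_anti.
rewrite nrm_ge0 andbT.
apply: (@geom_le0 q (2 * (B / (1 - q)) + B1)) => // n.
have -> : bisum f - s = - (psum f n - bisum f) + (psum f n - s) by ring.
apply: le_trans (nrmD _ _) _; rewrite nrmN mulrDl; apply: lerD => //.
exact: bisum_approx.
Qed.

Lemma bisum_bound q B f : 0 <= q < 1 -> 0 <= B -> zgeo q B f ->
  nrm (bisum f) <= 2 * (B / (1 - q)).
Proof.
move=> qq B0 hf; have := bisum_approx 0 qq B0 hf.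
by rewrite /psum !big_ord0 addr0 sub0r nrmN expr0 mulr1.
Qed.

Lemma psumD f g n : psum (fun m => f m + g m) n = psum f n + psum g n.
Proof. by rewrite /psum !big_split /= addrACA. Qed.

Lemma psumZ z f n : psum (fun m => z * f m) n = z * psum f n.
Proof. by rewrite /psum -!mulr_sumr mulrDr. Qed.

Lemma zgeoD q B B' f g : zgeo q B f -> zgeo q B' g ->
  zgeo q (B + B') (fun m => f m + g m).
Proof.
by move=> hf hg m; apply: le_trans (nrmD _ _) _; rewrite mulrDl; exact: lerD.
Qed.

Lemma zgeoZ q B z f : zgeo q B f -> zgeo q (nrm z * B) (fun m => z * f m).
Proof. by move=> hf m; rewrite nrmM -mulrA ler_wpM2l ?nrm_ge0. Qed.

Lemma bisumD q B B' f g : 0 <= q < 1 -> 0 <= B -> 0 <= B' ->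
  zgeo q B f -> zgeo q B' g ->
  bisum (fun m => f m + g m) = bisum f + bisum g.
Proof.
move=> qq B0 B0' hf hg.
apply: (@bisum_unique q (2 * (B / (1 - q)) + 2 * (B' / (1 - q))) (B + B')) => //.
- exact: addr_ge0.
- exact: zgeoD.
move=> n; rewrite psumD opprD addrACA; apply: le_trans (nrmD _ _) _.
by rewrite [leRHS]mulrDl; apply: lerD; exact: bisum_approx.
Qed.

Lemma bisumZ q B z f : 0 <= q < 1 -> 0 <= B -> zgeo q B f ->
  bisum (fun m => z * f m) = z * bisum f.
Proof.
move=> qq B0 hf.
apply: (@bisum_unique q (nrm z * (2 * (B / (1 - q)))) (nrm z * B)) => //.
- by rewrite mulr_ge0 // nrm_ge0.
- exact: zgeoZ.
move=> n; rewrite psumZ -mulrBr nrmM -mulrA ler_wpM2l ?nrm_ge0 //.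
exact: bisum_approx.
Qed.

Lemma bisumB q B B' f g : 0 <= q < 1 -> 0 <= B -> 0 <= B' ->
  zgeo q B f -> zgeo q B' g ->
  bisum (fun m => f m - g m) = bisum f - bisum g.
Proof.
move=> qq B0 B0' hf hg.
have hg' : zgeo q B' (fun m => -1 * g m).
  by move=> m; rewrite mulN1r nrmN.
rewrite -[- bisum g]mulN1r -(bisumZ (-1) qq B0' hg) -(bisumD qq B0 B0' hf hg').
by congr bisum; apply/funext => m; rewrite mulN1r.
Qed.

Lemma eq_bisum f g : f =1 g -> bisum f = bisum g.
Proof. by move=> h; congr bisum; apply/funext. Qed.

Lemma bisum_sum q B (n : nat) (f : nat -> int -> C) : 0 <= q < 1 -> 0 <= B ->
  (forall k, (k < n)%N -> zgeo q B (f k)) ->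
  bisum (fun m => \sum_(k < n) f k m) = \sum_(k < n) bisum (f k).
Proof.
move=> qq B0; elim: n => [|n IH] hf.
  rewrite big_ord0 (_ : (fun m : int => _) = (fun m => 0 * 0 : C)); last first.
    by apply/funext => m; rewrite big_ord0 mulr0.
  rewrite (bisumZ 0 qq (lexx 0)) ?mul0r // => m.
  by rewrite nrm0 mul0r.
rewrite big_ord_recr /= -IH; last by move=> k kn; apply: hf; exact: ltnW.
have h1 : zgeo q (B *+ n) (fun m => \sum_(k < n) f k m).
  move=> m; apply: le_trans (nrm_sum _ _ _) _.
  apply: (@le_trans _ _ (\sum_(k < n) B * q ^+ `|m|%N)).
    by apply: ler_sum => k _; apply: hf; apply: leqW.
  by rewrite sumr_const card_ord mulrnAl.
rewrite -(bisumD qq _ B0 h1 (hf n (ltnSn n))) ?mulrn_wge0 //.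
by apply: eq_bisum => m; rewrite big_ord_recr.
Qed.

(** Shifting the window changes the partial sum only by the boundary terms at [n] and [- n], which
    decay like [q ^ n]. *)
Lemma bisum_shift q B f : 0 < q < 1 -> 0 <= B -> zgeo q B f ->
  bisum (fun m => f (m + 1)) = bisum f.
Proof.
move=> /andP [q0 q1] B0 hf.
have qq : 0 <= q < 1 by rewrite ltW.
have hf' : zgeo q (B / q) (fun m => f (m + 1)).
  move=> m; apply: le_trans (hf _) _; rewrite -mulrA ler_wpM2l //.
  rewrite mulrC ler_pdivlMr // -exprSr.
  rewrite ler_wiXn2l ?ltW //; lia.
apply: (@bisum_unique q (2 * B + 2 * (B / (1 - q))) (B / q)) => //.
  by rewrite divr_ge0 // ltW.
move=> n.
have -> : psum (fun m => f (m + 1)) n = psum f n + f (Posz n) - f (- Posz n).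
  rewrite /psum.
  have -> : \sum_(k < n) f (Posz k + 1) = \sum_(k < n) f (Posz k) + f (Posz n) - f 0.
    elim: n => [|n IH]; first by rewrite !big_ord0 add0r subrr.
    rewrite !big_ord_recr /= IH; have -> : Posz n + 1 = Posz n.+1 by lia.
    ring.
  have -> : \sum_(k < n) f (Negz k + 1) = \sum_(k < n) f (Negz k) + f 0 - f (- Posz n).
    elim: n => [|n IH]; first by rewrite !big_ord0 add0r oppr0 subrr.
    rewrite !big_ord_recr /= IH; have -> : Negz n + 1 = - Posz n by lia.
    have -> : Negz n = - Posz n.+1 by lia.
    ring.
  ring.
have -> : psum f n + f (Posz n) - f (- Posz n) - bisum f =
    f (Posz n) + - f (- Posz n) + (psum f n - bisum f) by ring.
apply: le_trans (nrmD _ _) _; rewrite [leRHS]mulrDl; apply: lerD; last exact: bisum_approx.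
apply: le_trans (nrmD _ _) _; rewrite nrmN mulr2n mulrDl [leRHS]mulrDl mul1r.
by apply: lerD; apply: le_trans (hf _) _; rewrite ?abszN.
Qed.

(** The window of size [n] for the multiples is exactly the window of size [N * n] for the masked
    function. *)
Lemma bisum_multiples q B f (N : nat) : (0 < N)%N -> 0 <= q < 1 -> 0 <= B -> zgeo q B f ->
  bisum (fun m => if (Posz N %| m)%Z then f m else 0) = bisum (fun m => f (Posz N * m)).
Proof.
move=> N0 qq B0 hf; have /andP [q0 q1] := qq.
pose g m := if (Posz N %| m)%Z then f m else 0.
have hg : zgeo q B g.
  move=> m; rewrite /g; case: ifP => _; first exact: hf.
  by rewrite nrm0 mulr_ge0 // exprn_ge0.
have hN : zgeo q B (fun m => f (Posz N * m)).
  move=> m; apply: le_trans (hf _) _; rewrite ler_wpM2l //.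
  by rewrite ler_wiXn2l ?(ltW q1) // abszM leq_pmull.
apply/esym; apply: (@bisum_unique q (2 * (B / (1 - q))) B) => // n.
have -> : psum (fun m => f (Posz N * m)) n = psum g (N * n).
  rewrite /psum; congr (_ + _).
    elim: n => [|n IH]; first by rewrite muln0 !big_ord0.
    rewrite big_ord_recr /= IH mulnSr big_split_ord /=; congr (_ + _).
    rewrite (bigD1 (Ordinal N0)) //= addn0 big1 => [|k k0].
      by rewrite /g PoszM dvdz_mulr // addr0.
    rewrite /g; case: ifP => // hd; have : (N %| N * n + k)%N by [].
    have k1 : (0 < k)%N.
      by rewrite lt0n; apply: contra k0 => /eqP k0; apply/eqP/val_inj.
    rewrite dvdn_addr ?dvdn_mulr // => /dvdn_leq => /(_ k1).
    by rewrite leqNgt ltn_ord.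
  elim: n => [|n IH]; first by rewrite muln0 !big_ord0.
  (* On the negative side the multiple of [N] comes last in each block, because of the shift in
     [Negz]. *)
  have N1 : (N.-1 < N)%N by rewrite prednK.
  rewrite big_ord_recr /= IH mulnSr big_split_ord /=; congr (_ + _).
  rewrite (bigD1 (Ordinal N1)) //= big1 => [|k k0].
    rewrite addr0 /g.
    have -> : Negz (N * n + N.-1) = Posz N * Negz n by rewrite !NegzE; nia.
    by rewrite dvdz_mulr.
  rewrite /g; case: ifP => // hd.
  have : (N %| (N * n + k).+1)%N by [].
  rewrite -addnS dvdn_addr ?dvdn_mulr // => /dvdn_leq; rewrite ltnS => /(_ isT) hk.
  move: k0; rewrite -val_eqE /= => /eqP; have := ltn_ord k; lia.
apply: le_trans (bisum_approx _ qq B0 hg) _.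
rewrite ler_wpM2l ?mulr_ge0 ?invr_ge0 ?subr_ge0 ?(ltW q1) //.
by rewrite ler_wiXn2l ?(ltW q1) // leq_pmull.
Qed.

End GeometricSeries.

(** * The complex exponential and its first Taylor remainder *)

Section ComplexExponential.

Local Open Scope classical_set_scope.

Variable R : realType.
Local Notation C := (CC R).
Implicit Types (z w : C) (a b x : R).

Lemma cexpD z w : cexp (z + w) = cexp z * cexp w.
Proof.
case: z => a b; case: w => c d; rewrite /cexp /= expRD cosD sinD.
rewrite !rmorphM rmorphB rmorphD !rmorphM /=.
have ii : 'i * 'i = -1 :> C by rewrite -expr2 sqrCi.
move: ii ((expR a)%:C%C : C) ((expR c)%:C%C : C) ((cos b)%:C%C : C) ((sin b)%:C%C : C).
move: ((cos d)%:C%C : C) ((sin d)%:C%C : C) => cd sd ii ea ec cb sb.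
transitivity (ea * ec * (cb * cd + ('i * 'i) * (sb * sd) + 'i * (sb * cd + cb * sd))).
  by rewrite ii mulN1r.
ring.
Qed.

Lemma cexp0 : cexp (0 : C) = 1.
Proof. by rewrite /cexp /= expR0 cos0 sin0 mulr0 addr0 mulr1. Qed.

Lemma nrm_cexp z : nrm (cexp z) = expR (complex.Re z).
Proof.
rewrite /cexp nrmM nrm_real ger0_norm ?expR_ge0 //.
suff -> : nrm ((cos (complex.Im z))%:C%C + 'i * (sin (complex.Im z))%:C%C : C) = 1.
  by rewrite mulr1.
rewrite -[_ + _](_ : Complex (cos (complex.Im z)) (sin (complex.Im z)) = _); last first.
  by rewrite [LHS]complexRI.
by rewrite /nrm /= cos2Dsin2 sqrtr1.
Qed.

Lemma cexp_neq0 z : cexp z != 0.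
Proof.
apply/eqP => h; have := nrm_cexp z; rewrite h nrm0 => /eqP.
by rewrite eq_sym gt_eqF ?expR_gt0.
Qed.

Lemma cexpN z : cexp (- z) = (cexp z)^-1.
Proof.
apply: (mulfI (cexp_neq0 z)); rewrite -cexpD subrr cexp0 mulfV //.
exact: cexp_neq0.
Qed.

Lemma cexp_nat n z : cexp (n%:R * z) = cexp z ^+ n.
Proof.
elim: n => [|n IH]; first by rewrite mul0r cexp0.
by rewrite exprS -IH -cexpD -natr1 mulrDl mul1r addrC.
Qed.

Lemma cexp_pii : cexp ('i * (pi : R)%:C%C : C) = -1.
Proof.
have -> : ('i * (pi : R)%:C%C : C) = Complex 0 pi.
  by rewrite [RHS]complexRI /= add0r.
by rewrite /cexp /= expR0 cospi sinpi mulr0 addr0 mul1r rmorphN1.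
Qed.

Lemma cexp_2pii : cexp (2 * ('i * (pi : R)%:C%C) : C) = 1.
Proof. by rewrite cexp_nat cexp_pii sqrrN expr1n. Qed.

Lemma cexp_2pii_int (k : int) : cexp (k%:~R * (2 * ('i * (pi : R)%:C%C)) : C) = 1.
Proof.
case: k => n; first by rewrite cexp_nat cexp_2pii expr1n.
by rewrite NegzE mulrNz mulNr cexpN cexp_nat cexp_2pii expr1n invr1.
Qed.

Lemma abs_sin_le x : `|sin x| <= `|x|.
Proof.
wlog x0 : x / 0 <= x => [H|].
  have [/H//|/ltW x0] := leP 0 x.
  by rewrite -normrN -sinN -[leRHS]normrN; apply: H; rewrite oppr_ge0.
have [y _] := @MVT_segment R (@sin R) (@cos R) 0 x x0
  (fun t _ => is_derive_sin t) (continuous_subspaceT (@continuous_sin R)).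
rewrite sin0 !subr0 => ->; rewrite normrM ler_piMl //.
by rewrite ler_norml cos_geN1 cos_le1.
Qed.

Lemma one_sub_cos x : 1 - cos x = 2 * sin (x / 2) ^+ 2.
Proof.
have -> : cos x = cos (x / 2 + x / 2) by rewrite -splitr.
have := cos2Dsin2 (x / 2); rewrite cosD => h.
transitivity (cos (x / 2) ^+ 2 + sin (x / 2) ^+ 2
  - (cos (x / 2) * cos (x / 2) - sin (x / 2) * sin (x / 2))); first by rewrite h.
ring.
Qed.

Lemma abs_cos_sub1_sq x : `|cos x - 1| <= x ^+ 2.
Proof.
rewrite distrC one_sub_cos normrM normrX [`|2|]ger0_norm //.
have h := abs_sin_le (x / 2).
have h2 : `|sin (x / 2)| ^+ 2 <= `|x / 2| ^+ 2 by rewrite lerXn2r ?nnegrE.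
rewrite real_normK ?num_real // in h2 *.
have h3 : `|x / 2| ^+ 2 = x ^+ 2 / 4.
  by rewrite real_normK ?num_real // exprMn; congr (_ * _); field.
have := sqr_ge0 x; rewrite h3 in h2; nra.
Qed.

Lemma abs_cos_sub1 x : `|cos x - 1| <= `|x|.
Proof.
rewrite distrC one_sub_cos normrM normrX [`|2|]ger0_norm //.
have h := abs_sin_le (x / 2).
have h1 : `|sin (x / 2)| <= 1 by rewrite ler_norml sin_geN1 sin_le1.
have h0 := normr_ge0 (sin (x / 2)).
have e : `|x| = 2 * `|x / 2|.
  by rewrite normrM [`|2^-1|]ger0_norm //; field.
rewrite e; nra.
Qed.

Lemma abs_sin_sub x : `|sin x - x| <= x ^+ 2.
Proof.
wlog x0 : x / 0 <= x => [H|].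
  have [/H//|/ltW x0] := leP 0 x.
  have := H (- x); rewrite oppr_ge0 => /(_ x0).
  by rewrite sinN -opprD normrN sqrrN.
have hd t : is_derive t (1 : R) (fun y : R => sin y - y) (cos t - 1).
  exact: is_deriveB (is_derive_sin t) (is_derive_id t 1).
have hc : {within `[0, x], continuous (fun y : R => sin y - y)}.
  apply: continuous_subspaceT => y; apply: differentiable_continuous.
  by apply/derivable1_diffP; exact: ex_derive.
have [y yx] := @MVT_segment R _ _ 0 x x0 (fun t _ => hd t) hc.
rewrite sin0 !subr0 => ->; rewrite normrM expr2 [`|x|]ger0_norm // ler_wpM2r //.
apply: le_trans (abs_cos_sub1 y) _.
by move: yx; rewrite in_itv /= => /andP [y0 yx]; rewrite ger0_norm.
Qed.

Lemma expR_mul_ge a : (1 - a) * expR a <= 1.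
Proof.
rewrite -[leRHS](mulVf (lt0r_neq0 (expR_gt0 a))) ler_wpM2r ?expR_ge0 //.
by rewrite -expRN; exact: expR_ge1Dx.
Qed.

Lemma expR_sub1_le a : `|expR a - 1| <= `|a| * expR `|a|.
Proof.
have h1 := expR_ge1Dx a; have h2 := expR_mul_ge a.
have [a0|a0] := leP 0 a.
  by rewrite !ger0_norm; lra.
have e1 : expR a <= 1 by rewrite -expR0 ler_expR ltW.
have h3 : 1 <= expR `|a| by rewrite -expR0 ler_expR.
rewrite ler0_norm; last by lra.
rewrite ltr0_norm // in h3 *; nra.
Qed.

Lemma expR_taylor1 a : `|expR a - 1 - a| <= a ^+ 2 * expR `|a|.
Proof.
have h1 := expR_ge1Dx a; have h2 := expR_mul_ge a.
have h3 : 1 <= expR `|a| by rewrite -expR0 ler_expR.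
rewrite ger0_norm; last by lra.
have [a0|a0] := leP 0 a.
  rewrite ger0_norm //; nra.
have e1 : expR a <= 1 by rewrite -expR0 ler_expR ltW.
have h4 : a * (expR a - 1) <= a ^+ 2 by nra.
have : a ^+ 2 <= a ^+ 2 * expR `|a| by rewrite ler_peMr ?sqr_ge0.
lra.
Qed.

(** With [r = nrm z], the real and imaginary parts split into two terms each, every one at most
    [r ^ 2 exp r]; hence the 4. *)
Lemma nrm_cexp_taylor1 z : nrm (cexp z - 1 - z) <= 4 * nrm z ^+ 2 * expR (nrm z).
Proof.
apply: le_trans (nrm_le_ReIm _) _.
have -> : complex.Re (cexp z - 1 - z) =
    expR (complex.Re z) - 1 - complex.Re z
    + expR (complex.Re z) * (cos (complex.Im z) - 1).
  have -> : cexp z = Complex (expR (complex.Re z) * cos (complex.Im z))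
      (expR (complex.Re z) * sin (complex.Im z)).
    rewrite [RHS]complexRI /= !rmorphM /= /cexp mulrDr; congr (_ + _).
    by rewrite mulrCA.
  by case: z => a b /=; ring.
have -> : complex.Im (cexp z - 1 - z) =
    expR (complex.Re z) * (sin (complex.Im z) - complex.Im z)
    + (expR (complex.Re z) - 1) * complex.Im z.
  have -> : cexp z = Complex (expR (complex.Re z) * cos (complex.Im z))
      (expR (complex.Re z) * sin (complex.Im z)).
    rewrite [RHS]complexRI /= !rmorphM /= /cexp mulrDr; congr (_ + _).
    by rewrite mulrCA.
  by case: z => a b /=; ring.
have ha := nrm_Re z; have hb := nrm_Im z.
move: (complex.Re z) (complex.Im z) (nrm z) (nrm_ge0 z) ha hb => a b r r0 ha hb.
have er : 0 < expR r by exact: expR_gt0.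
have ea : expR `|a| <= expR r by rewrite ler_expR.
have ea' : expR a <= expR r by rewrite ler_expR (le_trans (ler_norm a)).
have ea0 : 0 < expR a by exact: expR_gt0.
have aa : a ^+ 2 <= r ^+ 2 by rewrite -real_normK ?num_real // lerXn2r ?nnegrE.
have bb : b ^+ 2 <= r ^+ 2 by rewrite -real_normK ?num_real // lerXn2r ?nnegrE.
have t1 : `|expR a - 1 - a| <= r ^+ 2 * expR r.
  apply: le_trans (expR_taylor1 a) _.
  by apply: ler_pM => //; rewrite ?sqr_ge0 ?expR_ge0.
have t2 : `|expR a * (cos b - 1)| <= r ^+ 2 * expR r.
  rewrite normrM gtr0_norm // mulrC.
  apply: ler_pM => //.
  by apply: le_trans (abs_cos_sub1_sq b) _.
have t3 : `|expR a * (sin b - b)| <= r ^+ 2 * expR r.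
  rewrite normrM gtr0_norm // mulrC.
  apply: ler_pM => //.
  by apply: le_trans (abs_sin_sub b) _.
have t4 : `|(expR a - 1) * b| <= r ^+ 2 * expR r.
  rewrite normrM; apply: (@le_trans _ _ ((r * expR r) * r)).
    apply: ler_pM => //; apply: le_trans (expR_sub1_le a) _.
    by apply: ler_pM => //; rewrite expR_ge0.
  by rewrite expr2 -mulrA [expR r * r]mulrC mulrA.
have := ler_normD (expR a - 1 - a) (expR a * (cos b - 1)).
have := ler_normD (expR a * (sin b - b)) ((expR a - 1) * b).
move: t1 t2 t3 t4; set X := r ^+ 2 * expR r; rewrite -[4 * _ * _]mulrA -/X; lra.
Qed.

End ComplexExponential.

(** * Termwise differentiation of Dirichlet sums *)

Section DirichletSums.

Local Open Scope classical_set_scope.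

Variable R : realType.
Local Notation C := (CC R).
Implicit Types (z w h : C) (b lam : int -> C) (q B r x : R).

Lemma is_derive_quadratic (f : C -> C) z (l : C) (k r : R) : 0 < r ->
  (forall h, nrm h <= r -> nrm (f (h + z) - f z - h * l) <= k * nrm h ^+ 2) ->
  is_derive z (1 : C) f l.
Proof.
move=> r0 H.
have k0 : 0 <= k.
  have hr : nrm (r%:C%C : C) = r by rewrite nrm_real gtr0_norm.
  have := H r%:C%C; rewrite hr lexx => /(_ isT) h.
  have := le_trans (nrm_ge0 _) h.
  by rewrite pmulr_lge0 // exprn_gt0.
have hc : (fun h : C => h^-1 *: ((f \o shift z) (h *: (1 : C)) - f z)) @ (0 : C)^' --> l.
  apply/cvgrPdist_le => e e0.
  have [e' [e'0 ->]] : exists e' : R, 0 < e' /\ e = e'%:C%C.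
    case: e e0 => a c; rewrite ltcE /= => /andP [/eqP -> a0].
    by exists a.
  have d0 : 0 < Num.min r (e' / (k + 1)).
    by rewrite lt_min r0 divr_gt0 // ltr_wpDl.
  have d0' : (0 : C) < (Num.min r (e' / (k + 1)))%:C%C by rewrite ltcR.
  near=> h.
  have hn : h != 0 by near: h; exact: nbhs_dnbhs_neq.
  have hd : nrm h <= Num.min r (e' / (k + 1)).
    by rewrite -lecR -nrmE; apply: ltW; near: h; exact: dnbhs0_lt.
  move: hd; rewrite le_min => /andP [hr he].
  rewrite nrmE lecR.
  have -> : l - h^-1 *: ((f \o shift z) (h *: 1) - f z) =
      - (h^-1 * (f (h + z) - f z - h * l)).
    have e1 : h *: (1 : C) = h by exact: mulr1.
    rewrite /= e1 -[_ *: _]/(h^-1 * _) [in RHS]mulrBr mulrA mulVf // mul1r.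
    by rewrite opprB.
  rewrite nrmN nrmM nrmV.
  have h0 : 0 < nrm h.
    rewrite lt_def nrm_ge0 andbT; apply: contra_neq hn; exact: nrm_eq0.
  rewrite mulrC ler_pdivrMr //; apply: le_trans (H h hr) _.
  rewrite expr2 mulrA ler_wpM2r ?nrm_ge0 //.
  have k1 : 0 < k + 1 by rewrite ltr_wpDl.
  rewrite -(ler_pM2r k1) in he; rewrite divfK ?gt_eqF // in he.
  by apply: le_trans he; rewrite mulrC ler_wpM2l ?nrm_ge0 // lerDl.
split; first by apply/cvg_ex; exists l.
exact: cvg_lim hc.
Unshelve. all: by end_near. Qed.

Lemma sq_le_expR x : 0 <= x -> x ^+ 2 <= 4 * expR x.
Proof.
move=> x0; have -> : expR x = expR (x / 2) * expR (x / 2) by rewrite -expRD -splitr.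
have := expR_ge1Dx (x / 2).
have : 0 < expR (x / 2) by exact: expR_gt0.
nra.
Qed.

Definition dsum b lam z : C := bisum (fun m => b m * cexp (lam m * z)).

(** The factor [exp (r |lam m|)] is a margin: it gives uniform decay on the disc of radius [r] about
    [z], and it pays for the powers of [lam m] that differentiation produces. *)
Definition dsummable b lam z : Prop := exists q r B, [/\ 0 <= q < 1, 0 < r, 0 <= B &
  forall m, nrm (b m) * expR (complex.Re (lam m * z)) * expR (r * nrm (lam m))
    <= B * q ^+ `|m|%N].

Lemma nrm_Re_le z : complex.Re z <= nrm z.
Proof. exact: le_trans (ler_norm _) (nrm_Re z). Qed.

Lemma dsummable_zgeo q r B b lam z h : 0 <= q -> 0 < r ->
  (forall m, nrm (b m) * expR (complex.Re (lam m * z)) * expR (r * nrm (lam m))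
    <= B * q ^+ `|m|%N) -> nrm h <= r ->
  zgeo q B (fun m => b m * cexp (lam m * (h + z))).
Proof.
move=> q0 r0 H hr m; apply: le_trans (H m).
rewrite nrmM nrm_cexp -mulrA ler_wpM2l ?nrm_ge0 // -expRD ler_expR.
rewrite mulrDr raddfD /= addrC lerD2l; apply: le_trans (nrm_Re_le _) _.
by rewrite nrmM mulrC ler_wpM2r ?nrm_ge0.
Qed.

(** Half of the margin is spent on the new factor, through [x <= (2 / r) exp (r x / 2)]. *)
Lemma dsummable_deriv_coef q r B b lam z : 0 <= q -> 0 < r ->
  (forall m, nrm (b m) * expR (complex.Re (lam m * z)) * expR (r * nrm (lam m))
    <= B * q ^+ `|m|%N) ->
  forall m, nrm (b m * lam m) * expR (complex.Re (lam m * z))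
      * expR (r / 2 * nrm (lam m)) <= 2 / r * B * q ^+ `|m|%N.
Proof.
move=> q0 r0 H m; rewrite -[2 / r * B * _]mulrA.
apply: le_trans (ler_wpM2l _ (H m)); last by rewrite divr_ge0 // ltW.
rewrite nrmM; set x := nrm (lam m).
have hx : x <= 2 / r * expR (r / 2 * x).
  have := expR_ge1Dx (r / 2 * x) => h.
  rewrite -ler_pdivrMl ?divr_gt0 // invf_div; lra.
have -> : expR (r * x) = expR (r / 2 * x) * expR (r / 2 * x).
  by rewrite -expRD -mulrDl -splitr.
have := ler_wpM2l (_ : 0 <= nrm (b m) * expR (complex.Re (lam m * z)) * expR (r / 2 * x)) hx.
have n0 : 0 <= nrm (b m) * expR (complex.Re (lam m * z)) * expR (r / 2 * x).
  by rewrite !mulr_ge0 ?nrm_ge0 ?expR_ge0.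
move=> /(_ n0) h.
have -> : nrm (b m) * x * expR (complex.Re (lam m * z)) * expR (r / 2 * x) =
  nrm (b m) * expR (complex.Re (lam m * z)) * expR (r / 2 * x) * x by ring.
by apply: le_trans h _; rewrite le_eqVlt; apply/orP; left; apply/eqP; ring.
Qed.

Lemma dsummable_deriv b lam z : dsummable b lam z ->
  dsummable (fun m => b m * lam m) lam z.
Proof.
move=> [q [r [B [qq r0 B0 H]]]]; have /andP [q0 q1] := qq.
exists q, (r / 2), (2 / r * B); split=> //.
- by rewrite divr_gt0.
- by rewrite mulr_ge0 // divr_ge0 // ltW.
exact: dsummable_deriv_coef.
Qed.

Lemma dsum_derive b lam z : dsummable b lam z ->
  is_derive z (1 : C) (dsum b lam) (dsum (fun m => b m * lam m) lam z).
Proof.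
move=> [q [r [B [qq r0 B0 H]]]]; have /andP [q0 q1] := qq.
have r2 : 0 < r / 2 by rewrite divr_gt0.
have H' := dsummable_deriv_coef q0 r0 H.
(* 64 is 4, from the Taylor remainder of [cexp], times 16, from
   [x ^ 2 <= (16 / r ^ 2) exp (r x / 2)]; the other half of the margin absorbs [exp (|lam m| |h|)]
   for [|h| <= r / 2]. *)
pose k := 2 * ((64 / r ^+ 2 * B) / (1 - q)).
apply: (@is_derive_quadratic _ _ _ k (r / 2)) => // h hr.
have hr' : nrm h <= r.
  by apply: le_trans hr _; lra.
have B'0 : 0 <= 2 / r * B by rewrite mulr_ge0 // divr_ge0 // ltW.
have z1 : zgeo q B (fun m => b m * cexp (lam m * (h + z))) by exact: dsummable_zgeo H hr'.
have z2 : zgeo q B (fun m => b m * cexp (lam m * z)).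
  have := @dsummable_zgeo _ _ _ _ _ _ 0 q0 r0 H; rewrite nrm0 add0r; apply; exact: ltW.
have z3 : zgeo q (2 / r * B) (fun m => b m * lam m * cexp (lam m * z)).
  have := @dsummable_zgeo _ _ _ _ _ _ 0 q0 r2 H'; rewrite nrm0 add0r; apply; exact: ltW.
have z4 := zgeoZ h z3.
have z12 : zgeo q (B + B) (fun m => b m * cexp (lam m * (h + z)) - b m * cexp (lam m * z)).
  move=> m; apply: le_trans (nrmB _ _) _; rewrite mulrDl; exact: lerD.
rewrite /dsum -(bisumZ h qq B'0 z3) -(bisumB qq B0 B0 z1 z2).
rewrite -(bisumB qq _ _ z12 z4) ?addr_ge0 //; last by rewrite mulr_ge0 ?nrm_ge0.
pose B2 := 64 / r ^+ 2 * B * nrm h ^+ 2.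
have -> : k * nrm h ^+ 2 = 2 * (B2 / (1 - q)).
  by rewrite /k /B2; ring.
apply: bisum_bound => //.
  by rewrite /B2 mulr_ge0 ?exprn_ge0 ?nrm_ge0 // mulr_ge0 // divr_ge0 // exprn_ge0 // ltW.
move=> m.
have -> : b m * cexp (lam m * (h + z)) - b m * cexp (lam m * z)
    - h * (b m * lam m * cexp (lam m * z)) =
    b m * cexp (lam m * z) * (cexp (lam m * h) - 1 - lam m * h).
  rewrite mulrDr cexpD; ring.
rewrite (nrmM (b m * cexp (lam m * z))) (nrmM (b m)) nrm_cexp.
set x := nrm (lam m); set y := nrm h.
have x0 : 0 <= x by exact: nrm_ge0.
have y0 : 0 <= y by exact: nrm_ge0.
have t1 : nrm (cexp (lam m * h) - 1 - lam m * h) <=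
    64 / r ^+ 2 * y ^+ 2 * expR (r * x).
  apply: le_trans (nrm_cexp_taylor1 _) _; rewrite (nrmM (lam m) h) -/x -/y.
  have e1 : expR (x * y) <= expR (r / 2 * x).
    by rewrite ler_expR mulrC ler_wpM2r.
  have e2 : x ^+ 2 <= 16 / r ^+ 2 * expR (r / 2 * x).
    have rx0 : 0 <= r / 2 * x by rewrite mulr_ge0 // ltW.
    have h2 := sq_le_expR rx0; rewrite exprMn in h2.
    have r4 : 0 < (r / 2) ^+ 2 by rewrite exprn_gt0.
    rewrite -(ler_pM2l r4); apply: le_trans h2 _.
    rewrite le_eqVlt; apply/orP; left; apply/eqP.
    by field; rewrite gt_eqF.
  have -> : expR (r * x) = expR (r / 2 * x) * expR (r / 2 * x).
    by rewrite -expRD -mulrDl -splitr.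
  have -> : 64 / r ^+ 2 * y ^+ 2 * (expR (r / 2 * x) * expR (r / 2 * x)) =
      4 * ((16 / r ^+ 2 * expR (r / 2 * x)) * y ^+ 2) * expR (r / 2 * x).
    by field; rewrite gt_eqF.
  rewrite exprMn; apply: ler_pM => //; rewrite ?expR_ge0 //.
    by rewrite !mulr_ge0 // exprn_ge0.
  by rewrite ler_wpM2l // ler_wpM2r // exprn_ge0.
have n0 : 0 <= nrm (b m) * expR (complex.Re (lam m * z)).
  by rewrite mulr_ge0 ?nrm_ge0 ?expR_ge0.
apply: le_trans (ler_wpM2l n0 t1) _.
have c0 : 0 <= 64 / r ^+ 2 * y ^+ 2.
  by rewrite mulr_ge0 ?exprn_ge0 // divr_ge0 // exprn_ge0 // ltW.
have := ler_wpM2l c0 (H m); rewrite -/x /B2 -/y.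
set X := nrm (b m) * _; move: X => X.
rewrite mulrA [c in _ -> _ <= c](_ : _ = 64 / r ^+ 2 * y ^+ 2 * (B * q ^+ `|m|%N)); last ring.
by rewrite [X * _]mulrA [X in _ -> X <= _](_ : _ = 64 / r ^+ 2 * y ^+ 2 * X * expR (r * x)) //; ring.
Qed.

(** The derivative is a Dirichlet sum with the same exponents and again summable, so that one
    differentiation can be iterated. *)
Lemma dsum_smooth (A : set C) b lam : open A -> (forall z, A z -> dsummable b lam z) ->
  smooth_on A (dsum b lam).
Proof.
move=> oA H n z Az.
suff [b' hb' E] : exists2 b', (forall z, A z -> dsummable b' lam z) &
    forall z, A z -> derive1n n (dsum b lam) z = dsum b' lam z.
  have [+ _] := dsum_derive (hb' z Az); apply: near_eq_derivable.
  by apply: filterS (open_nbhs_nbhs (conj oA Az)) => y /E.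
elim: n {z Az} => [|n [b' hb' E]]; first by exists b.
exists (fun m => b' m * lam m) => [z Az|z Az]; first exact: dsummable_deriv (hb' z Az).
rewrite derive1nS (near_derive1 oA Az E).
exact: is_derive_derive1 (dsum_derive (hb' z Az)).
Qed.

End DirichletSums.

(** * Proportionality in the Poisson summation formula *)

Section Gaussian.

Local Open Scope classical_set_scope.

Variable R : realType.
Local Notation C := (CC R).
Implicit Types (z w h e : C) (q B x t rho kap : R).

Variable mu : C.
Hypothesis mu_gt0 : 0 < complex.Re mu.

Definition gauss w : C := cexp (- (pi : R)%:C%C * mu * w ^+ 2).

Lemma ReZ t z : complex.Re ((t%:C%C : C) * z) = t * complex.Re z.
Proof. by case: z => a b /=; rewrite mul0r subr0. Qed.

Lemma gauss_bound rho kap : 0 <= rho -> 0 <= kap -> exists2 B, 0 <= B &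
  forall z t, nrm z <= rho ->
    nrm (gauss (z + t%:C%C)) * expR (kap * `|t|) <= B * expR (- `|t|).
Proof.
move=> rho0 kap0.
pose a := (pi : R) * complex.Re mu.
have a0 : 0 < a by rewrite mulr_gt0 ?pi_gt0.
pose M := (pi : R) * nrm mu.
have M0 : 0 <= M by rewrite mulr_ge0 ?pi_ge0 ?nrm_ge0.
(* All terms linear in [|t|]: the cross term of the square, the allowance [kap], and 1 for the decay
   [exp (- |t|)]. The constant below comes from completing the square against [a t ^ 2]. *)
pose b := 2 * M * rho + kap + 1.
exists (expR (M * rho ^+ 2 + b ^+ 2 / (4 * a))); first exact: expR_ge0.
move=> z t hz; rewrite /gauss nrm_cexp -!expRD ler_expR.
have -> : - (pi : R)%:C%C * mu * (z + t%:C%C) ^+ 2 =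
    - ((pi : R)%:C%C * mu * (z ^+ 2 + 2 * (z * t%:C%C)))
    + ((- ((pi : R) * t ^+ 2))%:C%C : C) * mu.
  rewrite rmorphN rmorphM rmorphXn /=; ring.
rewrite raddfD /= ReZ.
have h1 : complex.Re (- ((pi : R)%:C%C * mu * (z ^+ 2 + 2 * (z * t%:C%C)))) <=
    M * (rho ^+ 2 + 2 * (rho * `|t|)).
  apply: le_trans (nrm_Re_le _) _; rewrite nrmN.
  rewrite (nrmM (_ * mu)) (nrmM _ mu) nrm_real ger0_norm ?pi_ge0 //.
  rewrite ler_wpM2l //; apply: le_trans (nrmD _ _) _.
  rewrite nrmX (nrmM 2) (nrm_nat _ 2) (nrmM z) nrm_real.
  have z0 := nrm_ge0 z; apply: lerD; first by rewrite lerXn2r ?nnegrE.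
  by rewrite ler_wpM2l // ler_wpM2r.
have tt : t ^+ 2 = `|t| ^+ 2 by rewrite real_normK ?num_real.
rewrite tt; have := normr_ge0 t; set s := `|t| in h1 *; move=> s0.
have key : b * s <= b ^+ 2 / (4 * a) + a * s ^+ 2.
  have : 0 <= (b / (2 * a) - s) ^+ 2 * a by rewrite mulr_ge0 ?sqr_ge0 // ltW.
  have -> : (b / (2 * a) - s) ^+ 2 * a = b ^+ 2 / (4 * a) - b * s + a * s ^+ 2.
    by field; rewrite gt_eqF.
  lra.
have e2 : - ((pi : R) * s ^+ 2) * complex.Re mu = - (a * s ^+ 2) by rewrite /a; ring.
have e3 : b * s = 2 * M * rho * s + kap * s + s by rewrite /b; ring.
rewrite e2; rewrite e3 in key; nra.
Qed.

(** First-order Taylor remainder: the derivative of [gauss] at [w] is [- 2 pi mu w gauss w]. *)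
Definition gauss_rem e w : C :=
  gauss (w + e) - gauss w + 2 * (pi : R)%:C%C * mu * w * e * gauss w.

Lemma gauss_add w e :
  gauss (w + e) = gauss w * cexp (- (pi : R)%:C%C * mu * (2 * w * e + e ^+ 2)).
Proof. by rewrite /gauss -cexpD; congr cexp; ring. Qed.

Lemma gauss_remE w e : let u := - (pi : R)%:C%C * mu * (2 * w * e + e ^+ 2) in
  gauss_rem e w = gauss w * ((cexp u - 1 - u) + - ((pi : R)%:C%C * mu * e ^+ 2)).
Proof.
move=> u; rewrite /gauss_rem gauss_add -/u.
have -> : 2 * (pi : R)%:C%C * mu * w * e = - u - (pi : R)%:C%C * mu * e ^+ 2.
  by rewrite /u; ring.
move: (cexp u) (gauss w) => x y; ring.
Qed.

Lemma gauss_rem_bound (rho D : R) : 0 <= rho -> 0 <= D -> exists2 B, 0 <= B &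
  forall e z t, nrm z <= rho -> nrm e <= D ->
    nrm (gauss_rem e (z + t%:C%C)) <= B * nrm e ^+ 2 * expR (- `|t|).
Proof.
move=> rho0 D0.
pose M := (pi : R) * nrm mu.
have M0 : 0 <= M by rewrite mulr_ge0 ?pi_ge0 ?nrm_ge0.
(* Chosen so that the exponent increment satisfies [|u| <= |e| A (1 + |t|)]. Then [u ^ 2 exp |u|]
   grows at most like [exp ((2 + D A) |t|)], which is the allowance asked of [gauss_bound]. *)
pose A := M * (2 * rho + D + 2).
have A0 : 0 <= A by rewrite mulr_ge0 // addr_ge0 // addr_ge0 // mulr_ge0.
have kap0 : 0 <= 2 + D * A by rewrite addr_ge0 // mulr_ge0.
have [B B0 HB] := gauss_bound rho0 kap0.
pose c := 4 * A ^+ 2 * expR (D * A) + M.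
have c0 : 0 <= c by rewrite addr_ge0 // mulr_ge0 ?expR_ge0 // mulr_ge0 // exprn_ge0.
exists (c * B); first exact: mulr_ge0.
move=> e z t hz he; rewrite gauss_remE (nrmM (gauss _)).
set u := - _ * _ * _.
have e0 := nrm_ge0 e; have t0 := normr_ge0 t.
have hM v : nrm ((pi : R)%:C%C * mu * v) = M * nrm v.
  by rewrite (nrmM (_ * mu)) (nrmM _ mu) nrm_real ger0_norm ?pi_ge0.
have hu : nrm u <= nrm e * A * (1 + `|t|).
  rewrite /u mulNr mulNr nrmN hM.
  have h1 : nrm (2 * (z + t%:C%C) * e + e ^+ 2) <= nrm e * (2 * (rho + `|t|) + D).
    apply: le_trans (nrmD _ _) _; rewrite (nrmM _ e) (nrmM 2) (nrm_nat _ 2) nrmX.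
    rewrite expr2 mulrC -mulrDr ler_wpM2l //; apply: lerD => //.
    rewrite ler_wpM2l //; apply: le_trans (nrmD _ _) _.
    by rewrite nrm_real lerD2r.
  apply: le_trans (ler_wpM2l M0 h1) _.
  have -> : nrm e * A * (1 + `|t|) = M * (nrm e * ((2 * rho + D + 2) * (1 + `|t|))).
    by rewrite /A; ring.
  rewrite ler_wpM2l // ler_wpM2l //.
  have p1 := mulr_ge0 rho0 t0; have p2 := mulr_ge0 D0 t0; lra.
have et : 1 + `|t| <= expR `|t| by exact: expR_ge1Dx.
have h1 : nrm (cexp u - 1 - u) <=
    4 * A ^+ 2 * expR (D * A) * (nrm e ^+ 2 * expR ((2 + D * A) * `|t|)).
  apply: le_trans (nrm_cexp_taylor1 _) _.
  have hu1 : nrm u <= nrm e * A * expR `|t|.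
    by apply: le_trans hu _; rewrite ler_wpM2l // mulr_ge0.
  have hu2 : nrm u ^+ 2 <= nrm e ^+ 2 * A ^+ 2 * expR (2 * `|t|).
    have -> : nrm e ^+ 2 * A ^+ 2 * expR (2 * `|t|) = (nrm e * A * expR `|t|) ^+ 2.
      rewrite !exprMn; congr (_ * _).
      by rewrite expr2 -expRD; congr expR; ring.
    have p0 : 0 <= nrm e * A * expR `|t|.
      by apply: mulr_ge0; [exact: mulr_ge0 | exact: expR_ge0].
    exact: lerXn2r (nrm_ge0 _) p0 hu1.
  have hu3 : expR (nrm u) <= expR (D * A) * expR (D * A * `|t|).
    rewrite -expRD ler_expR; apply: le_trans hu _.
    have -> : D * A + D * A * `|t| = D * A * (1 + `|t|) by ring.
    by rewrite ler_wpM2r ?addr_ge0 // ler_wpM2r.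
  have -> : expR ((2 + D * A) * `|t|) = expR (2 * `|t|) * expR (D * A * `|t|).
    by rewrite -expRD mulrDl.
  have -> : 4 * A ^+ 2 * expR (D * A) *
      (nrm e ^+ 2 * (expR (2 * `|t|) * expR (D * A * `|t|))) =
      4 * (nrm e ^+ 2 * A ^+ 2 * expR (2 * `|t|)) * (expR (D * A) * expR (D * A * `|t|)).
    ring.
  apply: ler_pM => //; rewrite ?expR_ge0 //; first by rewrite mulr_ge0 ?exprn_ge0 ?nrm_ge0.
  by rewrite ler_wpM2l.
have h2 : nrm (- ((pi : R)%:C%C * mu * e ^+ 2)) <=
    M * (nrm e ^+ 2 * expR ((2 + D * A) * `|t|)).
  rewrite nrmN hM nrmX ler_wpM2l // ler_peMr ?exprn_ge0 //.
  by rewrite -[leLHS]expR0 ler_expR mulr_ge0.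
have h3 : nrm (cexp u - 1 - u + - ((pi : R)%:C%C * mu * e ^+ 2)) <=
    c * (nrm e ^+ 2 * expR ((2 + D * A) * `|t|)).
  by apply: le_trans (nrmD _ _) _; rewrite /c mulrDl; exact: lerD.
apply: le_trans (ler_wpM2l (nrm_ge0 _) h3) _.
have := HB z t hz; set E := expR ((2 + _) * _); set g := nrm (gauss _) => hg.
have ce : 0 <= c * nrm e ^+ 2 by rewrite mulr_ge0 // exprn_ge0.
have := ler_wpM2l ce hg.
have -> : c * nrm e ^+ 2 * (g * E) = g * (c * (nrm e ^+ 2 * E)) by ring.
by have -> : c * nrm e ^+ 2 * (B * expR (- `|t|)) = c * B * nrm e ^+ 2 * expR (- `|t|) by ring.
Qed.

End Gaussian.

(** * Riemann sums of the Gaussian and their translates *)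

Section RiemannSums.

Local Open Scope classical_set_scope.

Variable R : realType.
Local Notation C := (CC R).
Implicit Types (z w e d : C) (q B t rho : R) (N : nat) (m : int) (f g : R -> C).

Definition rpt N m : R := m%:~R / N%:R.

Definition rratio N : R := expR (- N%:R^-1).

Definition expdec B f : Prop := forall t, nrm (f t) <= B * expR (- `|t|).

Lemma rratio_itv N : (0 < N)%N -> 0 < rratio N < 1.
Proof.
move=> N0; rewrite /rratio expR_gt0 /= -[ltRHS]expR0 ltr_expR oppr_lt0.
by rewrite invr_gt0 ltr0n.
Qed.

Lemma rratio_itvW N : (0 < N)%N -> 0 <= rratio N < 1.
Proof. by move=> /rratio_itv /andP [/ltW -> ->]. Qed.

Lemma expdec_zgeo N B f : (0 < N)%N -> expdec B f -> zgeo (rratio N) B (fun m => f (rpt N m)).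
Proof.
move=> N0 hf m; apply: le_trans (hf _) _.
rewrite /rratio -expRM_natl /rpt normrM normfV.
rewrite [`|N%:R|]ger0_norm ?ler0n // -intr_norm mulrN.
by rewrite [in X in _ <= X](_ : (`|m|%N)%:R = (`|m|)%:~R :> R) // -abszE.
Qed.

Definition rsum N f : C := N%:R^-1 * bisum (fun m => f (rpt N m)).

(** Uniform in [N]: the geometric series of ratio [exp (- 1 / N)] is at most [N + 1], and the step
    [1 / N] compensates it. *)
Lemma rsum_bound N B f : (0 < N)%N -> 0 <= B -> expdec B f -> nrm (rsum N f) <= 4 * B.
Proof.
move=> N0 B0 hf; rewrite /rsum nrmM nrmV nrm_nat.
have nN0 : 0 < N%:R :> R by rewrite ltr0n.
have h := bisum_bound (rratio_itvW N0) B0 (expdec_zgeo N0 hf).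
have h2 : (1 - rratio N)^-1 <= N%:R + 1.
  have h3 := expR_mul_ge (- N%:R^-1 : R); rewrite -/(rratio N) opprK in h3.
  have /andP [q0 q1] := rratio_itv N0.
  rewrite invf_ple ?posrE ?subr_gt0 // ?addr_gt0 //.
  have e1 : (1 + N%:R^-1) = (N%:R + 1) / N%:R :> R by field; rewrite gt_eqF.
  rewrite e1 in h3.
  have N1 : 0 < N%:R + 1 :> R by rewrite addr_gt0.
  have h4 : rratio N <= N%:R / (N%:R + 1).
    by rewrite ler_pdivlMr // -(ler_pM2r (_ : 0 < N%:R^-1)) ?invr_gt0 // mulfV ?gt_eqF // -mulrA mulrC.
  have e2 : (N%:R + 1)^-1 = 1 - N%:R / (N%:R + 1) :> R by field; rewrite gt_eqF.
  rewrite e2; lra.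
have N1 : 1 <= N%:R :> R by rewrite ler1n.
rewrite mulrC ler_pdivrMr //; apply: le_trans h _.
have : B / (1 - rratio N) <= B * (N%:R + 1) by rewrite ler_wpM2l.
nra.
Qed.

Lemma rsumD N B B' f g : (0 < N)%N -> 0 <= B -> 0 <= B' -> expdec B f -> expdec B' g ->
  rsum N (fun t => f t + g t) = rsum N f + rsum N g.
Proof.
move=> N0 B0 B0' hf hg; rewrite /rsum -mulrDr; congr (_ * _).
exact: bisumD (rratio_itvW N0) B0 B0' (expdec_zgeo N0 hf) (expdec_zgeo N0 hg).
Qed.

Lemma rsumZ N B z f : (0 < N)%N -> 0 <= B -> expdec B f ->
  rsum N (fun t => z * f t) = z * rsum N f.
Proof.
move=> N0 B0 hf; rewrite /rsum (bisumZ z (rratio_itvW N0) B0 (expdec_zgeo N0 hf)).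
by rewrite mulrCA.
Qed.

Lemma expdecD B B' f g : expdec B f -> expdec B' g -> expdec (B + B') (fun t => f t + g t).
Proof.
by move=> hf hg t; apply: le_trans (nrmD _ _) _; rewrite mulrDl; exact: lerD.
Qed.

Lemma expdecZ B z f : expdec B f -> expdec (nrm z * B) (fun t => z * f t).
Proof. by move=> hf t; rewrite nrmM -mulrA ler_wpM2l ?nrm_ge0. Qed.

Variable mu : C.
Hypothesis mu_gt0 : 0 < complex.Re mu.

Definition riem N z : C := rsum N (fun t => gauss mu (z + t%:C%C)).

Lemma gauss_expdec rho : 0 <= rho -> exists2 B, 0 <= B &
  forall z, nrm z <= rho -> expdec B (fun t => gauss mu (z + t%:C%C)).
Proof.
move=> rho0; have [B B0 H] := gauss_bound mu_gt0 rho0 (lexx 0).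
by exists B => // z hz t; have := H z t hz; rewrite mul0r expR0 mulr1.
Qed.

Lemma rptS N m : (0 < N)%N -> rpt N (m + 1) = N%:R^-1 + rpt N m.
Proof. by move=> N0; rewrite /rpt intrD mulrDl mul1r addrC. Qed.

Lemma riem_period N z : (0 < N)%N -> riem N (z + (N%:R^-1 : R)%:C%C) = riem N z.
Proof.
move=> N0; have [B B0 H] := gauss_expdec (nrm_ge0 z).
rewrite /riem /rsum; congr (_ * _).
rewrite -(bisum_shift (rratio_itv N0) B0 (expdec_zgeo N0 (H z (lexx _)))).
by apply: eq_bisum => m; rewrite rptS // rmorphD addrA.
Qed.

(* Since riem N has period 1 / N, gauss_rem e may be replaced by
   gauss_rem e - e N gauss_rem (1 / N), whose linear terms in e cancel. *)
Lemma riem_step rho (D : R) : 0 <= rho -> 1 <= D -> exists2 k : R, 0 <= k &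
  forall N z e, (0 < N)%N -> nrm z <= rho -> nrm e <= D / N%:R ->
    nrm (riem N (z + e) - riem N z) <= k / N%:R ^+ 2.
Proof.
move=> rho0 D1; have D0 : 0 <= D by exact: le_trans D1.
have [B B0 H] := gauss_rem_bound mu_gt0 rho0 D0.
have [B1 B10 H1] := gauss_expdec (addr_ge0 rho0 D0).
exists (4 * (B * D ^+ 2 + D * B)).
  by rewrite mulr_ge0 // addr_ge0 // mulr_ge0 // exprn_ge0.
move=> N z e N0 hz he.
have nN0 : 0 < N%:R :> R by rewrite ltr0n.
have nN1 : 1 <= N%:R :> R by rewrite ler1n.
have heD : nrm e <= D by apply: le_trans he _; rewrite ler_pdivrMr // ler_peMr.
pose h : C := (N%:R^-1 : R)%:C%C.
have nh : nrm h = N%:R^-1 by rewrite /h nrm_real gtr0_norm ?invr_gt0.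
have hD : nrm h <= D by rewrite nh; apply: le_trans D1; rewrite invf_le1.
pose c : C := e * N%:R.
have nc : nrm c <= D by rewrite /c nrmM nrm_nat -ler_pdivlMr.
pose Y t : C := gauss_rem mu e (z + t%:C%C) - c * gauss_rem mu h (z + t%:C%C).
have ch : c * h = e.
  by rewrite /c /h fmorphV rmorph_nat mulfK // pnatr_eq0 -lt0n.
have YE t : Y t = (gauss mu (z + e + t%:C%C) + -1 * gauss mu (z + t%:C%C)) +
    (- c) * (gauss mu (z + h + t%:C%C) + -1 * gauss mu (z + t%:C%C)).
  rewrite /Y /gauss_rem -[z + e + _]addrAC -[z + h + _]addrAC.
  set w := z + t%:C%C; set g := gauss mu w; set g1 := gauss mu (w + e).
  set g2 := gauss mu (w + h).
  transitivity (g1 - g + 2 * (pi : R)%:C%C * mu * w * (e - c * h) * g - c * (g2 - g)).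
    ring.
  by rewrite ch subrr mulr0 mul0r; ring.
have zD v : nrm v <= D -> nrm (z + v) <= rho + D.
  by move=> hv; apply: le_trans (nrmD _ _) _; exact: lerD.
have d0 : expdec B1 (fun t => gauss mu (z + t%:C%C)).
  by apply: H1; apply: le_trans hz _; rewrite lerDl.
have d1 := H1 _ (zD e heD); have d2 := H1 _ (zD h hD).
have d0' := expdecZ (-1) d0; rewrite nrmN nrm1 mul1r in d0'.
have e1 := rsumD N0 B10 B10 d1 d0'; have e2 := rsumD N0 B10 B10 d2 d0'.
have B11 : 0 <= B1 + B1 by exact: addr_ge0.
have E : rsum N Y = riem N (z + e) - riem N z.
  rewrite (_ : Y = fun t => (gauss mu (z + e + t%:C%C) + -1 * gauss mu (z + t%:C%C)) +
    (- c) * (gauss mu (z + h + t%:C%C) + -1 * gauss mu (z + t%:C%C))); last first.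
    by apply/funext.
  have d2' := expdecD d2 d0'.
  have ncB : 0 <= nrm (- c) * (B1 + B1) by rewrite mulr_ge0 ?nrm_ge0.
  rewrite (rsumD N0 B11 ncB (expdecD d1 d0') (expdecZ (- c) d2')).
  rewrite (rsumZ (- c) N0 B11 d2') e1 e2 (rsumZ (-1) N0 B10 d0).
  rewrite -!/(riem N _) riem_period //.
  by rewrite !mulN1r subrr mulr0 addr0.
rewrite -E -mulrA; apply: rsum_bound => //.
  by rewrite divr_ge0 ?exprn_ge0 ?addr_ge0 ?mulr_ge0 ?exprn_ge0 // ltW.
move=> t; apply: le_trans (nrmB _ _) _.
have b1 := H e z t hz heD; have b2 := H h z t hz hD.
have n2 : nrm e ^+ 2 <= D ^+ 2 / N%:R ^+ 2.
  by rewrite -expr_div_n lerXn2r ?nnegrE ?nrm_ge0 ?divr_ge0 // ltW.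
have E0 := expR_ge0 (- `|t| : R).
rewrite (nrmM c) !mulrDl; apply: lerD.
  apply: le_trans b1 _; rewrite ler_wpM2r // -mulrA ler_wpM2l //.
rewrite nh exprVn in b2.
have := ler_pM (nrm_ge0 c) (nrm_ge0 _) nc b2.
by rewrite !mulrA.
Qed.

(** [N] steps of length [d / N], each costing [O (1 / N ^ 2)]. For complex [d] this is the discrete
    substitute for shifting the contour of the Gaussian integral. *)
Lemma riem_total z d : exists2 k : R, 0 <= k &
  forall N, (0 < N)%N -> nrm (riem N (z + d) - riem N z) <= k / N%:R.
Proof.
have rho0 : 0 <= nrm z + nrm d by rewrite addr_ge0 ?nrm_ge0.
have D1 : 1 <= nrm d + 1 by rewrite lerDr nrm_ge0.
have [k k0 H] := riem_step rho0 D1.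
exists k => // N N0.
have nN0 : 0 < N%:R :> R by rewrite ltr0n.
pose e : C := d / N%:R.
have ne : nrm e = nrm d / N%:R by rewrite /e nrmM nrmV nrm_nat.
have he : nrm e <= (nrm d + 1) / N%:R.
  by rewrite ne ler_wpM2r ?invr_ge0 ?ler0n // lerDl.
have ind j : (j <= N)%N -> nrm (riem N (z + j%:R * e) - riem N z) <= j%:R * (k / N%:R ^+ 2).
  elim: j => [|j IH] jN; first by rewrite !mul0r addr0 subrr nrm0.
  have -> : z + j.+1%:R * e = z + j%:R * e + e by rewrite -natr1; ring.
  set x := z + j%:R * e in IH *.
  have -> : riem N (x + e) - riem N z = (riem N (x + e) - riem N x) + (riem N x - riem N z).
    ring.
  apply: le_trans (nrmD _ _) _; rewrite -natr1 mulrDl mul1r addrC; apply: lerD.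
    exact/IH/ltnW.
  apply: H => //; apply: le_trans (nrmD _ _) _; rewrite lerD2l nrmM nrm_nat ne.
  rewrite mulrA ler_pdivrMr // mulrC ler_wpM2l ?nrm_ge0 //.
  by rewrite ler_nat ltnW.
have := ind N (leqnn N).
have -> : N%:R * e = d by rewrite /e mulrC divfK // pnatr_eq0 -lt0n.
by rewrite [_ * (k / _)](_ : _ = k / N%:R) //; field; rewrite gt_eqF.
Qed.

End RiemannSums.

(** * Discrete Fourier coefficients of the Gaussian *)

Section FourierCoefficients.

Local Open Scope classical_set_scope.

Variable R : realType.
Local Notation C := (CC R).
Implicit Types (z w e d : C) (x y t rho : R) (N n : nat) (k m : int).

(** With [y = x / 2] and [sin y >= y cos y], one gets [sin x = 2 sin y cos y >= 2 y cos y ^ 2 = y (1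
    + cos x) >= y]. *)
Lemma sin_lower x : 0 <= x -> x <= pi / 2 -> x / 2 <= sin x.
Proof.
move=> x0 xpi; have pi0 : 0 < (pi : R) by exact: pi_gt0.
pose y := x / 2; have y0 : 0 <= y by rewrite divr_ge0.
have hy : y * cos y <= sin y.
  have [c] := @MVT_segment R (@sin R) (@cos R) 0 y y0
    (fun t _ => is_derive_sin t) (continuous_subspaceT (@continuous_sin R)).
  rewrite in_itv /= => /andP [c0 cy]; rewrite sin0 !subr0 => ->.
  rewrite mulrC ler_wpM2r //; move: cy; rewrite le_eqVlt => /orP [/eqP -> //|cy].
  rewrite ltW // ltr_cos // in_itv /=; apply/andP; split => //;
    rewrite /y in cy *; lra.
have cx : 0 <= cos x.
  by apply: cos_ge0_pihalf; rewrite xpi andbT; apply: le_trans x0; rewrite oppr_le0 divr_ge0 // ltW.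
have sx : sin x = 2 * sin y * cos y.
  by rewrite {1}[x]splitr sinD -/y; ring.
have cxE : cos x = 2 * cos y ^+ 2 - 1.
  rewrite {1}[x]splitr cosD -/y; have := cos2Dsin2 y; lra.
have cy0 : 0 <= cos y.
  apply: cos_ge0_pihalf; rewrite /y; apply/andP; split; lra.
have xE : x = 2 * y by rewrite /y; field.
have : y * cos y * cos y <= sin y * cos y by rewrite ler_wpM2r.
have : y * (1 + cos x) = 2 * (y * cos y * cos y) by rewrite cxE; ring.
have : 0 <= y * cos x by rewrite mulr_ge0.
rewrite sx -/y; lra.
Qed.

Lemma one_sub_cos_lower y : `|y| <= pi -> y ^+ 2 / 8 <= 1 - cos y.
Proof.
move=> ypi; rewrite -cos_norm.
rewrite -(real_normK (num_real y)) one_sub_cos.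
have y0 := normr_ge0 y; move: `|y| y0 ypi => s s0 spi.
have h := @sin_lower (s / 2) (divr_ge0 s0 (ler0n _ 2)) (ler_wpM2r (_ : 0 <= 2^-1) spi).
have h2 : s / 2 / 2 <= sin (s / 2) by apply: h; rewrite invr_ge0.
nra.
Qed.

Lemma cexp_iE y : cexp ('i * y%:C%C : C) = Complex (cos y) (sin y).
Proof.
have -> : ('i * y%:C%C : C) = Complex 0 y by rewrite [RHS]complexRI /= add0r.
by rewrite /cexp /= expR0 mul1r [RHS]complexRI.
Qed.

Lemma nrm_cexp_i y : nrm (cexp ('i * y%:C%C : C)) = 1.
Proof. by rewrite cexp_iE /nrm /= cos2Dsin2 sqrtr1. Qed.

Lemma nrm_second_diff y :
  nrm (cexp ('i * y%:C%C : C) + cexp (- ('i * y%:C%C) : C) - 2) = 2 * (1 - cos y).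
Proof.
have -> : - ('i * y%:C%C) = 'i * (- y)%:C%C :> C by rewrite rmorphN mulrN.
rewrite !cexp_iE cosN sinN.
have -> : Complex (cos y) (sin y) + Complex (cos y) (- sin y) - 2 =
    (- (2 * (1 - cos y)))%:C%C :> C.
  rewrite [Complex (cos y) (sin y)]complexRI [Complex (cos y) (- _)]complexRI /=.
  rewrite !rmorphN rmorphM rmorphB rmorph1 rmorph_nat; ring.
rewrite nrm_real normrN ger0_norm // mulr_ge0 // subr_ge0; exact: cos_le1.
Qed.

Definition fchar k t : C := cexp (- ('i * (2 * pi * k%:~R * t)%:C%C)).

Lemma nrm_fchar k t : nrm (fchar k t) = 1.
Proof. by rewrite /fchar -mulrN -rmorphN nrm_cexp_i. Qed.

Lemma fcharD k t t' : fchar k (t + t') = fchar k t * fchar k t'.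
Proof. by rewrite /fchar -cexpD -opprD -mulrDr -rmorphD mulrDr. Qed.

Lemma fcharN k t : fchar k (- t) = cexp ('i * (2 * pi * k%:~R * t)%:C%C).
Proof. by rewrite /fchar mulrN rmorphN mulrN opprK. Qed.

Lemma expdec_fchar k B (f : R -> C) : expdec B f -> expdec B (fun t => f t * fchar k t).
Proof. by move=> h t; rewrite nrmM nrm_fchar mulr1. Qed.

Lemma psum_window (f : int -> C) n : psum f n = \sum_(j < n + n) f (Posz j - Posz n).
Proof.
rewrite /psum addrC big_split_ord /=; congr (_ + _).
  rewrite (reindex_inj rev_ord_inj); apply: eq_bigr => j _ /=; congr f.
  by have := ltn_ord j; lia.
by apply: eq_bigr => j _; congr f; lia.
Qed.

Lemma rpt_mul N m : (0 < N)%N -> rpt R N (Posz N * m) = m%:~R.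
Proof. by move=> N0; rewrite /rpt intrM mulrC mulKf // pnatr_eq0 -lt0n. Qed.

Lemma fchar_rpt_mul k N m : (0 < N)%N -> fchar k (rpt R N (Posz N * m)) = 1.
Proof.
move=> N0; rewrite rpt_mul // /fchar.
have -> : ('i * (2 * pi * k%:~R * m%:~R)%:C%C : C) =
    (k * m)%:~R * (2 * ('i * (pi : R)%:C%C)).
  by rewrite intrM !rmorphM !rmorph_int rmorph_nat /=; ring.
by rewrite cexpN cexp_2pii_int invr1.
Qed.

(** Only the remainder [r] of [m] counts, with [0 < r < N], and [1 - cos (2 pi r / N) = 2 sin (pi r
    / N) ^ 2] is positive. *)
Lemma fchar_rpt_neq1 N m : (0 < N)%N -> ~~ (Posz N %| m)%Z -> fchar 1 (rpt R N m) != 1.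
Proof.
move=> N0 Nm; have nN0 : 0 < N%:R :> R by rewrite ltr0n.
have N0z : Posz N != 0 by lia.
pose r := (m %% Posz N)%Z.
have r0 : 0 < r.
  by rewrite lt_def modz_ge0 // andbT; move: Nm; apply: contra => /eqP h; rewrite dvdzE; apply/dvdz_mod0P.
have rN : r < Posz N by have := ltz_mod m N0z; rewrite -/r; lia.
have -> : fchar 1 (rpt R N m) = fchar 1 (rpt R N r).
  have -> : rpt R N m = rpt R N (Posz N * (m %/ Posz N)%Z) + rpt R N r.
    by rewrite /rpt -mulrDl -intrD; congr (_%:~R / _); rewrite mulrC -divz_eq.
  by rewrite fcharD fchar_rpt_mul // mul1r.
set y := 2 * pi * 1%:~R * rpt R N r.
apply/eqP => h.
have hc : cos y = 1.
  have := congr1 (@complex.Re R) h.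
  by rewrite /fchar -/y -mulrN -rmorphN cexp_iE /= cosN.
have hs : 0 < sin (y / 2).
  have yE : y / 2 = pi * (r%:~R / N%:R) 
    by rewrite /y /rpt; move: (r%:~R / N%:R) => v; rewrite -[1%:~R]/(1 : R); field.
  rewrite yE; apply: sin_gt0_pi.
  have q0 : 0 < r%:~R / N%:R :> R by rewrite divr_gt0 // ltr0z.
  have q1 : r%:~R / N%:R < 1 :> R.
    by rewrite ltr_pdivrMr // mul1r -[N%:R]/((Posz N)%:~R) ltr_int.
  by rewrite mulr_gt0 ?pi_gt0 //= gtr_pMr ?pi_gt0.
have := one_sub_cos y; rewrite hc subrr => /esym/eqP.
by rewrite mulf_eq0 pnatr_eq0 /= expf_eq0 /= gt_eqF.
Qed.

(** Orthogonality of characters: a geometric sum over a full period of frequencies, whose ratio is a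
    [2 n]-th root of unity. *)
Lemma fchar_sum n m : (0 < n)%N ->
  \sum_(j < n + n) fchar (Posz j - Posz n) (rpt R (n + n) m) =
  if (Posz (n + n) %| m)%Z then (n + n)%:R else 0.
Proof.
move=> n0; have N0 : (0 < n + n)%N by rewrite addn_gt0 n0.
set N := (n + n)%N in N0 *; set t := rpt R N m; set a := fchar 1 t.
have E (j : nat) : fchar (Posz j - Posz n) t = fchar (- Posz n) t * a ^+ j.
  rewrite /a /fchar -cexp_nat -cexpD; congr cexp.
  have -> : 2 * pi * (Posz j - Posz n)%:~R * t =
      2 * pi * (- Posz n)%:~R * t + j%:R * (2 * pi * 1%:~R * t).
    by rewrite intrD -[(Posz j)%:~R]/(j%:R : R) -[1%:~R]/(1 : R); ring.
  rewrite rmorphD (rmorphM _ j%:R) rmorph_nat /=.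
  by move: ((_ * _ * _ * _)%:C%C : C) ((_ * _ * _ * _)%:C%C : C) => u v; ring.
under eq_bigr do rewrite E.
rewrite -mulr_sumr; case: ifP => hd.
  have /dvdzP [q hq] := hd.
  have t1 k : fchar k t = 1 by rewrite /t hq mulrC fchar_rpt_mul.
  rewrite /a !t1 mul1r; under eq_bigr do rewrite expr1n.
  by rewrite sumr_const card_ord.
have a1 : a != 1 by rewrite /a; apply: fchar_rpt_neq1 => //; rewrite hd.
have aN : a ^+ N = 1.
  rewrite /a /fchar -cexp_nat.
  have -> : N%:R * - ('i * (2 * pi * 1%:~R * t)%:C%C) = - (m%:~R * (2 * ('i * (pi : R)%:C%C))) :> C.
    rewrite /t /rpt !rmorphM fmorphV !rmorph_int !rmorph_nat /= rmorph1.
    by field; rewrite pnatr_eq0 -lt0n.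
  by rewrite cexpN cexp_2pii_int invr1.
have := subrX1 a N; rewrite aN subrr => /esym/eqP; rewrite mulf_eq0 subr_eq0 (negbTE a1) /=.
by move=> /eqP ->; rewrite mulr0.
Qed.

Variable mu : C.
Hypothesis mu_gt0 : 0 < complex.Re mu.

Definition fcoef N z k : C := rsum N (fun t => gauss mu (z + t%:C%C) * fchar k t).

Definition fgauss z k : C :=
  cexp (- (pi : R)%:C%C * mu^-1 * k%:~R ^+ 2 + 2 * ('i * (pi : R)%:C%C) * k%:~R * z).

Lemma mu_neq0 : mu != 0.
Proof. by apply/eqP => h; move: mu_gt0; rewrite h ltxx. Qed.

(** Completing the square in the exponent, exactly for every [N]: the character becomes a complex
    translation of the Gaussian. *)
Lemma fcoef_exact N z k : (0 < N)%N ->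
  fcoef N z k = fgauss z k * riem mu N (z + 'i * k%:~R / mu).
Proof.
move=> N0.
have [B B0 H] := gauss_expdec mu_gt0 (nrm_ge0 (z + 'i * k%:~R / mu)).
rewrite /riem -(rsumZ _ N0 B0 (H _ (lexx _))) /fcoef; congr (rsum _ _).
apply/funext => t; rewrite /fgauss /gauss /fchar -!cexpD; congr cexp.
rewrite !rmorphM rmorph_int rmorph_nat /=.
have ii : 'i * 'i = -1 :> C by rewrite -expr2 sqrCi.
have m0 := mu_neq0.
move: (t%:C%C : C) ((pi : R)%:C%C : C) ((k%:~R) : C) ii => s p kk ii.
transitivity (- p * mu * (z + s) ^+ 2 - 2 * 'i * p * kk * s
  - ('i * 'i + 1) * p * kk ^+ 2 / mu).
  by rewrite ii addNr !mul0r subr0; ring.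
by field.
Qed.

(** By orthogonality, summing over a full period of frequencies keeps only the integer sample
    points, with a factor [2 n] that the normalization of [rsum] cancels. *)
Lemma fcoef_sum n z : (0 < n)%N ->
  psum (fcoef (n + n) z) n = bisum (fun m => gauss mu (z + m%:~R)).
Proof.
move=> n0; have N0 : (0 < n + n)%N by rewrite addn_gt0 n0.
set N := (n + n)%N in N0 *.
have [B B0 H] := gauss_expdec mu_gt0 (nrm_ge0 z).
have hz := H z (lexx _).
have NC : N%:R != 0 :> C by rewrite pnatr_eq0 -lt0n.
rewrite psum_window /fcoef /rsum -mulr_sumr.
rewrite -(@bisum_sum _ _ _ N (fun j m => gauss mu (z + (rpt R N m)%:C%C)
   * fchar (Posz j - Posz n) (rpt R N m)) (rratio_itvW _ N0) B0); last first.
  by move=> j _; exact: (expdec_zgeo N0 (expdec_fchar _ hz)).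
have hz' := expdec_zgeo N0 hz.
rewrite (@eq_bisum _ _ (fun m => N%:R * (if (Posz N %| m)%Z
    then gauss mu (z + (rpt R N m)%:C%C) else 0))); last first.
  move=> m; rewrite -mulr_sumr fchar_sum // -/N; case: ifP => _; last by rewrite !mulr0.
  by rewrite mulrC.
rewrite (@bisumZ _ (rratio R N) B _ _ (rratio_itvW _ N0) B0); last first.
  move=> m; case: ifP => _; first exact: hz'.
  have /andP [q0 _] := rratio_itvW R N0.
  by rewrite nrm0 mulr_ge0 // exprn_ge0.
rewrite mulrA mulVf // mul1r.
rewrite (bisum_multiples N0 (rratio_itvW _ N0) B0 hz').
apply: eq_bisum => m; congr (gauss _ (_ + _)).
by rewrite rpt_mul // rmorph_int.
Qed.

(* A translation by 1 / N multiplies fcoef by a character, so that its second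
   difference multiplies fcoef by about - (2 pi k / N) ^ 2. *)
Lemma fcoef_bound z : exists2 B : R, 0 <= B &
  forall N k, (0 < N)%N -> k != 0 -> (2 * `|k| <= N)%N ->
    nrm (fcoef N z k) <= B / (k%:~R ^+ 2).
Proof.
have [B B0 HB] := gauss_rem_bound mu_gt0 (nrm_ge0 z) (@ler01 R).
have [B1 B10 H1] := gauss_expdec mu_gt0 (addr_ge0 (nrm_ge0 z) (@ler01 R)).
exists (2 * B); first exact: mulr_ge0.
move=> N k N0 k0 kN.
have nN0 : 0 < N%:R :> R by rewrite ltr0n.
pose h : R := N%:R^-1; have h0 : 0 < h by rewrite invr_gt0.
have h1 : h <= 1 by rewrite invf_le1 // ler1n.
have nh : nrm (h%:C%C : C) = h by rewrite nrm_real gtr0_norm.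
have d0 : expdec B1 (fun t => gauss mu (z + t%:C%C)).
  by apply: H1; rewrite lerDl.
have dp : expdec B1 (fun t => gauss mu (z + h%:C%C + t%:C%C)).
  by apply: H1; apply: le_trans (nrmD _ _) _; rewrite nh lerD2l.
have dm : expdec B1 (fun t => gauss mu (z - h%:C%C + t%:C%C)).
  by apply: H1; apply: le_trans (nrmB _ _) _; rewrite nh lerD2l.
set A := fcoef N z k.
pose a m := gauss mu (z + (rpt R N m)%:C%C) * fchar k (rpt R N m).
have ha : zgeo (rratio R N) B1 a by exact: (expdec_zgeo N0 (expdec_fchar k d0)).
pose om := cexp ('i * (2 * pi * k%:~R * h)%:C%C : C).
have omE : fchar k (- h) = om by rewrite fcharN.
have omV : fchar k h = om^-1 by rewrite /fchar cexpN.
have nom : nrm om = 1 by rewrite /om nrm_cexp_i.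
have Ep : rsum N (fun t => gauss mu (z + h%:C%C + t%:C%C) * fchar k t) = om * A.
  rewrite /A /fcoef /rsum mulrCA; congr (_ * _).
  rewrite -(bisum_shift (rratio_itv _ N0) B10 ha).
  have ha' : zgeo (rratio R N) B1 (fun m => om^-1 * (om * a (m + 1))).
    move=> m; rewrite mulrA mulVf ?mul1r; last exact: cexp_neq0.
    rewrite /a rptS // rmorphD addrA nrmM nrm_fchar mulr1.
    exact: (expdec_zgeo N0 dp m).
  have ha2 : zgeo (rratio R N) B1 (fun m => a (m + 1)).
    by move=> m; have := ha' m; rewrite mulrA mulVf ?mul1r //; exact: cexp_neq0.
  rewrite -(bisumZ om (rratio_itvW _ N0) B10 ha2); apply: eq_bisum => m.
  rewrite /a rptS // rmorphD addrA fcharD -/h omV.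
  have om0 : om != 0 by exact: cexp_neq0.
  by move: (gauss _ _) (fchar _ _) (om) om0 => u v o o0; field.
have Em : rsum N (fun t => gauss mu (z - h%:C%C + t%:C%C) * fchar k t) = om^-1 * A.
  rewrite /A /fcoef /rsum mulrCA; congr (_ * _).
  pose b m := gauss mu (z - h%:C%C + (rpt R N m)%:C%C) * fchar k (rpt R N m).
  have hb : zgeo (rratio R N) B1 b by exact: (expdec_zgeo N0 (expdec_fchar k dm)).
  rewrite -(bisum_shift (rratio_itv _ N0) B10 hb).
  rewrite -(bisumZ om^-1 (rratio_itvW _ N0) B10 ha); apply: eq_bisum => m.
  by rewrite /b rptS // rmorphD addrA subrK fcharD -/h omV mulrCA.
pose Y t : C := (gauss_rem mu h%:C%C (z + t%:C%C) + gauss_rem mu (- h%:C%C) (z + t%:C%C)) * fchar k t.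
have YE t : Y t = (gauss mu (z + h%:C%C + t%:C%C) * fchar k t +
   gauss mu (z - h%:C%C + t%:C%C) * fchar k t) + (-2) * (gauss mu (z + t%:C%C) * fchar k t).
  rewrite /Y /gauss_rem -[z + h%:C%C + _]addrAC -[z - h%:C%C + _]addrAC.
  move: (gauss _ _) (gauss _ _) (gauss _ _) => u v w; ring.
have E : rsum N Y = (om + om^-1 - 2) * A.
  have -> : Y = fun t => (gauss mu (z + h%:C%C + t%:C%C) * fchar k t +
   gauss mu (z - h%:C%C + t%:C%C) * fchar k t) + (-2) * (gauss mu (z + t%:C%C) * fchar k t).
    exact/funext.
  have cp := expdec_fchar k dp; have cm := expdec_fchar k dm; have c0 := expdec_fchar k d0.
  rewrite (rsumD N0 _ _ (expdecD cp cm) (expdecZ (-2) c0)) ?addr_ge0 ?mulr_ge0 ?nrm_ge0 //.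
  rewrite (rsumD N0 B10 B10 cp cm) (rsumZ _ N0 B10 c0) Ep Em -/(fcoef N z k) -/A; ring.
have hY : nrm (rsum N Y) <= 4 * (2 * B * h ^+ 2).
  apply: rsum_bound => //; first by apply: mulr_ge0; [exact: mulr_ge0 | exact: sqr_ge0].
  move=> t; rewrite /Y nrmM nrm_fchar mulr1; apply: le_trans (nrmD _ _) _.
  have b1 := HB h%:C%C z t (lexx _); rewrite nh in b1.
  have b2 := HB (- h%:C%C) z t (lexx _); rewrite nrmN nh in b2.
  have -> : 2 * B * h ^+ 2 * expR (- `|t|) =
    B * h ^+ 2 * expR (- `|t|) + B * h ^+ 2 * expR (- `|t|) by ring.
  by apply: lerD; [exact: b1 | exact: b2].
have kk0 : 0 < (k%:~R : R) ^+ 2 by rewrite exprn_even_gt0 //= intr_eq0.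
have hlow : 4 * (k%:~R ^+ 2 * h ^+ 2) <= nrm (om + om^-1 - 2).
  rewrite /om -cexpN nrm_second_diff.
  have pi2 : 2 <= (pi : R) by exact: pi_ge2.
  have ypi : `|2 * pi * k%:~R * h| <= pi.
    rewrite !normrM [`|2|]ger0_norm // [`|pi|]ger0_norm ?pi_ge0 // [`|h|]gtr0_norm //.
    have -> : 2 * pi * `|k%:~R| * h = pi * ((2 * `|k%:~R|) / N%:R) by rewrite /h; ring.
    rewrite ler_piMr ?pi_ge0 // ler_pdivrMr // mul1r -intr_norm -abszE.
    by rewrite -[(Posz _)%:~R]/(_%:R) -natrM ler_nat.
  have := one_sub_cos_lower ypi.
  have -> : (2 * pi * k%:~R * h) ^+ 2 / 8 = pi ^+ 2 * (k%:~R ^+ 2 * h ^+ 2) / 2 by field.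
  have : 4 <= (pi : R) ^+ 2 by nra.
  have : 0 <= k%:~R ^+ 2 * h ^+ 2 :> R by apply: mulr_ge0; exact: sqr_ge0.
  nra.
rewrite ler_pdivlMr //.
rewrite E nrmM in hY.
have hh0 : 0 < h ^+ 2 by rewrite exprn_gt0.
have A0 := nrm_ge0 A.
have : 4 * (k%:~R ^+ 2 * h ^+ 2) * nrm A <= 4 * (2 * B * h ^+ 2).
  by apply: le_trans hY; rewrite ler_wpM2r.
have -> : 4 * (k%:~R ^+ 2 * h ^+ 2) * nrm A = (4 * h ^+ 2) * (nrm A * k%:~R ^+ 2) by ring.
have -> : 4 * (2 * B * h ^+ 2) = (4 * h ^+ 2) * (2 * B) by ring.
by rewrite ler_pM2l // mulr_gt0.
Qed.

End FourierCoefficients.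

(** * Passage to the limit in the number of samples *)

Section Poisson.

Local Open Scope classical_set_scope.

Variable R : realType.
Local Notation C := (CC R).
Implicit Types (z w e d : C) (x y t rho : R) (N n : nat) (k m : int).

Lemma Re_inv_gt0 z : 0 < complex.Re z -> 0 < complex.Re z^-1.
Proof.
case: z => a b /= a0; rewrite divr_gt0 //.
by rewrite ltr_pwDl ?sqr_ge0 // exprn_gt0.
Qed.

Lemma expRN1_itv : 0 < (expR (-1) : R) < 1.
Proof. by rewrite expR_gt0 /= -[ltRHS]expR0 ltr_expR oppr_lt0 ltr01. Qed.

Lemma expRN1_itvW : 0 <= (expR (-1) : R) < 1.
Proof. by have /andP [/ltW -> ->] := expRN1_itv. Qed.

Lemma expRN1_pow n : (0 < n)%N -> (expR (-1) : R) ^+ n <= n%:R^-1.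
Proof.
move=> n0; rewrite -expRM_natl mulrN1 expRN.
have nn : 0 < n%:R :> R by rewrite ltr0n.
rewrite lef_pV2 ?posrE ?expR_gt0 //.
by apply: le_trans (expR_ge1Dx _); rewrite lerDr.
Qed.

Lemma natr_inv_small x y : 0 <= x -> 0 < y -> exists n0, forall n, (n0 <= n)%N ->
  x / n.+1%:R <= y.
Proof.
move=> x0 y0; have xy : 0 <= x / y by rewrite divr_ge0 // ltW.
exists (Num.bound (x / y)) => n hn.
have h := archi_boundP xy.
rewrite ler_pdivrMr ?ltr0n // mulrC -ler_pdivrMr //.
apply: (le_trans (ltW h)); rewrite ler_nat; exact: leqW.
Qed.

Variable mu : C.
Hypothesis mu_gt0 : 0 < complex.Re mu.

Definition gsum z : C := bisum (fun m => gauss mu (z + m%:~R)).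
Definition hsum z : C := bisum (fgauss mu z).

Lemma fgauss_zgeo z : exists2 B : R, 0 <= B & zgeo (expR (-1)) B (fgauss mu z).
Proof.
pose a := (pi : R) * complex.Re mu^-1.
have a0 : 0 < a by rewrite mulr_gt0 ?pi_gt0 ?Re_inv_gt0.
pose b := 2 * pi * nrm z + 1.
exists (expR (b ^+ 2 / (4 * a))); first exact: expR_ge0.
move=> k; rewrite /fgauss nrm_cexp -expRM_natl -expRD ler_expR raddfD /=.
set s : R := `|k|%:R.
have s0 : 0 <= s by rewrite ler0n.
have ks : k%:~R ^+ 2 = ((s ^+ 2)%:C%C : C).
  rewrite rmorphXn rmorph_nat /=.
  have -> : `|k|%:R = (`|k|)%:~R :> C by rewrite -abszE.
  by have [k0|k0] := leP 0 k; [rewrite ger0_norm | rewrite ltr0_norm // rmorphN sqrrN].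
have -> : - (pi : R)%:C%C * mu^-1 * k%:~R ^+ 2 = ((- (pi * s ^+ 2))%:C%C : C) * mu^-1.
  by rewrite ks rmorphN rmorphM /=; ring.
rewrite ReZ.
have h : complex.Re (2 * ('i * (pi : R)%:C%C) * k%:~R * z) <= 2 * pi * s * nrm z.
  apply: le_trans (nrm_Re_le _) _.
  rewrite (nrmM _ z) (nrmM _ k%:~R) (nrmM 2) (nrmM 'i) (nrm_nat _ 2) nrm_i nrm_real mul1r.
  rewrite ger0_norm ?pi_ge0 // le_eqVlt; apply/orP; left; apply/eqP; congr (_ * _ * _).
  by rewrite -(rmorph_int (real_complex R)) nrm_real -intr_norm -abszE.
have key : b * s <= b ^+ 2 / (4 * a) + a * s ^+ 2.
  have : 0 <= (b / (2 * a) - s) ^+ 2 * a by rewrite mulr_ge0 ?sqr_ge0 // ltW.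
  have -> : (b / (2 * a) - s) ^+ 2 * a = b ^+ 2 / (4 * a) - b * s + a * s ^+ 2.
    by field; rewrite gt_eqF.
  lra.
have e2 : - (pi * s ^+ 2) * complex.Re mu^-1 = - (a * s ^+ 2) by rewrite /a; ring.
have e3 : b * s = 2 * pi * s * nrm z + s by rewrite /b; ring.
rewrite e2 mulrN1; rewrite e3 in key; lra.
Qed.

Lemma riem0_bounded : exists2 B : R, 0 <= B & forall N, (0 < N)%N -> nrm (riem mu N 0) <= B.
Proof.
have [B B0 H] := gauss_expdec mu_gt0 (lexx 0).
exists (4 * B); first exact: mulr_ge0.
by move=> N N0; apply: rsum_bound => //; apply: H; rewrite nrm0.
Qed.

Lemma psumS (f : int -> C) n : psum f n.+1 = psum f n + (f (Posz n) + f (Negz n)).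
Proof. by rewrite /psum !big_ord_recr addrACA. Qed.

(** For finitely many frequencies the translations in [fcoef_exact] are bounded, so all these
    Riemann sums may be replaced by the one at 0. *)
Lemma fcoef_head z L : exists2 S : R, 0 <= S & forall N, (0 < N)%N ->
  nrm (psum (fcoef mu N z) L - riem mu N 0 * psum (fgauss mu z) L) <= S / N%:R.
Proof.
elim: L => [|L [S S0 IH]].
  by exists 0 => // N N0; rewrite /psum !big_ord0 addr0 mulr0 subrr nrm0 mul0r.
have one k : exists2 S1 : R, 0 <= S1 & forall N, (0 < N)%N ->
    nrm (fcoef mu N z k - riem mu N 0 * fgauss mu z k) <= S1 / N%:R.
  have [K K0 HK] := riem_total mu_gt0 0 (z + 'i * k%:~R / mu).
  exists (nrm (fgauss mu z k) * K); first by rewrite mulr_ge0 ?nrm_ge0.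
  move=> N N0; rewrite fcoef_exact // [riem mu N 0 * _]mulrC -mulrBr.
  rewrite (nrmM (fgauss mu z k)); have h := HK N N0; rewrite add0r in h.
  by apply: le_trans (ler_wpM2l (nrm_ge0 _) h) _; rewrite mulrA.
have [S1 S10 H1] := one (Posz L); have [S2 S20 H2] := one (Negz L).
exists (S + (S1 + S2)); first by rewrite !addr_ge0.
move=> N N0; rewrite !psumS.
set x := psum _ L; set y := psum _ L; set r := riem mu N 0.
set a := fcoef mu N z _; set b := fcoef mu N z _; set c := fgauss mu z _; set d := fgauss mu z _.
have -> : x + (a + b) - r * (y + (c + d)) = (x - r * y) + ((a - r * c) + (b - r * d)) by ring.
apply: le_trans (nrmD _ _) _; rewrite mulrDl; apply: lerD; first exact: IH.
by apply: le_trans (nrmD _ _) _; rewrite mulrDl; apply: lerD; [exact: H1 | exact: H2].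
Qed.

(** Telescoping with [1 / j ^ 2 <= 1 / (j - 1) - 1 / j], uniformly in [n]; starting at [L.+2] keeps
    [j - 1] positive. *)
Lemma fcoef_tail z : exists2 B : R, 0 <= B & forall L n, (L.+2 <= n)%N ->
  nrm (psum (fcoef mu (n + n) z) n - psum (fcoef mu (n + n) z) L.+2) <= B / L.+1%:R.
Proof.
have [B B0 H] := fcoef_bound mu_gt0 z.
exists (2 * B); first exact: mulr_ge0.
move=> L n Ln; have n0 : (0 < n)%N by move: Ln; lia.
set F := fcoef mu (n + n) z.
have N0 : (0 < n + n)%N by rewrite addn_gt0 n0.
suff : forall j, (L.+2 <= j <= n)%N ->
    nrm (psum F j - psum F L.+2) <= 2 * B * (L.+1%:R^-1 - (j.-1)%:R^-1).
  move=> /(_ n); rewrite Ln leqnn => /(_ isT) h; apply: le_trans h _.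
  by rewrite ler_wpM2l ?mulr_ge0 // gerBl invr_ge0.
elim=> [//|j IH] /andP [Lj jn].
move: Lj; rewrite leq_eqVlt => /orP [/eqP <-|Lj].
  by rewrite subrr nrm0 /= subrr mulr0.
have Lj' : (L.+2 <= j <= n)%N by move: Lj jn; lia.
have {}IH := IH Lj'.
rewrite psumS.
have -> : psum F j + (F (Posz j) + F (Negz j)) - psum F L.+2 =
    (psum F j - psum F L.+2) + (F (Posz j) + F (Negz j)) by ring.
apply: le_trans (nrmD _ _) _.
have j2 : (1 < j)%N by move: Lj; lia.
have jp : 0 < j%:R :> R by rewrite ltr0n ltnW.
have bp : nrm (F (Posz j)) <= B / j%:R ^+ 2.
  have := H (n + n)%N (Posz j) N0; rewrite -[(Posz j)%:~R]/(j%:R : R); apply; lia.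
have bn : nrm (F (Negz j)) <= B / j%:R ^+ 2.
  have h := H (n + n)%N (Negz j) N0; apply: le_trans (h _ _) _; try lia.
  have -> : (Negz j)%:~R ^+ 2 = j.+1%:R ^+ 2 :> R by rewrite NegzE mulrNz sqrrN.
  rewrite ler_wpM2l // lef_pV2 ?posrE ?exprn_gt0 ?ltr0n //; last exact: ltnW.
  by rewrite lerXn2r ?nnegrE ?ler0n // ler_nat.
have j1 : 0 < (j.-1)%:R :> R by rewrite ltr0n; lia.
have jE : j%:R = (j.-1)%:R + 1 :> R by rewrite natr1 prednK // ltnW.
have tele : (j%:R ^+ 2)^-1 <= (j.-1)%:R^-1 - j%:R^-1 :> R.
  rewrite -subr_ge0 (_ : _ - _ = ((j.-1)%:R * j%:R ^+ 2)^-1).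
    by rewrite invr_ge0 mulr_ge0 ?exprn_ge0 // ltW.
  have nz1 : (j.-1)%:R != 0 :> R by rewrite gt_eqF.
  have nz2 : (j.-1)%:R + 1 != 0 :> R by rewrite -jE gt_eqF.
  by rewrite jE; field; rewrite nz1 nz2.
have hs := nrmD (F (Posz j)) (F (Negz j)).
have : B / j%:R ^+ 2 <= B * ((j.-1)%:R^-1 - j%:R^-1) by rewrite ler_wpM2l.
rewrite /= in IH *; move: IH bp bn hs.
set u := nrm _; set v := nrm _; set v1 := nrm _; set v2 := nrm _.
set X := B / _; set Y := (j.-1)%:R^-1; set Z := j%:R^-1; set V := (L.+1)%:R^-1.
nra.
Qed.

(** Three errors of size [y / 3]: the tail of the discrete coefficients, the finitely many low
    frequencies, and the tail of [hsum]. The cutoff is chosen first, then the number of samples. *)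
Lemma poisson_approx z y : 0 < y -> exists n0, forall n, (n0 <= n)%N ->
  nrm (gsum z - riem mu (n.+1 + n.+1) 0 * hsum z) <= y.
Proof.
move=> y0; have y3 : 0 < y / 3 by rewrite divr_gt0.
have [Bt Bt0 Ht] := fcoef_tail z.
have [Bh Bh0 Hh] := fgauss_zgeo z.
have [Br Br0 Hr] := riem0_bounded.
pose M := Br * (2 * (Bh / (1 - expR (-1)))).
have /andP [e0 e1] := expRN1_itv.
have M0 : 0 <= M.
  by rewrite mulr_ge0 // mulr_ge0 // divr_ge0 // subr_ge0 ltW.
have [L1 HL1] := natr_inv_small Bt0 y3.
have [L2 HL2] := natr_inv_small M0 y3.
pose L := maxn L1 L2.
have [S S0 HS] := fcoef_head z L.+2.
have [n1 Hn1] := natr_inv_small S0 y3.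
exists (maxn n1 L.+2) => n; rewrite geq_max => /andP [n1n Ln].
set N := (n.+1 + n.+1)%N; have N0 : (0 < N)%N by [].
rewrite /gsum -(fcoef_sum mu_gt0 z (ltn0Sn n)) -/N.
have t1 : nrm (psum (fcoef mu N z) n.+1 - psum (fcoef mu N z) L.+2) <= y / 3.
  have h := Ht L n.+1 (ltnW (Ln : (L.+2 < n.+1)%N)).
  by apply: le_trans h _; apply: HL1; exact: leq_maxl.
have t2 : nrm (psum (fcoef mu N z) L.+2 - riem mu N 0 * psum (fgauss mu z) L.+2) <= y / 3.
  apply: le_trans (HS N N0) _; apply: le_trans (Hn1 n n1n).
  by rewrite ler_wpM2l // lef_pV2 ?posrE ?ltr0n // ler_nat leq_addr.
have t3 : nrm (riem mu N 0 * (psum (fgauss mu z) L.+2 - hsum z)) <= y / 3.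
  rewrite nrmM.
  have h := bisum_approx L.+2 expRN1_itvW Bh0 Hh.
  apply: le_trans (ler_pM (nrm_ge0 _) (nrm_ge0 _) (Hr N N0) h) _.
  have h2 := ler_wpM2l M0 (expRN1_pow (ltn0Sn L.+1)).
  rewrite (mulrA Br); apply: (le_trans h2); apply: HL2; apply: leqW; exact: leq_maxr.
set a := psum _ n.+1 in t1 *; set b := psum _ L.+2 in t1 t2.
set c := psum (fgauss mu z) _ in t2 t3; set r := riem mu N 0 in t2 t3 *.
have -> : a - r * hsum z = (a - b) + ((b - r * c) + r * (c - hsum z)) by ring.
apply: le_trans (nrmD _ _) _; have := nrmD (b - r * c) (r * (c - hsum z)); lra.
Qed.

(** Cross multiplication eliminates the Riemann sum at 0, so its limit need not be identified. *)
Lemma poisson_proportional z w : gsum z * hsum w = gsum w * hsum z.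
Proof.
apply/eqP; rewrite -subr_eq0; apply/eqP/nrm_eq0/le_anti; rewrite nrm_ge0 andbT.
apply/ler_addgt0Pr => y y0; rewrite add0r.
pose s := nrm (hsum z) + nrm (hsum w) + 1.
have s0 : 0 < s by rewrite ltr_wpDl // addr_ge0 ?nrm_ge0.
have ys : 0 < y / s by rewrite divr_gt0.
have [n1 H1] := poisson_approx z ys; have [n2 H2] := poisson_approx w ys.
pose n := maxn n1 n2.
have h1 := H1 n (leq_maxl _ _); have h2 := H2 n (leq_maxr _ _).
set r := riem mu _ 0 in h1 h2.
have -> : gsum z * hsum w - gsum w * hsum z =
  (gsum z - r * hsum z) * hsum w + - ((gsum w - r * hsum w) * hsum z) by ring.
apply: le_trans (nrmD _ _) _; rewrite nrmN !nrmM.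
have p1 := ler_wpM2r (nrm_ge0 (hsum w)) h1; have p2 := ler_wpM2r (nrm_ge0 (hsum z)) h2.
have -> : y = y / s * (nrm (hsum z) + nrm (hsum w) + 1) by rewrite -/s divfK // gt_eqF.
have := nrm_ge0 (hsum z); lra.
Qed.

End Poisson.

(** * Theta functions *)

Section ThetaFunctions.

Local Open Scope classical_set_scope.

Variable R : realType.
Local Notation C := (CC R).
Implicit Types (z w mu : C) (c t : R) (k m : int) (b : int -> C).

Definition tlam c m : C := (- (pi * (m%:~R + c) ^+ 2))%:C%C.

Definition half_range c : Prop := 0 <= c <= 2^-1.

Lemma half_range0 : half_range 0.
Proof. by rewrite /half_range lexx invr_ge0 ler0n. Qed.

Lemma half_range_half : half_range 2^-1.
Proof. by rewrite /half_range invr_ge0 ler0n lexx. Qed.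

(** A linear lower bound turns Gaussian decay into the geometric decay demanded by [zgeo]; it covers
    the shifts 0 and 1/2 at once. *)
Lemma sq_shift_ge c m : half_range c -> (`|m|%N)%:R - 1 <= (m%:~R + c) ^+ 2 :> R.
Proof.
move=> /andP [c0 c1]; case: m => n.
  rewrite -[(Posz n)%:~R]/(n%:R : R) /=.
  have n0 : 0 <= n%:R :> R by rewrite ler0n.
  nra.
rewrite NegzE mulrNz -[(Posz n.+1)%:~R]/(n.+1%:R : R) /=.
have n0 : 1 <= n.+1%:R :> R by rewrite ler1n.
have c2 : c * 2 <= 1 by rewrite -ler_pdivlMr // mul1r.
nra.
Qed.

Lemma dsummable_theta b c z : half_range c -> (forall m, nrm (b m) = 1) ->
  0 < complex.Re z -> dsummable b (tlam c) z.
Proof.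
move=> hc hb z0.
pose a := pi * (complex.Re z / 2).
have a0 : 0 < a by rewrite mulr_gt0 ?pi_gt0 // divr_gt0.
exists (expR (- a)), (complex.Re z / 2), (expR a); split.
- by rewrite expR_ge0 -[ltRHS]expR0 ltr_expR oppr_lt0.
- by rewrite divr_gt0.
- exact: expR_ge0.
move=> m; rewrite hb mul1r -expRM_natl -!expRD ler_expR ReZ nrm_real normrN.
have s0 : 0 <= pi * (m%:~R + c) ^+ 2 :> R by rewrite mulr_ge0 ?pi_ge0 ?sqr_ge0.
rewrite ger0_norm //.
have h := ler_wpM2l (ltW a0) (sq_shift_ge m hc).
rewrite /a in h *; move: h; set s := (_ + c) ^+ 2; set n : R := _%:R; nra.
Qed.

Lemma tlam_half m : - (pi : R)%:C%C * (m%:~R + 2^-1) ^+ 2 = tlam 2^-1 m.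
Proof.
by rewrite /tlam rmorphN rmorphM rmorphXn (rmorphD _ m%:~R) rmorph_int fmorphV rmorph_nat mulNr.
Qed.

Lemma tlam_zero m : - (pi : R)%:C%C * m%:~R ^+ 2 = tlam 0 m.
Proof. by rewrite /tlam addr0 rmorphN rmorphM rmorphXn rmorph_int mulNr. Qed.

Lemma theta2E : theta 2 = dsum (fun=> 1) (tlam 2^-1) :> (C -> C).
Proof.
by apply/funext => z; apply: eq_bisum => m; rewrite (mul1r (cexp _)) -tlam_half.
Qed.

Lemma theta3E : theta 3 = dsum (fun=> 1) (tlam 0) :> (C -> C).
Proof.
by apply/funext => z; apply: eq_bisum => m; rewrite (mul1r (cexp _)) -tlam_zero.
Qed.

Lemma theta4E : theta 4 = dsum (fun m => (-1) ^ m) (tlam 0) :> (C -> C).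
Proof. by apply/funext => z; apply: eq_bisum => m; rewrite -tlam_zero. Qed.

Lemma nrm_sign m : nrm ((-1) ^ m : C) = 1.
Proof.
case: m => n; first by rewrite -exprnP nrmX nrmN nrm1 expr1n.
by rewrite NegzE -exprnN nrmV nrmX nrmN nrm1 expr1n invr1.
Qed.

Definition half_plane : set C := [set z | 0 < complex.Re z].

Lemma open_half_plane : open half_plane.
Proof.
rewrite openE => z z0; apply/nbhs_ballP; exists ((complex.Re z)%:C%C) => /=.
  by rewrite ltcR.
move=> w; rewrite /ball /= nrmE ltcR => h.
have := nrm_Re (z - w); rewrite raddfB /= => h2.
have := ler_norm (complex.Re z - complex.Re w); rewrite /half_plane /=; lra.
Qed.

Lemma theta_dsum j : (2 <= j <= 4)%N -> exists b c, [/\ half_range c,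
  forall m, nrm (b m) = 1 & theta j = dsum b (tlam c) :> (C -> C)].
Proof.
move: j => [|[|[|[|[|j]]]]] // _.
- exists (fun=> 1), 2^-1; split; [exact: half_range_half|by move=> m; exact: nrm1|exact: theta2E].
- exists (fun=> 1), 0; split; [exact: half_range0|by move=> m; exact: nrm1|exact: theta3E].
- exists (fun m => (-1) ^ m), 0.
  by split; [exact: half_range0|exact: nrm_sign|exact: theta4E].
Qed.

Lemma theta_smooth j : (2 <= j <= 4)%N -> smooth_on half_plane (@theta R j).
Proof.
move=> /theta_dsum [b [c [hc hb ->]]]; apply: dsum_smooth; first exact: open_half_plane.
by move=> z z0; exact: dsummable_theta.
Qed.

Lemma is_derive_cexp z : is_derive z (1 : C) (@cexp R) (cexp z).
Proof.
apply: (@is_derive_quadratic _ _ _ _ (nrm (cexp z) * (4 * expR 1)) 1) => // h h1.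
have -> : cexp (h + z) - cexp z - h * cexp z = cexp z * (cexp h - 1 - h).
  rewrite cexpD; ring.
rewrite (nrmM (cexp z)) -mulrA ler_wpM2l ?nrm_ge0 //.
apply: le_trans (nrm_cexp_taylor1 h) _; rewrite mulrAC ler_wpM2r ?exprn_ge0 ?nrm_ge0 //.
by rewrite ler_wpM2l // ler_expR.
Qed.

Lemma is_derive_linear (a z : C) : is_derive z (1 : C) (fun x : C => a * x) a.
Proof.
have h := is_derive_mul (is_derive_cst a z (1 : C)) (is_derive_id z (1 : C)).
by apply: (is_derive_eq h); rewrite mul0r add0r mulr1.
Qed.

Lemma is_derive_gauss mu z : is_derive z (1 : C) (gauss mu)
  (- (2 * (pi : R)%:C%C * mu) * z * gauss mu z).
Proof.
pose a : C := - (pi : R)%:C%C * mu.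
have h1 := is_derive_mul (is_derive_id z (1 : C)) (is_derive_linear a z).
have h2 := is_derive_comp h1 (is_derive_cexp _).
have E : gauss mu = (fun x : C => cexp (x * (a * x))).
  by apply/funext => x; rewrite /gauss -/a; congr cexp; ring.
rewrite E; apply: (is_derive_eq h2); rewrite /a; ring.
Qed.

Section Inversion.

Variable mu : C.
Hypothesis mu_gt0 : 0 < complex.Re mu.

Local Notation piC := ((pi : R)%:C%C : C).

(** Coefficients and exponents that make both Poisson sums, near the point [c], Dirichlet sums in
    [z], up to the factor [gauss mu z] for [gsum]. *)
Definition gcoef c m : C := gauss mu (c%:C%C + m%:~R).
Definition glam c m : C := - (2 * piC * mu) * (c%:C%C + m%:~R).
Definition hlam k : C := 2 * ('i * piC) * k%:~R.

Lemma nrm_int m : nrm (m%:~R : C) = (`|m|%N)%:R.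
Proof. by rewrite -(rmorph_int (real_complex R)) nrm_real -intr_norm -abszE. Qed.

Lemma gcoef_summable c z : dsummable (gcoef c) (glam c) z.
Proof.
(* [|glam c m| (|z| + 1)] is linear in [|c + m|], so the Gaussian absorbs it; the 1 provides the
   margin [r = 1]. *)
pose kap := nrm (2 * piC * mu) * (nrm z + 1).
have kap0 : 0 <= kap by rewrite mulr_ge0 ?addr_ge0 ?nrm_ge0.
have [B B0 H] := gauss_bound mu_gt0 (lexx 0) kap0.
exists (expR (-1)), 1, (B * expR `|c|); split => //.
- exact: expRN1_itvW.
- by rewrite mulr_ge0 ?expR_ge0.
move=> m; pose t : R := c + m%:~R.
have tE : c%:C%C + m%:~R = t%:C%C :> C by rewrite /t (rmorphD _ c) rmorph_int.
have := H 0 t; rewrite nrm0 => /(_ (lexx 0)); rewrite add0r => Ht.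
have lE : nrm (glam c m) = nrm (2 * piC * mu) * `|t|.
  by rewrite /glam tE (nrmM _ t%:C%C) nrmN nrm_real.
apply: le_trans (_ : nrm (gauss mu t%:C%C) * expR (kap * `|t|) <= _).
  rewrite /gcoef tE -mulrA ler_wpM2l ?nrm_ge0 // -expRD ler_expR.
  rewrite mul1r /kap [leRHS]mulrAC -lE mulrDr mulr1 lerD2r.
  by apply: le_trans (nrm_Re_le _) _; rewrite (nrmM (glam c m)).
apply: (le_trans Ht); rewrite -mulrA ler_wpM2l // -expRM_natl -expRD ler_expR.
rewrite mulrN1 -lerBlDr opprK.
have : `|m%:~R : R| <= `|c| + `|t|.
  have -> : m%:~R = - c + t by rewrite /t addKr.
  by apply: le_trans (ler_normD _ _) _; rewrite normrN.
by rewrite -intr_norm -abszE; lra.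
Qed.

Lemma gsumE c z : gsum mu (c%:C%C + z) = gauss mu z * dsum (gcoef c) (glam c) z.
Proof.
have [q [r [B [qq r0 B0 H]]]] := gcoef_summable c z; have /andP [q0 _] := qq.
have hz : zgeo q B (fun m => gcoef c m * cexp (glam c m * (0 + z))).
  by apply: (dsummable_zgeo q0 r0 H); rewrite nrm0 ltW.
rewrite add0r in hz; rewrite /dsum -(bisumZ (gauss mu z) qq B0 hz).
apply: eq_bisum => m.
have -> : c%:C%C + z + m%:~R = c%:C%C + m%:~R + z by rewrite addrAC.
rewrite gauss_add -/(gcoef c m).
have -> : cexp (- piC * mu * (2 * (c%:C%C + m%:~R) * z + z ^+ 2)) =
    gauss mu z * cexp (glam c m * z).
  rewrite /gauss -cexpD; congr cexp; rewrite /glam; ring.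
by move: (gcoef c m) (gauss mu z) (cexp _) => x y t; ring.
Qed.

Lemma hsumE c z : hsum mu (c%:C%C + z) = dsum (fgauss mu c%:C%C) hlam z.
Proof.
apply: eq_bisum => k; rewrite /fgauss -cexpD; congr cexp; rewrite /hlam; ring.
Qed.

Lemma hcoef_summable c z : dsummable (fgauss mu c%:C%C) hlam z.
Proof.
have pi0 : 0 < (pi : R) by exact: pi_gt0.
have [B B0 H] := fgauss_zgeo mu_gt0 (c%:C%C + z).
(* Since [|hlam k| = 2 pi |k|], this margin costs [exp (|k| / 2)], half of the available decay. *)
exists (expR (- 2^-1)), (4 * pi)^-1, B; split => //.
- by rewrite expR_ge0 -[ltRHS]expR0 ltr_expR oppr_lt0 /= invr_gt0 ltr0n.
- by rewrite invr_gt0 mulr_gt0.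
move=> k; have hE : nrm (fgauss mu c%:C%C k) * expR (complex.Re (hlam k * z)) =
    nrm (fgauss mu (c%:C%C + z) k).
  rewrite -nrm_cexp -(nrmM (fgauss mu _ k)) /fgauss -cexpD; congr (nrm (cexp _)).
  rewrite /hlam; ring.
have -> : (4 * pi)^-1 * nrm (hlam k) = `|k|%:R * 2^-1.
  rewrite /hlam (nrmM _ k%:~R) (nrmM 2) (nrmM 'i) (nrm_nat _ 2) nrm_i nrm_real nrm_int.
  rewrite ger0_norm ?(ltW pi0) //; move: (gt_eqF pi0); move: (pi : R) => p p0.
  by field; rewrite p0.
rewrite hE -expRM_natl; apply: le_trans (ler_wpM2r (expR_ge0 _) (H k)) _.
rewrite -expRM_natl -mulrA -expRD ler_wpM2l // ler_expR; lra.
Qed.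

(** Proportionality at the points [c + z] and [c], differentiated twice in [z] at 0. The term
    [- 2 pi mu] is the second derivative of the factor [gauss mu z]. *)
Lemma second_derivative_identity c :
  (- (2 * piC * mu) * gsum mu c%:C%C
    + dsum (fun m => gcoef c m * glam c m * glam c m) (glam c) 0) * hsum mu c%:C%C
  = gsum mu c%:C%C * dsum (fun k => fgauss mu c%:C%C k * hlam k * hlam k) hlam 0.
Proof.
pose D := dsum (gcoef c) (glam c).
pose D1 := dsum (fun m => gcoef c m * glam c m) (glam c).
pose H1 := dsum (fun k => fgauss mu c%:C%C k * hlam k) hlam.
have dD z : is_derive z (1 : C) D (D1 z) by exact: dsum_derive (gcoef_summable c z).
have dD1 z := dsum_derive (dsummable_deriv (gcoef_summable c z)).
have dH z := dsum_derive (hcoef_summable c z).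
have dH1 z := dsum_derive (dsummable_deriv (hcoef_summable c z)).
set g0 := gsum mu c%:C%C; set h0 := hsum mu c%:C%C.
have E : (fun z => gauss mu z * D z * h0) =
    (fun z => g0 * dsum (fgauss mu c%:C%C) hlam z).
  apply/funext => z; rewrite -hsumE -/(D z) /D -gsumE; exact: poisson_proportional.
have d1 z := is_derive_mul (is_derive_mul (is_derive_gauss mu z) (dD z)) (is_derive_cst h0 z (1 : C)).
have d2 z := is_derive_mul (is_derive_cst g0 z (1 : C)) (dH z).
(* The first derivatives are compared for all [z], so that they can be differentiated again. *)
have E1 : (fun z => gauss mu z * (D1 z - 2 * piC * mu * z * D z) * h0) = (fun z => g0 * H1 z).
  apply/funext => z; have := is_derive_derive1 (d1 z).
  rewrite (E : (fun x : C => gauss mu x * D x * _) = _) (is_derive_derive1 (d2 z)).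
  rewrite /H1 /cst mul0r add0r mulr0 addr0 => ->; ring.
have g1 : gauss mu 0 = 1 by rewrite /gauss expr0n mulr0 cexp0.
have gD : D 0 = g0 by rewrite /g0 -[c%:C%C]addr0 gsumE g1 mul1r.
have dl := is_derive_linear (2 * piC * mu) 0.
have d3 := is_derive_mul (is_derive_mul (is_derive_gauss mu 0)
  (is_deriveB (dD1 0) (is_derive_mul dl (dD 0)))) (is_derive_cst h0 0 (1 : C)).
have d4 := is_derive_mul (is_derive_cst g0 0 (1 : C)) (dH1 0).
have := is_derive_derive1 d3; rewrite -[(_ - _) 0]/(D1 0 - 2 * piC * mu * 0 * D 0).
rewrite (E1 : (fun x : C => gauss mu x * _ * h0) = _) (is_derive_derive1 d4).
rewrite /cst g1 gD mul0r add0r => ->; ring.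
Qed.

End Inversion.

End ThetaFunctions.

Lemma log_of_second_derivative (K : numFieldType) (p mu x x' y y' : K) :
  p != 0 -> x != 0 -> y != 0 ->
  (- (2 * p * mu) * y - 4 * p * mu ^+ 2 * y') * x = y * (4 * p * x') ->
  x' / x = - mu ^+ 2 * (y' / y) - mu / 2.
Proof.
move=> p0 x0 y0 h; have n4 : (4 : K) != 0 by rewrite pnatr_eq0.
apply: (mulfI (_ : 4 * p * y * x != 0)); first by rewrite !mulf_neq0.
transitivity (y * (4 * p * x')); first by field.
by rewrite -h; field.
Qed.

Lemma log_inversion (K : numFieldType) (mu x y : K) : mu != 0 ->
  y = - mu^-1 ^+ 2 * x - mu^-1 / 2 -> x = - mu ^+ 2 * y - mu / 2.
Proof. by move=> m0 ->; field. Qed.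

(** * Inversion of theta functions and correspondence of their zeros *)

Section ThetaInversion.

Local Open Scope classical_set_scope.

Variable R : realType.
Local Notation C := (CC R).
Local Notation piC := ((pi : R)%:C%C : C).
Implicit Types (z w mu : C) (c t : R) (k m : int) (b : int -> C).

Section FixedTime.

Variable mu : C.
Hypothesis mu_gt0 : 0 < complex.Re mu.

(* Averaging over the points j / N extracts the coefficients of index
   divisible by N, among which the one of index 0 dominates. *)
Lemma hsum_neq0 : exists z, hsum mu z != 0.
Proof.
have [B B0 H] := fgauss_zgeo mu_gt0 0.
pose q := expR (-1) : R.
have /andP [q0 q1] := expRN1_itv R; rewrite -/q in H q0 q1.
have qq : 0 <= q < 1 by rewrite ltW.
have q1' : 0 < 1 - q by rewrite subr_gt0.
pose x := B + 2 * (B / (1 - q)).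
have x0 : 0 <= x by rewrite addr_ge0 // mulr_ge0 // divr_ge0 // ltW.
have half0 : 0 < 2^-1 :> R by rewrite invr_gt0 ltr0n.
have [n0 /(_ n0 (leqnn _)) hn] := natr_inv_small x0 half0.
pose n := n0.+1; pose N := (n + n)%N.
have N0 : (0 < N)%N by [].
apply: contrapT => h0.
have h z : hsum mu z = 0.
  by apply/eqP/negP => /negP hz; apply: h0; exists z.
pose f := fgauss mu 0.
pose wj (j : nat) : C := - ((Posz j - Posz n)%:~R / N%:R).
have fw j k : fgauss mu (wj j) k = f k * fchar (Posz j - Posz n) (rpt R N k).
  rewrite /f /fgauss /fchar -cexpD; congr cexp.
  rewrite /wj /rpt mulr0 addr0 !rmorphM !rmorphB /= !rmorph_int fmorphV !rmorph_nat.
  ring.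
have hw j : zgeo q B (fgauss mu (wj j)).
  by move=> k; rewrite fw (nrmM (f k)) nrm_fchar mulr1; exact: H.
have E : \sum_(j < N) hsum mu (wj j) =
    bisum (fun k => N%:R * (if (Posz N %| k)%Z then f k else 0)).
  apply: etrans (esym (@bisum_sum _ q B N (fun j => fgauss mu (wj j)) qq B0 _)) _ => //.
  apply: eq_bisum => k.
  under eq_bigr do rewrite fw.
  rewrite -mulr_sumr fchar_sum //; case: ifP => _; last by rewrite !mulr0.
  by rewrite mulrC.
have hg : zgeo q B (fun k => if (Posz N %| k)%Z then f k else 0).
  move=> k; case: ifP => _; first exact: H.
  by rewrite nrm0 mulr_ge0 // exprn_ge0 // ltW.
have E2 : bisum (fun k => f (Posz N * k)) = 0.
  rewrite -(bisum_multiples N0 qq B0 H); apply/eqP.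
  have Nz : N%:R != 0 :> C by rewrite pnatr_eq0.
  rewrite -(mulrI_eq0 _ (mulfI Nz)) -(bisumZ N%:R qq B0 hg) -E.
  by rewrite big1.
pose fN k := f (Posz N * k).
have qN1 : q ^+ N <= q by rewrite -[leRHS]expr1 ler_wiXn2l // ltW.
have qqN : 0 <= q ^+ N < 1 by rewrite exprn_ge0 ?(ltW q0) //= (le_lt_trans qN1).
have hN : zgeo (q ^+ N) B fN 
  by move=> k; rewrite -exprM; have := H (Posz N * k); rewrite abszM.
have := bisum_approx 1 qqN B0 hN; rewrite E2 subr0 expr1 /psum !big_ord1.
have f0 : fN 0 = 1.
  by rewrite /fN mulr0 /f /fgauss expr0n !mulr0 addr0 cexp0.
rewrite f0 => h1; have h2 := hN (Negz 0); rewrite expr1 in h2.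
have h3 : 1 <= nrm (1 + fN (Negz 0)) + nrm (fN (Negz 0)).
  by rewrite -{1}(nrm1 R) -{1}(addrK (fN (Negz 0)) 1); exact: nrmB.
have h4 : q ^+ N <= n%:R^-1.
  by apply: le_trans (expRN1_pow R N0) _; rewrite lef_pV2 ?posrE ?ltr0n // ler_nat leq_addr.
have h5 : B / (1 - q ^+ N) <= B / (1 - q).
  rewrite ler_wpM2l // lef_pV2 ?posrE // ?lerD2l ?lerN2 //.
  by rewrite (lt_le_trans q1') // lerD2l lerN2.
have h6 : x * q ^+ N <= 2^-1 by apply: le_trans hn; rewrite ler_wpM2l.
have qN0 : 0 <= q ^+ N by rewrite exprn_ge0 // ltW.
rewrite /x in h6; nra.
Qed.

(** A term-by-term identity from expanding the square; it carries nonvanishing from [hsum] at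
    [mu^-1] to [gsum] at [mu]. *)
Lemma gsum_hsum z : gsum mu z = gauss mu z * hsum mu^-1 ('i * mu * z).
Proof.
have [B B0 H] := fgauss_zgeo (Re_inv_gt0 mu_gt0) ('i * mu * z).
rewrite /hsum -(bisumZ (gauss mu z) (expRN1_itvW R) B0 H); apply: eq_bisum => m.
rewrite /gauss /fgauss -cexpD invrK; congr cexp.
have ii : 'i * 'i = -1 :> C by rewrite -expr2 sqrCi.
transitivity (- piC * mu * (z + m%:~R) ^+ 2 + 2 * piC * mu * z * m%:~R * ('i * 'i + 1)).
  by rewrite ii addNr mulr0 addr0.
ring.
Qed.

End FixedTime.

Lemma gsum_neq0 mu : 0 < complex.Re mu -> exists z, gsum mu z != 0.
Proof.
move=> mu0; have [w hw] := hsum_neq0 (Re_inv_gt0 mu0).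
exists (w / ('i * mu)); rewrite gsum_hsum // mulf_neq0 ?cexp_neq0 //.
by rewrite mulrC divfK // mulf_neq0 ?neq0Ci ?mu_neq0.
Qed.

Lemma dsumZ x b lam z : dsummable b lam z ->
  dsum (fun m => x * b m) lam z = x * dsum b lam z.
Proof.
move=> [q [r [B [qq r0 B0 H]]]]; have /andP [q0 _] := qq.
have hz : zgeo q B (fun m => b m * cexp (lam m * (0 + z))).
  by apply: (dsummable_zgeo q0 r0 H); rewrite nrm0 ltW.
rewrite add0r in hz; rewrite /dsum -(bisumZ x qq B0 hz).
by apply: eq_bisum => m; rewrite (mulrA x).
Qed.

Lemma tlamE c m : tlam c m = - piC * (c%:C%C + m%:~R) ^+ 2.
Proof. by rewrite /tlam rmorphN rmorphM rmorphXn (rmorphD _ m%:~R) rmorph_int addrC mulNr. Qed.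

Section Pair.

Variables (c : R) (b : int -> C).
Hypothesis c_range : half_range c.
Hypothesis bE : forall k, cexp (2 * ('i * piC) * k%:~R * c%:C%C) = b k.

(** For [c = 0] and [b = 1] both [A] and [B] are theta 3; for [c = 1/2] and [b k = (-1) ^ k] they
    are theta 2 and theta 4. *)
Let A := dsum (fun=> 1) (tlam c) : C -> C.
Let B := dsum b (tlam 0) : C -> C.

Lemma nrm_pair k : nrm (b k) = 1.
Proof.
rewrite -bE nrm_cexp -(rmorph_int (real_complex R)) -(rmorph_nat (real_complex R)) /=.
by rewrite !(mul0r, mulr0, mul1r, subr0, addr0, oppr0, expR0).
Qed.

Lemma gcoef_pair mu m : gcoef mu c m = 1 * cexp (tlam c m * mu).
Proof. rewrite (mul1r (cexp _)) tlamE /gcoef /gauss; congr cexp; ring. Qed.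

Lemma gsum_pair mu : gsum mu c%:C%C = A mu.
Proof. by apply: eq_bisum => m; exact: gcoef_pair. Qed.

Lemma fgauss_pair mu k : fgauss mu c%:C%C k = b k * cexp (tlam 0 k * mu^-1).
Proof. rewrite -bE -cexpD tlamE /fgauss rmorph0 add0r; congr cexp; ring. Qed.

Lemma hsum_pair mu : hsum mu c%:C%C = B mu^-1.
Proof. by apply: eq_bisum => k; exact: fgauss_pair. Qed.

(** The heat equation, term by term: [glam ^ 2 = - 4 pi mu ^ 2 tlam c] and
    [hlam ^ 2 = 4 pi tlam 0]. *)
Lemma dsum_pair_derive mu : 0 < complex.Re mu ->
  (- (2 * piC * mu) * A mu - 4 * piC * mu ^+ 2 * derive1 A mu) * B mu^-1
  = A mu * (4 * piC * derive1 B mu^-1).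
Proof.
move=> mu0; have := second_derivative_identity mu0 c; rewrite gsum_pair hsum_pair.
have sA : dsummable (fun=> 1) (tlam c) mu.
  by apply: dsummable_theta => // m; exact: nrm1.
have sB : dsummable b (tlam 0) mu^-1.
  by apply: dsummable_theta; [exact: half_range0|exact: nrm_pair|exact: Re_inv_gt0].
rewrite (is_derive_derive1 (dsum_derive sA)) (is_derive_derive1 (dsum_derive sB)).
have -> : dsum (fun m => gcoef mu c m * glam mu c m * glam mu c m) (glam mu c) 0 =
    - (4 * piC * mu ^+ 2) * dsum (fun m => 1 * tlam c m) (tlam c) mu.
  rewrite -(dsumZ _ (dsummable_deriv sA)); apply: eq_bisum => m.
  rewrite mulr0 cexp0 gcoef_pair; move: (cexp _) => e.
  rewrite tlamE /glam; ring.
have -> : dsum (fun k => fgauss mu c%:C%C k * hlam R k * hlam R k) (hlam R) 0 =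
    4 * piC * dsum (fun k => b k * tlam 0 k) (tlam 0) mu^-1.
  rewrite -(dsumZ _ (dsummable_deriv sB)); apply: eq_bisum => m.
  rewrite mulr0 cexp0 fgauss_pair; move: (cexp _) (b m) => e b0.
  have ii : 'i * 'i = -1 :> C by rewrite -expr2 sqrCi.
  rewrite tlamE /hlam rmorph0 add0r.
  transitivity (4 * piC ^+ 2 * m%:~R ^+ 2 * b0 * e * ('i * 'i)); first by ring.
  rewrite ii; ring.
move=> <-; congr (_ * _); ring.
Qed.

(** Proportionality against a point where the sum of the other kind does not vanish: without such a
    point both sides of the product formula could be 0. *)
Lemma dsum_pair_eq0 mu : 0 < complex.Re mu -> (A mu == 0) = (B mu^-1 == 0).
Proof.
move=> mu0; have P z w := poisson_proportional mu0 z w.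
apply/eqP/eqP => h0.
  have [z /negP hz] := gsum_neq0 mu0; apply/eqP/negP => /negP; rewrite -hsum_pair => hb.
  by apply: hz; have := P z c%:C%C; rewrite gsum_pair h0 mul0r => /eqP; rewrite mulf_eq0 (negPf hb) orbF.
have [z /negP hz] := hsum_neq0 mu0; apply/eqP/negP => /negP; rewrite -gsum_pair => hb.
by apply: hz; have := P c%:C%C z; rewrite hsum_pair h0 mulr0 => /eqP; rewrite mulf_eq0 (negPf hb).
Qed.

Lemma dsum_pair_log mu : 0 < complex.Re mu -> A mu != 0 ->
  derive1 B mu^-1 / B mu^-1 = - mu ^+ 2 * (derive1 A mu / A mu) - mu / 2.
Proof.
move=> mu0 A0; have B0 := A0; rewrite (dsum_pair_eq0 mu0) in B0.
apply: (log_of_second_derivative _ B0 A0 (dsum_pair_derive mu0)).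
by rewrite fmorph_eq0 gt_eqF ?pi_gt0.
Qed.

Lemma dsum_pair_log_inv mu : 0 < complex.Re mu -> B mu != 0 ->
  derive1 A mu^-1 / A mu^-1 = - mu ^+ 2 * (derive1 B mu / B mu) - mu / 2.
Proof.
move=> mu0 B0; have nu0 := Re_inv_gt0 mu0; have m0 := mu_neq0 mu0.
have A0 : A mu^-1 != 0 by rewrite (dsum_pair_eq0 nu0) invrK.
apply: (log_inversion m0); have := dsum_pair_log nu0 A0.
by rewrite invrK.
Qed.

End Pair.

End ThetaInversion.

Lemma half_shift_sq (K : numFieldType) (p m : K) :
  p * (2^-1 + m) ^+ 2 = p / 4 + p * (m * m + m).
Proof. by field. Qed.

(** * Theta functions under inversion and translation *)

Section ModularRules.

Local Open Scope classical_set_scope.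

Variable R : realType.
Local Notation C := (CC R).
Local Notation piC := ((pi : R)%:C%C : C).
Implicit Types (z mu : C) (k m : int).

Lemma cexp_pii_int k : cexp ('i * piC * k%:~R) = (-1) ^ k :> C.
Proof.
case: k => n; first by rewrite (mulrC ('i * piC)) cexp_nat cexp_pii.
by rewrite NegzE mulrNz mulrN cexpN (mulrC ('i * piC)) cexp_nat cexp_pii.
Qed.

Lemma pair_zero k : cexp (2 * ('i * piC) * k%:~R * (0 : R)%:C%C) = 1.
Proof. by rewrite rmorph0 mulr0 cexp0. Qed.

Lemma pair_half k : cexp (2 * ('i * piC) * k%:~R * (2^-1 : R)%:C%C) = (-1) ^ k.
Proof.
rewrite -cexp_pii_int fmorphV rmorph_nat; congr cexp.
transitivity ('i * piC * k%:~R * (2 / 2)); first by ring.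
by rewrite divff ?mulr1 // pnatr_eq0.
Qed.

(** The index [6 - j] exchanges 2 and 4. The case [j = 2] reads the pair (theta 2, theta 4)
    backwards. *)
Lemma theta_inversion j mu : (2 <= j <= 4)%N -> 0 < complex.Re mu ->
  (theta (6 - j) mu == 0) = (theta j mu^-1 == 0) /\
  (theta (6 - j) mu != 0 -> derive1 (theta j) mu^-1 / theta j mu^-1 =
    - mu ^+ 2 * (derive1 (theta (6 - j)) mu / theta (6 - j) mu) - mu / 2).
Proof.
move=> hj mu0; have nu0 := Re_inv_gt0 mu0.
case: j hj => [|[|[|[|[|j]]]]] // _; rewrite ?(theta2E, theta3E, theta4E).
- split; last exact (dsum_pair_log_inv (half_range_half R) pair_half mu0).
  by rewrite (dsum_pair_eq0 pair_half nu0) invrK.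
- split; last exact (dsum_pair_log (half_range0 R) pair_zero mu0).
  exact (dsum_pair_eq0 pair_zero mu0).
- split; last exact (dsum_pair_log (half_range_half R) pair_half mu0).
  exact (dsum_pair_eq0 pair_half mu0).
Qed.

Lemma sign_sq m : ((-1) ^ m : C) * (-1) ^ m = 1.
Proof.
case: m => n; first by rewrite -exprMn mulrNN mulr1 expr1n.
by rewrite NegzE -exprnN -invfM -exprMn mulrNN mulr1 expr1n invr1.
Qed.

Lemma sign_mul_self m : (-1) ^ (m * m) = (-1) ^ m :> C.
Proof.
rewrite -exprz_exp; have /eqP := sign_sq m.
rewrite -expr2 sqrf_eq1 => /orP [/eqP -> | /eqP E].
  by rewrite exp1rz.
by rewrite {1}E.
Qed.

Lemma dsum_translate b c z :
  dsum b (tlam c) (z - 'i) =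
  dsum (fun m => b m * cexp ('i * piC * (c%:C%C + m%:~R) ^+ 2)) (tlam c) z.
Proof.
apply: eq_bisum => m; rewrite -(mulrA (b m)) -cexpD; congr (_ * cexp _).
rewrite tlamE; ring.
Qed.

Definition translate_index (j : nat) : nat := if j == 2%N then 2%N else (7 - j)%N.

(** Modulo [2 pi i], the exponent [i pi (c + m) ^ 2] is [i pi m] for [c = 0], because [m ^ 2] and
    [m] have the same parity, and [i pi / 4] for [c = 1/2], because [m ^ 2 + m] is even. *)
Lemma theta_translate j : (2 <= j <= 4)%N -> exists2 x : C, x != 0 &
  forall z, 0 < complex.Re z -> theta j (z - 'i) = x * theta (translate_index j) z.
Proof.
have sg m : cexp ('i * piC * ((0 : R)%:C%C + m%:~R) ^+ 2) = (-1) ^ m.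
  by rewrite rmorph0 add0r -sign_mul_self -cexp_pii_int intrM expr2.
case: j => [|[|[|[|[|j]]]]] // _.
- rewrite -[translate_index _]/2%N; exists (cexp ('i * piC / 4)); first exact: cexp_neq0.
  move=> z z0; rewrite theta2E dsum_translate.
  rewrite -(dsumZ _ (dsummable_theta (half_range_half R) (fun=> nrm1 R) z0)).
  apply: eq_bisum => m; congr (_ * _); rewrite mulr1 mul1r.
  have -> : 'i * piC * ((2^-1 : R)%:C%C + m%:~R) ^+ 2 =
      'i * piC / 4 + 'i * piC * (m * m + m)%:~R.
    rewrite fmorphV rmorph_nat intrD intrM; exact: half_shift_sq.
  by rewrite cexpD cexp_pii_int expfzDr ?oppr_eq0 ?oner_eq0 // sign_mul_self sign_sq mulr1.
- rewrite -[translate_index _]/4%N; exists 1; first exact: oner_neq0.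
  move=> z z0; rewrite mul1r theta3E theta4E dsum_translate.
  by apply: eq_bisum => m; rewrite sg mul1r.
- rewrite -[translate_index _]/3%N; exists 1; first exact: oner_neq0.
  move=> z z0; rewrite mul1r theta3E theta4E dsum_translate.
  by apply: eq_bisum => m; rewrite sg sign_sq.
Qed.

Lemma Re_subi z : complex.Re (z - 'i) = complex.Re z.
Proof. by case: z => a b /=; rewrite oppr0 addr0. Qed.

Lemma theta_translate_log j z : (2 <= j <= 4)%N -> 0 < complex.Re z ->
  (theta (translate_index j) z == 0) = (theta j (z - 'i) == 0) /\
  derive1 (theta j) (z - 'i) / theta j (z - 'i) =
    derive1 (theta (translate_index j)) z / theta (translate_index j) z.
Proof.
move=> hj z0; have [x x0 E] := theta_translate hj.
rewrite E //; split; first by rewrite mulf_eq0 (negPf x0).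
have hj' : (2 <= translate_index j <= 4)%N.
  by case: j hj {E} => [|[|[|[|[|j]]]]].
have z1 : half_plane (z - 'i) by rewrite /half_plane /= Re_subi.
have d0 := is_deriveB (is_derive_id z (1 : C)) (is_derive_cst ('i : C) z (1 : C)).
have d1 := is_derive_comp d0 (smooth_is_derive (theta_smooth hj) z1).
have d2 := is_derive_mul (is_derive_cst x z (1 : C)) (smooth_is_derive (theta_smooth hj') (z0 : half_plane z)).
have E1 := near_derive1 (@open_half_plane R) z0 E.
have : derive1 (theta j) (z - 'i) = x * derive1 (theta (translate_index j)) z.
  have := etrans (esym (is_derive_derive1 d1)) (etrans E1 (is_derive_derive1 d2)).
  by rewrite subr0 mulr1 mul0r add0r.
move=> ->; rewrite invfM mulrACA mulfV // mul1r //.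
Qed.

End ModularRules.

(** * Modular rules for the family *)

(** The inhomogeneous term of the theta rule contributes [- z], and [(z^-1 + q)^-1 - z = - z ^ 2 (z
    + q^-1)^-1]: this is what turns [q] into [q^-1]. *)
Lemma w_invert_algebra (K : numFieldType) (q z l l' : K) : z != 0 -> q != 0 -> z^-1 + q != 0 ->
  l' = - z ^+ 2 * l - z / 2 ->
  (z^-1 + q)^-1 + 2 * l' = - z ^+ 2 * ((z + q^-1)^-1 + 2 * l).
Proof.
move=> z0 q0 zq ->; have h : q * z + 1 != 0.
  by apply: contra_neq zq => h; apply: (mulIf z0); rewrite mulrDl mulVf // addrC h mul0r.
by field; rewrite q0 z0 mulrC h.
Qed.

Lemma F_invert_algebra (K : fieldType) (q z d : K) : z != 0 -> q != 0 ->
  d * (z^-1 + q) ^+ 2 = q ^+ 2 * z ^- 2 * (d * (z + q^-1) ^+ 2).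
Proof. by move=> z0 q0; field; rewrite z0 q0. Qed.

Section FamilyRules.

Local Open Scope classical_set_scope.

Variable R : realType.
Local Notation C := (CC R).
Implicit Types (z mu q : C) (b : 'I_4) (j : nat).

Definition swap23 := swap (inord 2) (inord 3).
Definition swap13 := swap (inord 1) (inord 3).

Lemma val_swap23 b : b != ord0 -> (swap23 b).+1 = translate_index b.+1.
Proof.
rewrite /swap23 /swap /translate_index -!val_eqE /= !inordK //.
by case: b => [[|[|[|[|m]]]] hb] //= _; rewrite !inordK.
Qed.

Lemma val_swap13 b : b != ord0 -> (swap13 b).+1 = (6 - b.+1)%N.
Proof.
rewrite /swap13 /swap -!val_eqE /= !inordK //.
by case: b => [[|[|[|[|m]]]] hb] //= _; rewrite !inordK.
Qed.

Lemma theta_index b : b != ord0 -> (2 <= b.+1 <= 4)%N.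
Proof. by case: b => [[|[|[|[|m]]]] hb]. Qed.

Lemma w_translate b q z : b != ord0 -> 0 < complex.Re z ->
  w b q (z - 'i) = w (swap23 b) (q - 'i) z.
Proof.
move=> b0 z0; have [_ E] := theta_translate_log (theta_index b0) z0.
rewrite /w val_swap23 //; apply: f_equal2; first by rewrite addrAC addrA.
exact (congr1 (fun x => 2 * x) E).
Qed.

Lemma F_translate c q z : F c q (z - 'i) = F c (q - 'i) z.
Proof. by rewrite /F addrAC addrA. Qed.

Lemma w_invert b q z : b != ord0 -> 0 < complex.Re z -> q != 0 -> w_defined q z^-1 ->
  w b q z^-1 = - z ^+ 2 * w (swap13 b) q^-1 z.
Proof.
move=> b0 z0 q0 [zq hth]; have zn := mu_neq0 z0.
have [E L] := theta_inversion (theta_index b0) z0.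
have t0 := hth _ (theta_index b0); rewrite -E in t0.
rewrite /w val_swap13 //.
exact (w_invert_algebra zn q0 zq (L t0)).
Qed.

Lemma F_invert c q z : z != 0 -> q != 0 -> F c q z^-1 = q ^+ 2 * z ^- 2 * F c q^-1 z.
Proof. exact: F_invert_algebra. Qed.

Definition w_domain q : set C := [set z | 0 < complex.Re z /\ w_defined q z].

Lemma w_domain_invert q z : q != 0 -> w_domain q z^-1 -> w_domain q^-1 z.
Proof.
move=> q0 [z0 [zq hth]]; have z1 : 0 < complex.Re z by rewrite -[z]invrK Re_inv_gt0.
split=> //; split; last first.
  move=> k hk; have hk' : (2 <= 6 - k <= 4)%N by case: k hk => [|[|[|[|[|k]]]]].
  have [E _] := theta_inversion hk' z1.
  by rewrite -[k](subKn (_ : k <= 6)%N) ?E ?hth //; case/andP: hk => _ /leq_trans ->.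
have zn := mu_neq0 z1; apply: contra_neq zq => h.
have -> : z = - q^-1 by apply/eqP; rewrite -addr_eq0 h.
by rewrite invrN invrK addNr.
Qed.

Lemma w_defined_translate q z : 0 < complex.Re z -> w_defined q (z - 'i) -> w_defined (q - 'i) z.
Proof.
move=> z0 [zq hth]; split; first by rewrite addrA addrAC.
move=> k hk; have hk' : (2 <= translate_index k <= 4)%N by case: k hk => [|[|[|[|[|k]]]]].
have [E _] := theta_translate_log hk' z0.
have := hth _ hk'; rewrite -E.
by case: k hk {hk' E} => [|[|[|[|[|k]]]]].
Qed.

Lemma open_w_domain q : open (w_domain q).
Proof.
rewrite openE => z [z0 [zq hth]].
have nz (f : C -> C) : derivable f z 1 -> f z != 0 -> \forall y \near z, f y != 0.
  move=> d fz; have cz : {for z, continuous f}.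
    by apply: differentiable_continuous; exact/derivable1_diffP.
  exact: (cvgr_neq0 _ cz fz).
have ct k : (2 <= k <= 4)%N -> \forall y \near z, theta k y != 0.
  by move=> hk; apply: nz (hth k hk); exact: (theta_smooth hk (n := 0%N) z0).
have cq : \forall y \near z, y + q != 0.
  by apply: (nz (fun y => y + q)) zq; apply: derivableD; [exact: derivable_id|exact: derivable_cst].
have cR : \forall y \near z, 0 < complex.Re y.
  exact: open_nbhs_nbhs (conj (@open_half_plane R) z0).
have c2 := ct 2%N isT; have c3 := ct 3%N isT; have c4 := ct 4%N isT.
rewrite /interior /=; near=> y; split; first by near: y.
split; first by near: y.
move=> [|[|[|[|[|k]]]]] // _; near: y.
- exact: c2.
- exact: c3.
- exact: c4.
Unshelve. all: by end_near. Qed.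

Lemma w_smooth b q : b != ord0 -> smooth_on (w_domain q) (w b q).
Proof.
move=> b0; have hb := theta_index b0.
have th : smooth_on (w_domain q) (theta b.+1).
  by move=> n x [x0 _]; exact: theta_smooth.
apply: smooth_genP; first exact: open_w_domain.
apply: SmoothAdd.
  apply: SmoothInv; first by move=> x [_ []].
  by apply: SmoothAdd; apply: SmoothBase; [exact: smooth_on_id|exact: smooth_on_cst].
apply: SmoothMul; first by apply: SmoothBase; exact: smooth_on_cst.
apply: SmoothMul; first by apply: SmoothBase; exact: smooth_on_derive1.
by apply: SmoothInv; [move=> x [_ [_ h]]; exact: h|exact: SmoothBase].
Qed.

Lemma F_smooth (A : set C) c q : open A -> smooth_on A (F c q).
Proof.
move=> oA; apply: smooth_genP => //; apply: SmoothMul; first by apply: SmoothBase; exact: smooth_on_cst.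
have h : smooth_gen A (fun x : C => x + q).
  by apply: SmoothAdd; apply: SmoothBase; [exact: smooth_on_id|exact: smooth_on_cst].
exact: SmoothMul.
Qed.

End FamilyRules.

(** * Modular rules for the heat coefficients *)

Lemma w_invert_cancel (K : fieldType) (t x : K) : t != 0 ->
  - t ^+ 2 * x * - (t^-1 * t^-1) = x.
Proof. by move=> t0; field. Qed.

Lemma w_invert_cancel_sym (K : fieldType) (t x : K) : t != 0 ->
  x = - (t^-1 * t^-1) * (- t ^+ 2 * x).
Proof. by move=> t0; field. Qed.

Lemma F_invert_cancel (K : fieldType) (q t x : K) :
  q ^+ 2 * t ^- 2 * x = - q ^+ 2 * (- (t^-1 * t^-1) * x).
Proof. by rewrite -invfM; ring. Qed.

Section CoefficientRules.

Local Open Scope classical_set_scope.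

Variable R : realType.
Local Notation C := (CC R).
Implicit Types (z mu q : C) (b : 'I_4) (k n : nat) (c : R).

Lemma derive1_shift (f : C -> C) e : derive1 (fun t => f (t - e)) = (fun t => derive1 f (t - e)).
Proof.
apply/funext => t; rewrite !derive1E /derive; apply: (congr1 (fun g : C -> C => lim (g @ (0 : C)^'))).
by apply/funext => h /=; rewrite addrA.
Qed.

Lemma derive1n_shift (f : C -> C) e k t :
  derive1n k (fun t => f (t - e)) t = derive1n k f (t - e).
Proof. elim: k f => [//|k IH] f.
rewrite derive1Sn (derive1_shift f e).
by rewrite derive1Sn; exact: (IH (derive1 f)). Qed.

Lemma jet_w_translate b q mu : b != ord0 -> 0 < complex.Re mu ->
  jet (w b q) (mu - 'i) = jet (w (swap23 b) (q - 'i)) mu.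
Proof.
move=> b0 mu0; apply/funext => k; rewrite /jet -derive1n_shift.
apply: (near_derive1n k (@open_half_plane R) mu0) => z; exact: w_translate.
Qed.

Lemma jet_F_translate c q mu : jet (F c q) (mu - 'i) = jet (F c (q - 'i)) mu.
Proof.
apply/funext => k; rewrite /jet -derive1n_shift; congr (derive1n k _ mu).
by apply/funext => z; exact: F_translate.
Qed.

Lemma swap23E : [/\ swap23 (inord 1) = inord 1, swap23 (inord 2) = inord 3
  & swap23 (inord 3) = inord 2].
Proof. by rewrite /swap23 /swap -!val_eqE /= !inordK. Qed.

Lemma swap13E : [/\ swap13 (inord 1) = inord 3, swap13 (inord 2) = inord 2
  & swap13 (inord 3) = inord 1].
Proof. by rewrite /swap13 /swap -!val_eqE /= !inordK. Qed.

Lemma inord_neq0 j : (0 < j < 4)%N -> inord j != ord0 :> 'I_4.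
Proof. by case/andP=> j0 j4; rewrite -val_eqE /= inordK // -lt0n. Qed.

Lemma on_family_translate T c q mu : 0 < complex.Re mu ->
  on_family T c q (mu - 'i) =
  T (jet (w 1 (q - 'i)) mu) (jet (w 3 (q - 'i)) mu) (jet (w 2 (q - 'i)) mu)
    (jet (F c (q - 'i)) mu).
Proof.
move=> mu0; rewrite /on_family jet_F_translate.
have E (j : nat) (hj : (0 < j < 4)%N) := jet_w_translate q (inord_neq0 hj) mu0.
have [s1 s2 s3] := swap23E.
move: (E 1%N isT) (E 2%N isT) (E 3%N isT); rewrite s1 s2 s3 !inordK // => e1 e2 e3.
by rewrite e1 e2 e3.
Qed.

(** The reparametrization rule with the identity change of time and [d = 1]. Translation itself only
    re-bases the jets, so this exchange is all that it requires. *)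
Lemma heat_coef_swap23 (A : set C) n (v : 'I_4 -> C -> C) f x a : open A -> A x ->
  (forall b, b != ord0 -> smooth_on A (v b)) -> smooth_on A f ->
  is_heat_coef n (jet (v (inord 1)) x) (jet (v (inord 2)) x) (jet (v (inord 3)) x) (jet f x) a ->
  is_heat_coef n (jet (v (inord 1)) x) (jet (v (inord 3)) x) (jet (v (inord 2)) x) (jet f x) a.
Proof.
move=> oA Ax hv hf H; have [s1 s2 s3] := swap23E.
have r1 (t : C) : derive1 (fun x : C => x) t = 1 by exact: is_derive_derive1 (is_derive_id t (1 : C)).
have := @heat_coef_reparam C (inord 2) (inord 3) n v (fun b => v (swap23 b))
  f f (fun t => t) A A x 1 a.
rewrite r1 s1 s2 s3 !expr1n divr1 (mul1r 1) (mul1r a) => h.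
refine (h _ _ _ _ _ oA Ax _ _ hv hf hf _ _ H).
- exact: inord_neq0.
- exact: inord_neq0.
- by rewrite -val_eqE /= !inordK.
- exact: oner_neq0.
- exact: oner_neq0.
- by [].
- exact: smooth_on_id.
- by move=> b t b0 At; rewrite r1 mulr1 /swap23 swapK // -val_eqE /= !inordK.
- by move=> t _; rewrite r1 !mul1r.
Qed.

Lemma w_domain_inv q t : q != 0 -> w_domain q^-1 t -> w_domain q t^-1.
Proof.
move=> q0 h; rewrite -[q]invrK; apply: w_domain_invert; first by rewrite invr_eq0.
by rewrite invrK.
Qed.

(** Here [r t = t^-1] and [d = - q ^ 2]. For index 2 the powers of [d] cancel and the derivative
    [- mu ^ -2] is left. *)
Lemma heat_coef_invert c q mu a : q != 0 -> w_domain q mu^-1 ->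
  is_heat_coef 2 (jet (w 1 q) mu^-1) (jet (w 2 q) mu^-1) (jet (w 3 q) mu^-1)
    (jet (F c q) mu^-1) a ->
  is_heat_coef 2 (jet (w 1 q^-1) mu) (jet (w 2 q^-1) mu) (jet (w 3 q^-1) mu)
    (jet (F c q^-1) mu) (- mu ^- 2 * a).
Proof.
move=> q0 hmu H; have oA := @open_w_domain R q^-1; have [s1 s2 s3] := swap13E.
have AB t : w_domain q^-1 t -> w_domain q t^-1 by exact: w_domain_inv.
have A0 t : w_domain q^-1 t -> t != 0 by case=> /mu_neq0.
have r1 (t : C) : w_domain q^-1 t -> derive1 (fun x : C => x^-1) t = - (t^-1 * t^-1).
  move=> h; apply: is_derive_derive1.
  by apply: (is_derive_eq (is_derive_inv (A0 t h) (is_derive_id t (1 : C)))); rewrite mulN1r.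
have Amu := w_domain_invert q0 hmu; have m0 := A0 _ Amu.
have := @heat_coef_reparam C (inord 1) (inord 3) 2 (fun b => w b q) (fun b => w b q^-1)
  (F c q) (F c q^-1) (fun t => t^-1) (w_domain q^-1) (w_domain q) mu (- q ^+ 2) a.
rewrite r1 // divff ?mulr1; last by rewrite expf_neq0 // oppr_eq0 expf_neq0.
have -> : - (mu^-1 * mu^-1) = - mu ^- 2 by rewrite -invfM.
rewrite !inordK //; apply => //.
- exact: inord_neq0.
- exact: inord_neq0.
- by rewrite -val_eqE /= !inordK.
- by rewrite oppr_eq0 expf_neq0.
- by rewrite oppr_eq0 invr_eq0 expf_neq0.
- apply: smooth_genP => //; apply: SmoothInv => //; apply: SmoothBase; exact: smooth_on_id.
- by move=> b b0; exact: w_smooth.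
- by apply: F_smooth; exact: open_w_domain.
- exact: F_smooth.
- move=> b t b0 At; rewrite r1 //; have [_ h] := AB t At; have [t0 _] := At.
  rewrite (w_invert b0 t0 q0 h); exact: w_invert_cancel (A0 t At).
- by move=> t At; rewrite r1 // (F_invert c (A0 t At) q0); exact: F_invert_cancel.
Qed.

End CoefficientRules.

Section MainRules.

Local Open Scope classical_set_scope.

Variable R : realType.
Local Notation C := (CC R).
Implicit Types (z mu q x : C) (b : 'I_4) (k n : nat) (c : R).

(** If both sets are empty, both choices are the default 0, which is compatible with scaling;
    otherwise uniqueness in [S'] identifies the choice. *)
Lemma xget_scale (S S' : set C) x : (forall a, S a -> S' (x * a)) -> (S' !=set0 -> S !=set0) ->
  (forall a a', S' a -> S' a' -> a = a') -> xget 0 S' = x * xget 0 S.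
Proof.
move=> SS S0 uS.
have [[a Sa]|nS] := pselect (S !=set0).
  apply: uS; first by apply: (xgetPex 0); exists (x * a); exact: SS.
  by apply: SS; apply: (xgetPex 0); exists a.
have nS' : ~ (S' !=set0) by move=> h; apply: nS; exact: S0.
rewrite (xgetPN 0 (P := S')) ?(xgetPN 0 (P := S)) ?mulr0 //.
- by move=> a Sa; apply: nS; exists a.
- by move=> a Sa; apply: nS'; exists a.
Qed.

Lemma swap23_neq0 b : b != ord0 -> swap23 b != ord0.
Proof. by move=> b0; rewrite /swap23 swap_eq0 // -val_eqE /= !inordK. Qed.

(** The factor is 1, so the two sets of heat coefficients are equal: applying the exchange twice
    gives both inclusions. *)
Lemma atilde4_translate c q mu : 0 < complex.Re mu -> w_defined q (mu - 'i) ->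
  atilde4 c q (mu - 'i) = atilde4 c (q - 'i) mu.
Proof.
move=> mu0 h; rewrite /atilde4 (on_family_translate (@a4 C) c q mu0) /on_family /a4.
have hm : w_domain (q - 'i) mu by split=> //; exact: w_defined_translate.
have oA := @open_w_domain R (q - 'i).
have hF := @F_smooth R _ c (q - 'i) oA; have [s1 s2 s3] := swap23E.
have hw (b : 'I_4) (b0 : b != ord0) := @w_smooth R b (q - 'i) b0.
have H a := @heat_coef_swap23 R _ 2 (fun b => w b (q - 'i)) _ mu a oA hm hw hF.
have H' a := @heat_coef_swap23 R _ 2 (fun b => w (swap23 b) (q - 'i)) _ mu a oA hm
  (fun (b : 'I_4) (b0 : b != ord0) => hw (swap23 b) (@swap23_neq0 b b0)) hF.
have i1 : inord 1 = 1%N :> nat := @inordK 3 1 isT.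
have i2 : inord 2 = 2%N :> nat := @inordK 3 2 isT.
have i3 : inord 3 = 3%N :> nat := @inordK 3 3 isT.
rewrite s1 s2 s3 in H'; rewrite i1 i2 i3 in H H'.
by congr xget; apply/seteqP; split=> a; [exact: H'|exact: H].
Qed.

Lemma atilde4_invert c q mu : q != 0 -> w_domain q mu^-1 ->
  atilde4 c q mu^-1 = - mu ^+ 2 * atilde4 c q^-1 mu.
Proof.
move=> q0 hmu; have A1 := w_domain_invert q0 hmu; have [/mu_neq0 m0 _] := A1.
have E : atilde4 c q^-1 mu = - mu ^- 2 * atilde4 c q mu^-1.
  apply: xget_scale.
  - by move=> a; exact: heat_coef_invert.
  (* The way back is the same rule at [q^-1] and [mu^-1]. *)
  - move=> [a Sa]; exists (- mu^-1 ^- 2 * a).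
    have := @heat_coef_invert R c q^-1 mu^-1 a; rewrite !invrK invr_eq0; exact.
  - by move=> a a'; exact: heat_coef_unique.
by rewrite E mulrA mulrNN mulfV ?mul1r // expf_neq0.
Qed.

End MainRules.

(** * Jets under inversion and the rules for the second and zeroth coefficients *)

Lemma inversion_jet1_algebra (K : comNzRingType) (i a b : K) :
  - (i * i) * ((0 * (i * i) + -1 * (1 * i + i * 1)) * a + -1 * (i * i) * b) =
  2 * (i * (i * i)) * a + i * (i * (i * i)) * b.
Proof. by ring. Qed.

Lemma inversion_jet2_algebra (K : comNzRingType) (i a b c : K) :
  - (i * i) *
  ((0 * (i * (i * i)) + 2 * (1 * (i * i) + i * (1 * i + i * 1))) * a
   + 2 * (i * (i * i)) * b
   + ((1 * (i * (i * i)) + i * (1 * (i * i) + i * (1 * i + i * 1))) * b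
      + i * (i * (i * i)) * c)) =
  - (6 * i ^+ 4 * a + 6 * i ^+ 5 * b + i ^+ 6 * c).
Proof. by ring. Qed.

(* The jets of f at i = 1 / x and of x -> - x ^- 2 * f (1 / x) at x. *)
Definition inverted_jet (K : pzRingType) (i : K) (f g : nat -> K) : Prop :=
  [/\ g 0%N = - i ^+ 2 * f 0%N, g 1%N = 2 * i ^+ 3 * f 0%N + i ^+ 4 * f 1%N
    & g 2%N = - (6 * i ^+ 4 * f 0%N + 6 * i ^+ 5 * f 1%N + i ^+ 6 * f 2%N)].

Definition square_jet (K : pzRingType) (d u : K) (f : nat -> K) : Prop :=
  [/\ f 0%N = d * u ^+ 2, f 1%N = 2 * d * u & f 2%N = 2 * d].

(** With [i = 1 / mu] and [u = i + q], the quotient [u / (q i)] is [mu + q^-1]; expressing both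
    sides through [u] leaves a rational identity in independent variables. *)
Lemma a2_invert_algebra (K : numClosedFieldType) (f1 f2 f3 f g1 g2 g3 g : nat -> K) i q d u :
  i != 0 -> q != 0 -> d != 0 -> u != 0 ->
  f1 0%N != 0 -> f2 0%N != 0 -> f3 0%N != 0 ->
  inverted_jet i f1 g3 -> inverted_jet i f2 g2 -> inverted_jet i f3 g1 ->
  square_jet d u f -> square_jet d (u / (q * i)) g ->
  a2 f1 f2 f3 f = q ^+ 2 * i ^- 2 * a2 g1 g2 g3 g.
Proof.
rewrite /a2 => i0 q0 d0 u0 h1 h2 h3 [-> -> ->] [-> -> ->] [-> -> ->] [-> -> ->] [-> -> ->].
move: (f1 0%N) (f2 0%N) (f3 0%N) h1 h2 h3 => x1 x2 x3 h1 h2 h3.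
move: (f1 1%N) (f2 1%N) (f3 1%N) (f1 2%N) (f2 2%N) (f3 2%N) => y1 y2 y3 z1 z2 z3.
by field; rewrite i0 q0 u0 d0 h1 h2 h3.
Qed.

Lemma a2_swap23 (K : numClosedFieldType) (f1 f2 f3 f : nat -> K) : a2 f1 f3 f2 f = a2 f1 f2 f3 f.
Proof. rewrite /a2 !invfM; ring. Qed.

Lemma square_jet_algebra (K : comNzRingType) (d u : K) :
  0 * (u * u) + d * (1 * u + u * 1) = 2 * d * u.
Proof. by ring. Qed.

Lemma shift_invert_algebra (K : fieldType) (z q : K) : z != 0 -> q != 0 ->
  z + q^-1 = (z^-1 + q) / (q / z).
Proof. by move=> z0 q0; field; rewrite z0 q0. Qed.

Section InversionJets.

Local Open Scope classical_set_scope.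

Variable K : numClosedFieldType.
Implicit Types (x : K) (k : nat).

Lemma is_derive_comp_inv (h : K -> K) x d : x != 0 -> is_derive x^-1 (1 : K) h d ->
  is_derive x (1 : K) (fun t => h t^-1) (- (x^-1 * x^-1) * d).
Proof.
move=> x0 dh; have := is_derive_comp (is_derive_inv x0 (is_derive_id x (1 : K))) dh.
by move=> h1; apply: (is_derive_eq h1); rewrite mulN1r mulrC.
Qed.

Lemma inversion_jets (A B : set K) (f v : K -> K) x : open A -> A x ->
  (forall t, A t -> t != 0 /\ B t^-1) -> smooth_on B f ->
  (forall t, A t -> v t = - (t^-1 * t^-1) * f t^-1) ->
  inverted_jet x^-1 (fun k => derive1n k f x^-1) (fun k => derive1n k v x).
Proof.
move=> oA Ax AB hf hv.
have d0 s : B s -> is_derive s (1 : K) f (derive1 f s) by move=> hs; exact: smooth_is_derive hf hs.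
have d1 s : B s -> is_derive s (1 : K) (derive1 f) (derive1 (derive1 f) s).
  by move=> hs; exact: smooth_is_derive (smooth_on_derive1 hf) hs.
have id' s : is_derive s (1 : K) (fun x : K => x) 1 by exact: is_derive_id.
(* [v] and its derivative are written as functions of [s = 1 / t], so that each differentiation is a
   chain rule with factor [- s ^ 2]. *)
pose h0 (s : K) := cst (-1) s * (s * s) * f s.
pose h1 (s : K) := cst 2 s * (s * (s * s)) * f s + s * (s * (s * s)) * derive1 f s.
have e0 t : A t -> derive1 v t = h1 t^-1.
  move=> At; have [t0 Bt] := AB t At.
  have E y : A y -> v y = h0 y^-1 by move=> Ay; rewrite hv // /h0 /cst mulN1r.
  refine (etrans (@near_derive1 K v (fun t => h0 t^-1) A t oA At E) (is_derive_derive1 _)).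
  apply: (is_derive_eq (is_derive_comp_inv t0 (is_derive_mul (is_derive_mul
    (is_derive_cst (-1 : K) _ _) (is_derive_mul (id' _) (id' _))) (d0 _ Bt)))).
  exact (inversion_jet1_algebra _ _ _).
have e1 t : A t -> derive1 (derive1 v) t =
    - (6 * t^-1 ^+ 4 * f t^-1 + 6 * t^-1 ^+ 5 * derive1 f t^-1 + t^-1 ^+ 6 * derive1 (derive1 f) t^-1).
  move=> At; have [t0 Bt] := AB t At.
  refine (etrans (@near_derive1 K (derive1 v) (fun t => h1 t^-1) A t oA At e0) (is_derive_derive1 _)).
  have c3 := is_derive_mul (id' t^-1) (is_derive_mul (id' t^-1) (id' t^-1)).
  apply: (is_derive_eq (is_derive_comp_inv t0 (is_deriveD
    (is_derive_mul (is_derive_mul (is_derive_cst (2 : K) _ _) c3) (d0 _ Bt))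
    (is_derive_mul (is_derive_mul (id' t^-1) c3) (d1 _ Bt))))).
  exact (inversion_jet2_algebra _ _ _ _).
split; [|rewrite -[LHS]/(derive1 v x) e0 // /h1 /cst|exact: e1].
- by rewrite /= hv // -expr2.
Qed.

End InversionJets.

Section SecondCoefficient.

Local Open Scope classical_set_scope.

Variable R : realType.
Local Notation C := (CC R).
Implicit Types (z mu q x : C) (b : 'I_4) (k n : nat) (c : R).

Lemma square_jet_F c q x : square_jet c%:C%C (x + q) (jet (F c q) x).
Proof.
have dx (t : C) : is_derive t (1 : C) (fun y : C => y + q) 1.
  apply: (is_derive_eq (is_deriveD (is_derive_id t (1 : C)) (is_derive_cst q t (1 : C)))).
  by rewrite addr0.
have d1 : derive1 (F c q) = (fun t => cst (2 * c%:C%C) t * (t + q)).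
  apply/funext => t; apply: is_derive_derive1.
  apply: (is_derive_eq (is_derive_mul (is_derive_cst (c%:C%C : C) t (1 : C)) (is_derive_mul (dx t) (dx t)))).
  exact (square_jet_algebra _ _).
split=> //.
  by rewrite -[LHS]/(derive1 (F c q) x) d1.
rewrite -[LHS]/(derive1 (derive1 (F c q)) x) d1; apply: is_derive_derive1.
apply: (is_derive_eq (is_derive_mul (is_derive_cst (2 * c%:C%C : C) x (1 : C)) (dx x))).
by rewrite mul0r add0r mulr1.
Qed.

Lemma atilde2_translate c q mu : 0 < complex.Re mu ->
  atilde2 c q (mu - 'i) = atilde2 c (q - 'i) mu.
Proof.
by move=> mu0; rewrite /atilde2 (on_family_translate (@a2 C) c q mu0) a2_swap23.
Qed.

Lemma w_inverted_jet b q mu : b != ord0 -> q != 0 -> w_domain q mu^-1 ->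
  inverted_jet mu^-1 (jet (w b q) mu^-1) (jet (w (swap13 b) q^-1) mu).
Proof.
move=> b0 q0 hmu; have A1 := w_domain_invert q0 hmu.
apply: (inversion_jets (@open_w_domain R q^-1) A1 (B := w_domain q)).
- move=> t At; split; first by case: At => /mu_neq0.
  exact: w_domain_inv.
- exact: w_smooth.
- move=> t At; have [t0 _] := At; have t1 := mu_neq0 t0; have [_ h] := w_domain_inv q0 At.
  rewrite (w_invert b0 t0 q0 h); exact: w_invert_cancel_sym.
Qed.

Lemma atilde2_invert c q mu : 0 < c -> q != 0 -> regular q mu^-1 -> 0 < complex.Re mu ->
  atilde2 c q mu^-1 = q ^+ 2 * mu ^+ 2 * atilde2 c q^-1 mu.
Proof.
move=> c0 q0 [hmu hw] mu0; have m0 := mu_neq0 mu0.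
have Amu : w_domain q mu^-1 by split=> //; exact: Re_inv_gt0.
have [s1 s2 s3] := swap13E.
have J (j : nat) (hj : (0 < j < 4)%N) := w_inverted_jet (inord_neq0 hj) q0 Amu.
move: (J 1%N isT) (J 2%N isT) (J 3%N isT); rewrite s1 s2 s3 !inordK // => j1 j2 j3.
have E : mu ^+ 2 = mu^-1 ^- 2 by rewrite exprVn invrK.
have d0 : c%:C%C != 0 :> C by rewrite fmorph_eq0 gt_eqF.
have [zq _] := hmu.
rewrite E; apply: (a2_invert_algebra _ q0 d0 zq _ _ _ j1 j2 j3).
- by rewrite invr_eq0.
- exact: hw.
- exact: hw.
- exact: hw.
- exact: square_jet_F.
have <- : mu + q^-1 = (mu^-1 + q) / (q / mu) by exact: shift_invert_algebra.
exact: square_jet_F.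
Qed.

End SecondCoefficient.

Lemma a0_swap23 (K : numClosedFieldType) (f1 f2 f3 f : nat -> K) :
  a0 f1 f3 f2 f = a0 f1 f2 f3 f.
Proof. by rewrite /a0 mulrAC. Qed.

Lemma a0_invert_algebra (K : numClosedFieldType) (x1 x2 x3 f q z : K) : z != 0 ->
  4 * (q ^+ 2 * z ^- 2 * f) ^+ 2 * (- z ^+ 2 * x3) * (- z ^+ 2 * x2) * (- z ^+ 2 * x1) =
  - q ^+ 4 * z ^+ 2 * (4 * f ^+ 2 * x1 * x2 * x3).
Proof. by move=> z0; field. Qed.

Lemma atilde0_invert (R : realType) (c : R) (q mu : CC R) : q != 0 -> 0 < complex.Re mu ->
  w_defined q mu^-1 -> atilde0 c q mu^-1 = - q ^+ 4 * mu ^+ 2 * atilde0 c q^-1 mu.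
Proof.
move=> q0 mu0 h; have m0 := mu_neq0 mu0; have [s1 s2 s3] := swap13E.
have J (j : nat) (hj : (0 < j < 4)%N) := w_invert (inord_neq0 hj) mu0 q0 h.
move: (J 1%N isT) (J 2%N isT) (J 3%N isT); rewrite s1 s2 s3 !inordK // => j1 j2 j3.
rewrite /atilde0 /on_family /a0 /jet /= j1 j2 j3 (F_invert c m0 q0).
exact: a0_invert_algebra.
Qed.

Theorem theorem6p3 (R : realType) (c : R) (q0 mu : CC R)
    (c_gt0 : 0 < c) (mu_gt0 : 0 < complex.Re mu) :
  [/\ w_defined q0 (mu - 'i) ->
        atilde0 c q0 (mu - 'i) = atilde0 c (q0 - 'i) mu,
      q0 != 0 -> w_defined q0 mu^-1 ->
        atilde0 c q0 mu^-1 = - q0 ^+ 4 * mu ^+ 2 * atilde0 c q0^-1 mu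
    & [/\ regular q0 (mu - 'i) ->
            atilde2 c q0 (mu - 'i) = atilde2 c (q0 - 'i) mu,
          q0 != 0 -> regular q0 mu^-1 ->
            atilde2 c q0 mu^-1 = q0 ^+ 2 * mu ^+ 2 * atilde2 c q0^-1 mu,
          regular q0 (mu - 'i) ->
            atilde4 c q0 (mu - 'i) = atilde4 c (q0 - 'i) mu
        & q0 != 0 -> regular q0 mu^-1 ->
            atilde4 c q0 mu^-1 = - mu ^+ 2 * atilde4 c q0^-1 mu]].
Proof.
split.
- by move=> _; rewrite /atilde0 (on_family_translate (@a0 (CC R)) c q0 mu_gt0) a0_swap23.
- by move=> hq h; exact: atilde0_invert.
split.
- by move=> _; exact: atilde2_translate.
- by move=> hq h; exact: atilde2_invert.
- by move=> [h _]; exact: atilde4_translate.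
- by move=> hq [h _]; apply: atilde4_invert => //; split=> //; exact: Re_inv_gt0.
Qed.
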